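(* Let $(A_n)_{n\in\mathbb N}$ be a sequence of symmetric random matrices satisfying assumptions (i)--(iii) of the context, with associated means $\mu_n$ and variances $\sigma_n^2$. Fix any $r\in[2,\infty)$, set $p=r^*=r/(r-1)$, and let $\bar A_n:=n^{-(1-\frac2r)}A_n$. Then, as $n\to\infty$, $$\frac1{\sigma_n}\big(M_r(\bar A_n)-\alpha_n(p,r)\big)\xrightarrow{d}Z\sim\mathrm{Normal}(0,2),\qquad\text{where}\quad \alpha_n(p,r)=(n-1)\mu_n+\Big(p-1+\frac1{r-1}\Big)\frac{\sigma_n^2}{2\mu_n}.$$
   Context: $M_r(A):=\sup_{x\in\mathbb R^n:\|x\|_r\le1}x^TAx$, where $\|x\|_r=(\sum_i|x_i|^r)^{1/r}$. $\mathrm{Normal}(m,s^2)$ is the normal law with mean $m$ and variance $s^2$; $\xrightarrow{d}$ is convergence in distribution. $f(n)=\omega(g(n))$ means $f(n)/g(n)\to\infty$. Assumptions on the matrices. For each $n\ge1$, $F_n$ is a distribution supported on $[0,\infty)$ with finite mean $\mu_n$ and variance $\sigma_n^2$, and $A_n=(a^n_{ij})_{i,j=1}^n$ is a symmetric random matrix such that: (i) $(a^n_{ij})_{1\le i<j\le n}$ are i.i.d. with common distribution $F_n$, and $a^n_{ii}=0$ for all $i\in[n]=\{1,\dots,n\}$; (ii) $\mu_n=O(1)$, $\mu_n=\omega\big(\frac{\log^{2/3}n}{n^{1/3}}\big)$, $\sigma_n\ge n^{-\frac12+c_0}$ for some constant $c_0>0$, and $\frac{\sigma_n^2}{\mu_n}=O(1)$;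 (iii) there exists $c<\infty$ (independent of $n$) such that $\mathbb E\big[|a^n_{12}-\mu_n|^k\big]\le\frac{k!}{2}c^{k-2}\sigma_n^2$ for all $k\ge3$. *)

(* Defs.v *)
From HB Require Import structures.
From mathcomp Require Import all_boot all_order all_algebra.
From mathcomp Require Import all_classical all_reals all_analysis.
Import Order.TTheory GRing.Theory Num.Theory.
Import numFieldNormedType.Exports.

Set Implicit Arguments.
Unset Strict Implicit.
Unset Printing Implicit Defensive.

Local Open Scope classical_set_scope.
Local Open Scope ring_scope.

Definition lr_norm (R : realType) (r : R) (n : nat) (x : 'cV[R]_n) : R :=
  (\sum_(i < n) `|x i 0| `^ r) `^ r^-1.

(* The set is nonempty (it contains x = 0) and, for 0 < r, bounded above, so
   [sup] is the genuine supremum. *)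
Definition max_quad_form (R : realType) (r : R) (n : nat) (B : 'M[R]_n) : R :=
  sup [set (x^T *m B *m x) 0 0 | x in [set x : 'cV[R]_n | lr_norm r x <= 1]].

Definition little_omega (R : realType) (f g : nat -> R) : Prop :=
  (f n / g n) @[n --> \oo] --> +oo.

Definition mutually_independent (d : measure_display) (T : measurableType d)
    (R : realType) (P : probability T R) (I : finType) (D : {set I})
    (X : I -> T -> R) : Prop :=
  forall J : {set I}, J \subset D ->
  forall B : I -> set R, (forall i, measurable (B i)) ->
    P (\bigcap_(i in [set` J]) (X i @^-1` B i)) =
    (\prod_(i in J) P (X i @^-1` B i))%E.

(* The X n may live on different probability spaces; that they are random
   variables is part of the claim. *)
Definition cvg_in_distribution (R : realType) (d : nat -> measure_display)
    (T : forall n, measurableType (d n)) (P : forall n, probability (T n) R)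
    (X : forall n, T n -> R) (d' : measure_display) (T' : measurableType d')
    (Q : probability T' R) (Z : {RV Q >-> R}) : Prop :=
  (forall n, measurable_fun [set: T n] (X n)) /\
  (forall t : R, {for t, continuous (cdf Z)} ->
    P n [set w | X n w <= t] @[n --> \oo] --> cdf Z t).

Definition alpha (R : realType) (mu sigma : nat -> R) (p r : R) (n : nat) : R :=
  (n%:R - 1) * mu n + (p - 1 + (r - 1)^-1) * (sigma n ^+ 2 / (2 * mu n)).

(* Main.v *)
(** Let [W] be [A_n - mu_n] off the diagonal, [S] the sum of its entries above
    the diagonal, and [t = sigma_n / (sqrt n * mu_n)].  After division by
    [n * mu_n], the matrix is a small perturbation of a multiple of the all-ones
    matrix, with row sums [D + (r - 1) * a i] where [\sum_i a i = 0]; the maximum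
    of its form on the l^r ball is [D + (\sum_i a i ^ 2) / n + O(t ^ 3)], attained
    near the direction [1 + a].  The lower bound evaluates the form there.  For
    the upper bound, the spectral gap on the orthogonal complement of the
    constants gives [y^T B y <= lam * \sum_i y_i ^ 2 * (1 + (r - 2) * a i)], and
    Young's inequality turns the weighted l^2 norm into the l^r norm.  Undoing the
    scaling, [D] contributes [(n - 1) * mu_n + 2 * S / n], the mean of [a ^ 2]
    concentrates at the correction in [alpha], and the remainder is [o(sigma_n)].

    All that is needed of [W] is that a few sums of squares of polynomials of
    degree at most 2 in its entries are within a constant of their expectations;
    these are computed by orthogonality and controlled by Markov's inequality.  In
    particular the spectral norm is bounded through [W ^ 2].

    Finally [2 * S / (n * sigma_n)] converges to Normal(0, 2) by Stein's method:
    each summand is independent of the rest of the sum, and the solution [g] of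
    [2 * g' - x * g = f - E f(Z)] has a bounded Lipschitz derivative because every
    bounded solution of [y' = x * y / 2 + k] satisfies [|x * y| <= 2 * sup |k|]. *)

Require Import Defs.
From HB Require Import structures.
From mathcomp Require Import all_boot all_order all_algebra.
From mathcomp Require Import all_classical all_reals all_analysis.
From mathcomp Require Import measurable_realfun zify ring lra.
Import Order.TTheory GRing.Theory Num.Theory.
Import numFieldNormedType.Exports.

Local Open Scope classical_set_scope.
Local Open Scope ring_scope.

Set Implicit Arguments.
Unset Strict Implicit.
Unset Printing Implicit Defensive.

(** * Calculus *)

(** Writing the row sums as [D + (r - 1) * a i] comes from the Lagrange condition
    [B x = lam * x^(r-1)]: since [B] nearly annihilates mean-zero vectors and [D] is near 1,
    [x = 1 + a] satisfies it to first order. No maximizer is ever located; the upper bound treats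
    all vectors at once, because the weighted form matches [B] to first order at [1 + a] and
    dominates it on mean-zero vectors. The cubic remainder is dictated by the scaling: [t ^ 3]
    becomes [n * mu_n * t ^ 3 / sigma_n = sqrt n * t ^ 2 = (sigma_n ^ 2 / mu_n) / (sqrt n * mu_n)],
    which tends to 0, whereas the second-order term yields the shift in [alpha]. The same quantity
    governs the rest: the largest [|a i|] and the spectral norm are bounded through fourth powers,
    of size [n * t ^ 4 = (sqrt n * t ^ 2) ^ 2], so neither a union bound nor exponential
    concentration enters. In the expansion of the maximum, randomness enters only through the event
    that one statistic is at most a constant [K]; on it every estimate is deterministic. *)

Section derive_pointwise.
Context {R : realType}.
Implicit Types (f g : R -> R) (x a b c : R).

Lemma is_deriveB_fun f g x a b :
  is_derive x (1 : R) f a -> is_derive x (1 : R) g b ->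
  is_derive x (1 : R) (fun y => f y - g y) (a - b).
Proof. exact: is_deriveB. Qed.

Lemma is_deriveD_fun f g x a b :
  is_derive x (1 : R) f a -> is_derive x (1 : R) g b ->
  is_derive x (1 : R) (fun y => f y + g y) (a + b).
Proof. exact: is_deriveD. Qed.

Lemma is_deriveM_fun f g x a b :
  is_derive x (1 : R) f a -> is_derive x (1 : R) g b ->
  is_derive x (1 : R) (fun y => f y * g y) (a * g x + f x * b).
Proof.
move=> fa gb; have := is_deriveM fa gb.
by rewrite (_ : f x *: b + _ = a * g x + f x * b)// addrC [X in X + _]mulrC.
Qed.

Lemma is_deriveZ_fun f c x a :
  is_derive x (1 : R) f a -> is_derive x (1 : R) (fun y => c * f y) (c * a).
Proof. exact: is_deriveZ. Qed.

Lemma is_derive_sqr x : is_derive x (1 : R) (fun y => y ^+ 2) (2 * x).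
Proof.
have := is_deriveX 2 (is_derive_id x (1 : R)).
by rewrite /= expr1 (_ : _ *: _ = 2 * x)//; exact: mulr1.
Qed.

Lemma is_derive_comp_fun f g x a b :
  is_derive (g x) (1 : R) f a -> is_derive x (1 : R) g b ->
  is_derive x (1 : R) (fun y => f (g y)) (a * b).
Proof. exact: is_derive1_comp. Qed.

End derive_pointwise.

(** For [|x| <= 1/2] both [1 + x] and its inverse are at most 2, so [ln y < y] gives
    [|ln (1 + x)| <= 2]. *)
Lemma powR_bounded_near1 (R : realType) (u : R) :
  exists2 C : R, 0 <= C & forall x, `|x| <= 1/2 -> (1 + x) `^ u <= C.
Proof.
exists (expR (`|u| * 2)); first exact: expR_ge0.
move=> x; rewrite ler_norml => /andP[x1 x2].
have x0 : 0 < 1 + x by lra.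
rewrite /powR gt_eqF// ler_expR (le_trans (ler_norm _))// normrM ler_wpM2l//.
rewrite ler_norml; apply/andP; split; last first.
  by apply: (le_trans (ltW (ln_sublinear _))); lra.
have := @ln_sublinear R (1 + x)^-1; rewrite invr_gt0 => /(_ x0).
rewrite lnV ?posrE// => h.
have : (1 + x)^-1 <= 2 by rewrite -[leRHS]invrK lef_pV2 ?posrE ?invr_gt0; lra.
lra.
Qed.

(** The mean value theorem gains one power of [|x|]; the factor [1 / (k + 1)] of a true integration
    is given up. *)
Lemma integrate_bound (R : realType) (f df : R -> R) (C : R) (k : nat) :
  (forall x : R, `|x| <= 1/2 -> is_derive x (1 : R) f (df x)) ->
  (forall x, `|x| <= 1/2 -> `|df x| <= C * `|x| ^+ k) ->
  forall x, `|x| <= 1/2 -> `|f x - f 0| <= C * `|x| ^+ k.+1.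
Proof.
move=> fd dfC x; rewrite ler_norml => /andP[x1 x2].
have C0 : 0 <= C.
  have := dfC (1/2); rewrite ger0_norm; last by lra.
  move=> /(_ (lexx _)) h.
  have : 0 <= C * (1/2) ^+ k by apply: le_trans h.
  by rewrite pmulr_lge0// exprn_gt0//; lra.
have cont (a b : R) : -(1/2) <= a -> b <= 1/2 -> {within `[a, b], continuous f}.
  move=> a1 b1; apply: derivable_within_continuous => z.
  rewrite in_itv/= => /andP[az zb]; apply: ex_derive.
  by apply: fd; rewrite ler_norml; apply/andP; split; lra.
have [x0|x0] := leP 0 x.
  have [z|//|c] := @MVT_segment R f df 0 x x0; rewrite ?in_itv/=.
  - move=> /andP[z0 zx]; apply: fd; rewrite ler_norml; apply/andP; split; lra.
  - by apply: cont; lra.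
  move=> /andP[c0 cx] ->; rewrite subr0 normrM exprSr mulrA ler_wpM2r//.
  apply: (le_trans (dfC _ _)); first by rewrite ler_norml; apply/andP; split; lra.
  by rewrite ler_wpM2l// lerXn2r ?nnegrE// ger0_norm// ger0_norm.
have [z|//|c] := @MVT_segment R f df x 0 (ltW x0); rewrite ?in_itv/=.
- move=> /andP[z0 zx]; apply: fd; rewrite ler_norml; apply/andP; split; lra.
- by apply: cont; lra.
move=> /andP[c0 cx]; rewrite distrC => ->.
rewrite sub0r normrM normrN exprSr mulrA ler_wpM2r//.
apply: (le_trans (dfC _ _)); first by rewrite ler_norml; apply/andP; split; lra.
by rewrite ler_wpM2l// lerXn2r ?nnegrE// ler0_norm// ltr0_norm// lerN2.
Qed.

(** The bound on [(1 + x) ^ (s - 3)] is integrated three times, each time after subtracting the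
    Taylor polynomial found so far. *)
Lemma powR_taylor3 (R : realType) (s : R) :
  exists2 C : R, 0 <= C & forall x, `|x| <= 1/2 ->
    (1 + x) `^ s <= 1 + s * x + s * (s - 1) / 2 * x ^+ 2 + C * `|x| ^+ 3.
Proof.
have pos (x : R) : `|x| <= 1/2 -> 0 < 1 + x.
  by rewrite ler_norml => /andP[x1 x2]; lra.
have dpow (u x : R) : `|x| <= 1/2 ->
    is_derive x 1 (fun x => (1 + x) `^ u) (u * (1 + x) `^ (u - 1)).
  move=> /pos x0.
  rewrite -[X in is_derive _ _ _ X]mulr1.
  apply: (is_derive_comp_fun (f := fun y : R => y `^ u)).
    exact: is_derive1_powR.
  rewrite -[X in is_derive _ _ _ X]add0r.
  exact: (is_deriveD_fun (f := fun=> 1)).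
have [B B0 HB] := powR_bounded_near1 (s - 3).
have step0 (x : R) : `|x| <= 1/2 ->
    `|(1 + x) `^ (s - 2) - 1| <= `|s - 2| * B * `|x| ^+ 1.
  have /= := @integrate_bound R (fun x => (1 + x) `^ (s - 2))
    (fun x => (s - 2) * (1 + x) `^ (s - 2 - 1)) (`|s - 2| * B) 0.
  rewrite addr0 powR1; apply.
  move=> y /HB h; rewrite expr0 mulr1 normrM ler_wpM2l// ger0_norm ?powR_ge0//.
  by rewrite (_ : s - 2 - 1 = s - 3)//; ring.
have step1 (x : R) : `|x| <= 1/2 ->
    `|(1 + x) `^ (s - 1) - (1 + (s - 1) * x)| <=
      `|s - 1| * (`|s - 2| * B) * `|x| ^+ 2.
  have /= := @integrate_bound R (fun x => (1 + x) `^ (s - 1) - (s - 1) * x)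
    (fun x => (s - 1) * ((1 + x) `^ (s - 2) - 1)) (`|s - 1| * (`|s - 2| * B)) 1.
  rewrite addr0 powR1 mulr0 subr0 => h xh.
  rewrite (_ : _ - _ = (1 + x) `^ (s - 1) - (s - 1) * x - 1); last by ring.
  apply: h => // y yh.
    have -> : (s - 1) * ((1 + y) `^ (s - 2) - 1) =
      (s - 1) * (1 + y) `^ (s - 1 - 1) - (s - 1) * 1.
      by rewrite (_ : s - 1 - 1 = s - 2); ring.
    apply: is_deriveB_fun; exact: dpow.
  by rewrite normrM -!mulrA ler_wpM2l// mulrA step0.
exists (`|s| * (`|s - 1| * (`|s - 2| * B))).
  by rewrite !mulr_ge0.
move=> x xh; rewrite -lerBlDl (le_trans (ler_norm _))//.
have /= := @integrate_bound R
    (fun x => (1 + x) `^ s - s * x - (s * (s - 1) / 2) * x ^+ 2)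
    (fun x => s * ((1 + x) `^ (s - 1) - (1 + (s - 1) * x)))
    (`|s| * (`|s - 1| * (`|s - 2| * B))) 2.
rewrite addr0 powR1 mulr0 subr0 expr0n/= mulr0 subr0 => h.
rewrite (_ : _ - _ = (1 + x) `^ s - s * x - s * (s - 1) / 2 * x ^+ 2 - 1); last by ring.
apply: h => // y yh; last first.
  by rewrite normrM -[leRHS]mulrA ler_wpM2l//= step1.
have -> : s * ((1 + y) `^ (s - 1) - (1 + (s - 1) * y)) =
  (s * (1 + y) `^ (s - 1) - s * 1) - (s * (s - 1) / 2) * (2 * y).
  by field.
apply: is_deriveB_fun.
  apply: is_deriveB_fun; exact: dpow.
exact/is_deriveZ_fun/is_derive_sqr.
Qed.

(** * Quadratic forms near the all-ones matrix *)

Section quadratic_form.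
Context {R : realType} {n : nat}.
Implicit Types (B : 'M[R]_n) (x y a g : 'I_n -> R).

Definition mulmf B x : 'I_n -> R := fun i => \sum_j B i j * x j.
Definition qform B x : R := \sum_i x i * mulmf B x i.

Lemma mulmfD B x y i : mulmf B (fun k => x k + y k) i = mulmf B x i + mulmf B y i.
Proof. by rewrite -big_split/=; apply: eq_bigr => j _; rewrite mulrDr. Qed.

Lemma mulmfZ B c x i : mulmf B (fun k => c * x k) i = c * mulmf B x i.
Proof. by rewrite mulr_sumr; apply: eq_bigr => j _; rewrite mulrCA. Qed.

Lemma qformZ B c x : qform B (fun k => c * x k) = c ^+ 2 * qform B x.
Proof.
by rewrite /qform mulr_sumr; apply: eq_bigr => i _; rewrite mulmfZ; ring.
Qed.

Lemma mulmf_sym B x y : B^T = B ->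
  \sum_i x i * mulmf B y i = \sum_i y i * mulmf B x i.
Proof.
move=> Bs; under eq_bigr do rewrite mulr_sumr.
rewrite exchange_big/=; apply: eq_bigr => j _.
rewrite mulr_sumr; apply: eq_bigr => i _.
by rewrite -[in RHS]Bs mxE; ring.
Qed.

End quadratic_form.

Section perturbed_constant.
Context {R : realType} {n : nat}.
(** Here [t] is the relative size of the row-sum fluctuations and [K] absorbs every constant. [Ba]
    is one order better than [a2], because [B] is close to a multiple of the all-ones matrix and [a]
    has mean zero; [amax] keeps the weights [1 + (r - 2) * a i] away from 0. *)
Variables (B : 'M[R]_n) (a : 'I_n -> R) (D K t r : R).
Hypothesis n0 : (0 < n)%N.
Hypothesis r2 : 2 <= r.
Hypothesis K1 : 1 <= K.
Hypothesis t0 : 0 < t.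
Hypothesis Bsym : B^T = B.
Hypothesis rowB : forall i, \sum_j B i j = D + (r - 1) * a i.
Hypothesis sa : \sum_i a i = 0.
Hypothesis Dt : `|D - 1| <= K * t.
Hypothesis a2 : \sum_i a i ^+ 2 <= K * n%:R * t ^+ 2.
Hypothesis a4 : \sum_i a i ^+ 4 <= K * n%:R * t ^+ 4.
Hypothesis Ba : \sum_i mulmf B a i ^+ 2 <= K * n%:R * t ^+ 4.
Hypothesis amax : forall i, `|a i| <= 1 / (4 * r).
Hypothesis gap : forall g, \sum_i g i = 0 ->
  qform B g <= 1 / 4 * \sum_i g i ^+ 2.

Let N : R := n%:R.
Let N0 : 0 < N. Proof. by rewrite ltr0n. Qed.
Let S2 := \sum_i a i ^+ 2.
Let b := mulmf B a.

Lemma mulmf1 i : mulmf B (fun=> 1) i = D + (r - 1) * a i.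
Proof. by rewrite -rowB; apply: eq_bigr => j _; rewrite mulr1. Qed.

Lemma sum_mulmf_a : \sum_i b i = (r - 1) * S2.
Proof.
transitivity (\sum_i 1 * b i); first by apply: eq_bigr => i _; rewrite mul1r.
rewrite (mulmf_sym (fun=> 1) a Bsym).
under eq_bigr do rewrite mulmf1 mulrDr.
rewrite big_split/= -mulr_suml sa mul0r add0r mulr_sumr.
by apply: eq_bigr => i _; ring.
Qed.

(** Interpolation between second and fourth powers: [t * |a| ^ 3 <= (t ^ 2 * a ^ 2 + a ^ 4) / 2].
    The next lemma follows in the same way, with [b i] in place of [a i ^ 2]. *)
Lemma sum_norm_a3 : \sum_i `|a i| ^+ 3 <= K * N * t ^+ 3.
Proof.
have t0' := t0.
rewrite -(ler_pM2l t0).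
have h : \sum_i t * `|a i| ^+ 3 <= 1 / 2 * (t ^+ 2 * S2 + \sum_i a i ^+ 4).
  rewrite /S2 mulr_sumr -big_split/= mulr_sumr; apply: ler_sum => i _.
  have -> : a i ^+ 4 = `|a i| ^+ 4 by rewrite -normrX ger0_norm// exprn_even_ge0.
  have -> : a i ^+ 2 = `|a i| ^+ 2 by rewrite -normrX ger0_norm// sqr_ge0.
  have := sqr_ge0 (t * `|a i| - `|a i| ^+ 2); nra.
rewrite mulr_sumr (le_trans h)//.
have -> : t * (K * N * t ^+ 3) =
    1 / 2 * (t ^+ 2 * (K * N * t ^+ 2) + K * N * t ^+ 4) by field.
by rewrite ler_wpM2l ?divr_ge0// lerD// ler_wpM2l// sqr_ge0.
Qed.

Lemma sum_norm_ab : \sum_i `|a i * b i| <= K * N * t ^+ 3.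
Proof.
rewrite -(ler_pM2l t0).
have h : \sum_i t * `|a i * b i| <= 1 / 2 * (t ^+ 2 * S2 + \sum_i b i ^+ 2).
  rewrite /S2 mulr_sumr -big_split/= mulr_sumr; apply: ler_sum => i _.
  have -> : b i ^+ 2 = `|b i| ^+ 2 by rewrite -normrX ger0_norm// sqr_ge0.
  have -> : a i ^+ 2 = `|a i| ^+ 2 by rewrite -normrX ger0_norm// sqr_ge0.
  rewrite normrM.
  have := sqr_ge0 (t * `|a i| - `|b i|); nra.
rewrite mulr_sumr (le_trans h)//.
have -> : t * (K * N * t ^+ 3) =
    1 / 2 * (t ^+ 2 * (K * N * t ^+ 2) + K * N * t ^+ 4) by field.
by rewrite ler_wpM2l ?divr_ge0// lerD// ler_wpM2l// sqr_ge0.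
Qed.

Lemma qform_1D_a : qform B (fun i => 1 + a i) =
  N * D + 2 * (r - 1) * S2 + \sum_i a i * b i.
Proof.
transitivity (\sum_i (D + (r - 1) * a i ^+ 2 + (r - 1 + D) * a i + b i + a i * b i)).
  by apply: eq_bigr => i _; rewrite mulmfD mulmf1 -/b; ring.
rewrite !big_split/= -!mulr_sumr sa sum_mulmf_a sumr_const card_ord -mulr_natl.
by rewrite /S2 /N; ring.
Qed.

(** The constant part [D] of [B (1 + a)] is orthogonal to [g], so only [(r - 1) * a + b] survives in
    the cross term. *)
Lemma qform_decomp (m : R) g : \sum_i g i = 0 ->
  qform B (fun i => m * (1 + a i) + g i) =
  m ^+ 2 * (N * D + 2 * (r - 1) * S2 + \sum_i a i * b i) +
  2 * m * \sum_i g i * ((r - 1) * a i + b i) + qform B g.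
Proof.
move=> g0.
have e1 i : mulmf B (fun k => m * (1 + a k) + g k) i =
    m * mulmf B (fun k => 1 + a k) i + mulmf B g i.
  by rewrite mulmfD mulmfZ.
have cross : \sum_i g i * mulmf B (fun k => 1 + a k) i =
    \sum_i g i * ((r - 1) * a i + b i).
  transitivity (\sum_i (D * g i + g i * ((r - 1) * a i + b i))).
    by apply: eq_bigr => i _; rewrite mulmfD mulmf1 -/b; ring.
  by rewrite big_split/= -mulr_sumr g0 mulr0 add0r.
rewrite -qform_1D_a -cross /qform.
transitivity (\sum_i (m ^+ 2 * ((1 + a i) * mulmf B (fun k => 1 + a k) i) +
  m * (g i * mulmf B (fun k => 1 + a k) i) + m * ((1 + a i) * mulmf B g i) +
  g i * mulmf B g i)).
  by apply: eq_bigr => i _; rewrite e1; ring.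
rewrite !big_split/= -!mulr_sumr (mulmf_sym (fun i => 1 + a i) g Bsym).
ring.
Qed.

(* The weights [1 + (r - 2) * a i] are those of the Hoelder inequality that
   bounds a weighted l^2 norm by the l^r norm; they are proportional, to first
   order, to the (r-2)-nd power of the maximizer [1 + a i]. *)
Lemma qform_le_weighted (C lam : R) :
    (2 * K + 1) * t <= 1 / 8 ->
    2 * r * (2 * K + 1) * K + 2 * r * K + K +
      12 * K * ((2 * K + 1) ^+ 2 * r ^+ 2 + 4 * r ^+ 2 + 1) <= C ->
    C * t ^+ 2 <= 1 ->
    lam = D + S2 / N + C * t ^+ 3 ->
  `|lam - 1| <= (2 * K + 1) * t /\
  forall y, qform B y <= lam * \sum_i y i ^+ 2 * (1 + (r - 2) * a i).
Proof.
move=> Lt HC Ct lamE; have K1' := K1; have r2' := r2; have t0' := t0.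
set L := 2 * K + 1 in Lt HC *.
have Kt : 0 <= (K - 1) * t by rewrite mulr_ge0 ?subr_ge0 ?(ltW t0).
have t1 : t <= 1 by rewrite /L in Lt; nra.
have S20 : 0 <= S2 by apply: sumr_ge0 => i _; exact: sqr_ge0.
have S2N : S2 / N <= K * t ^+ 2.
  rewrite ler_pdivrMr// (le_trans a2)// /N.
  by rewrite (_ : K * n%:R * t ^+ 2 = K * t ^+ 2 * n%:R)//; ring.
have tt : t ^+ 2 <= t by rewrite expr2; nra.
have Ktt : K * t ^+ 2 <= K * t by rewrite ler_wpM2l//; lra.
have C0 : 0 <= C.
  apply: le_trans HC; rewrite !addr_ge0// ?mulr_ge0// ?addr_ge0// ?mulr_ge0//;
  try by [lra | rewrite /L; lra | exact: sqr_ge0 | rewrite exprn_ge0//; lra].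
have Ct3 : C * t ^+ 3 <= t by rewrite exprS mulrCA; nra.
have Ct30 : 0 <= C * t ^+ 3 by rewrite mulr_ge0// exprn_ge0// ltW.
have lam1 : `|lam - 1| <= L * t.
  have SN0 : 0 <= S2 / N by rewrite divr_ge0// ltW.
  move: Dt; rewrite lamE /L !ler_norml => /andP[D1 D2].
  by apply/andP; split; nra.
split=> // y.
have [lam7 lam9] : 7 / 8 <= lam /\ lam <= 9 / 8.
  by move: lam1; rewrite ler_norml => /andP[? ?]; split; lra.
set k := r - 2; have k0 : 0 <= k by rewrite /k; lra.
have kr : k <= r by rewrite /k; lra.
(* Since [1 + a] sums to [N], this coefficient makes the remainder [g] mean-zero. *)
have [m mE] : exists m, m = (\sum_i y i) / N by eexists.
pose g i := y i - m * (1 + a i).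
have g0 : \sum_i g i = 0.
  rewrite /g sumrB -mulr_sumr big_split/= sa addr0 sumr_const card_ord.
  by rewrite mE divfK ?subrr// gt_eqF.
have -> : y = (fun i => m * (1 + a i) + g i).
  by apply/funext => i; rewrite /g addrC subrK.
rewrite qform_decomp//.
(* The mismatch of the two cross terms. The weights satisfy [(1 + a) * (1 + k * a) = 1 + (r - 1) * a
   + k * a ^ 2], so the first-order parts cancel up to [lam - 1] and [e] has order [t ^ 2]. *)
pose e i := (lam - 1) * (r - 1) * a i + lam * k * a i ^+ 2 - b i.
have -> : \sum_i (m * (1 + a i) + g i) ^+ 2 * (1 + k * a i) =
   m ^+ 2 * (N + (1 + 2 * k) * S2 + k * \sum_i a i ^+ 3) +
   2 * m * \sum_i g i * ((r - 1) * a i + k * a i ^+ 2) +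
   \sum_i g i ^+ 2 * (1 + k * a i).
  transitivity (\sum_i (m ^+ 2 * 1 + m ^+ 2 * (2 + k) * a i +
     m ^+ 2 * (1 + 2 * k) * a i ^+ 2 + m ^+ 2 * k * a i ^+ 3 +
     2 * m * g i + 2 * m * (g i * ((r - 1) * a i + k * a i ^+ 2)) +
     g i ^+ 2 * (1 + k * a i))).
    by apply: eq_bigr => i _; rewrite /k; ring.
  rewrite !big_split/= -!mulr_sumr sa g0 sumr_const card_ord /S2 /N.
  by ring.
(* Since [lam >= 7/8] and the weights are at least 3/4, half of the squared norm of [g] is
   available: one quarter pays for [qform B g] by [gap], the other absorbs the cross term by
   completing the square. *)
have gape : 1 / 4 * \sum_i g i ^+ 2 + 1 / 4 * \sum_i g i ^+ 2 <=
    lam * \sum_i g i ^+ 2 * (1 + k * a i).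
  rewrite -mulrDl !mulr_sumr; apply: ler_sum => i _.
  rewrite [leRHS]mulrCA [leLHS]mulrC ler_wpM2l ?sqr_ge0//.
  have : `|k * a i| <= 1 / 4.
    rewrite normrM (ger0_norm k0) (le_trans (ler_pM k0 _ kr (amax i)))//.
    by rewrite (_ : r * _ = 1 / 4)//; field; lra.
  by rewrite ler_norml => /andP[? ?]; nra.
have cross : - (1 / 4 * \sum_i g i ^+ 2) - 4 * m ^+ 2 * \sum_i e i ^+ 2 <=
    2 * m * (lam * \sum_i g i * ((r - 1) * a i + k * a i ^+ 2) -
             \sum_i g i * ((r - 1) * a i + b i)).
  rewrite (mulr_sumr _ _ _ lam) -sumrB !mulr_sumr -opprD -big_split/= -sumrN.
  apply: ler_sum => i _.
  have -> : lam * (g i * ((r - 1) * a i + k * a i ^+ 2)) -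
    g i * ((r - 1) * a i + b i) = g i * e i by rewrite /e; ring.
  have := sqr_ge0 (1 / 2 * g i + 2 * (m * e i)); nra.
have es : \sum_i e i ^+ 2 <= 3 * K * (L ^+ 2 * r ^+ 2 + 4 * r ^+ 2 + 1) * N * t ^+ 3.
  apply: (@le_trans _ _ (3 * ((L * t) ^+ 2 * r ^+ 2 * S2 +
      4 * r ^+ 2 * (\sum_i a i ^+ 4) + \sum_i b i ^+ 2))).
    rewrite /S2 !mulr_sumr -!big_split/= mulr_sumr; apply: ler_sum => i _.
    set u := (lam - 1) * (r - 1) * a i; set v := lam * k * a i ^+ 2.
    have hu : u ^+ 2 <= (L * t) ^+ 2 * r ^+ 2 * a i ^+ 2.
      rewrite /u !exprMn ler_wpM2r ?sqr_ge0//.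
      rewrite ler_pM ?sqr_ge0//; last by rewrite ler_sqr ?nnegrE; lra.
      rewrite -exprMn -[leLHS]real_normK ?num_real// lerXn2r ?nnegrE//.
      exact: le_trans lam1.
    have hv : v ^+ 2 <= 4 * r ^+ 2 * a i ^+ 4.
      rewrite /v exprMn (_ : (a i ^+ 2) ^+ 2 = a i ^+ 4); last by ring.
      rewrite ler_wpM2r ?exprn_even_ge0//.
      rewrite (_ : 4 * r ^+ 2 = (2 * r) ^+ 2); last by ring.
      have lk0 : 0 <= lam * k by rewrite mulr_ge0//; lra.
      have lkr : lam * k <= 2 * r by rewrite ler_pM//; lra.
      by rewrite lerXn2r// nnegrE//; lra.
    rewrite /e -/u -/v.
    have := sqr_ge0 (u - v); have := sqr_ge0 (u + b i); have := sqr_ge0 (v + b i).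
    nra.
  have t43 : t ^+ 4 <= t ^+ 3.
    by rewrite exprS ler_piMl// exprn_ge0// ltW.
  have h2 : S2 <= K * N * t ^+ 2 by [].
  apply: (@le_trans _ _ (3 * K * (L ^+ 2 * r ^+ 2 + 4 * r ^+ 2 + 1) * N * t ^+ 4)).
    have -> : 3 * K * (L ^+ 2 * r ^+ 2 + 4 * r ^+ 2 + 1) * N * t ^+ 4 =
      3 * ((L * t) ^+ 2 * r ^+ 2 * (K * N * t ^+ 2) +
      4 * r ^+ 2 * (K * N * t ^+ 4) + K * N * t ^+ 4) by ring.
    rewrite ler_wpM2l// lerD// lerD//.
      by apply: ler_wpM2l => //; rewrite mulr_ge0 ?sqr_ge0.
    apply: ler_wpM2l; last exact: a4.
    by rewrite mulr_ge0 ?sqr_ge0.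
  apply: ler_wpM2l => //; apply: mulr_ge0; last exact: ltW.
  apply: mulr_ge0; first by lra.
  by rewrite !addr_ge0// mulr_ge0 ?sqr_ge0.
(* The coefficient of [m ^ 2]. To leading order that of [S2] is -1, which the summand [S2 / N] of
   [lam] compensates; all other terms are cubic in [t] and are paid for by [C * t ^ 3]. *)
have main : 0 <= N * (lam - D) + (lam * (1 + 2 * k) - 2 * (r - 1)) * S2 +
    lam * k * (\sum_i a i ^+ 3) - (\sum_i a i * b i) - 4 * \sum_i e i ^+ 2.
  have -> : lam * (1 + 2 * k) - 2 * (r - 1) = (lam - 1) * (2 * r - 3) - 1.
    by rewrite /k; ring.
  have -> : N * (lam - D) = S2 + N * C * t ^+ 3.
    by rewrite lamE; field; rewrite gt_eqF.
  have p1 : - (2 * r * L * K * N * t ^+ 3) <= (lam - 1) * (2 * r - 3) * S2.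
    have : `|(lam - 1) * (2 * r - 3) * S2| <= L * t * (2 * r) * (K * N * t ^+ 2).
      rewrite !normrM (ger0_norm S20) !ler_pM ?mulr_ge0//.
      by rewrite ger0_norm; lra.
    rewrite ler_norml => /andP[h _]; apply: le_trans h; rewrite lerN2.
    by rewrite (_ : L * t * (2 * r) * _ = 2 * r * L * K * N * t ^+ 3)//; ring.
  have p2 : - (2 * r * K * N * t ^+ 3) <= lam * k * (\sum_i a i ^+ 3).
    have : `|lam * k * (\sum_i a i ^+ 3)| <= (2 * r) * (K * N * t ^+ 3).
      rewrite normrM ler_pM//.
        rewrite ger0_norm; last by rewrite mulr_ge0//; lra.
        by apply: ler_pM; lra.
      apply: le_trans sum_norm_a3; rewrite (le_trans (ler_norm_sum _ _ _))//.
      by apply: ler_sum => i _; rewrite normrX.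
    by rewrite ler_norml => /andP[h _]; apply: le_trans h; rewrite lerN2; lra.
  have p3 : \sum_i a i * b i <= K * N * t ^+ 3.
    apply: le_trans sum_norm_ab; apply: (le_trans (ler_norm _)).
    exact: ler_norm_sum.
  have HC' := ler_wpM2r (mulr_ge0 (ltW N0) (exprn_ge0 3 (ltW t0))) HC.
  lra.
have := mulr_ge0 (sqr_ge0 m) main; have := gap g0.
lra.
Qed.

End perturbed_constant.

Lemma normr_exp3_scale (R : realType) (k x : R) : 0 <= k ->
  `|k * x| ^+ 3 = k ^+ 3 * `|x| ^+ 3.
Proof. by move=> k0; rewrite normrM ger0_norm// exprMn. Qed.

(* Young's inequality with exponents [r / 2] and [r / (r - 2)], the second
   power being expanded to second order. *)
Lemma weighted_sqr_le_powR (R : realType) (r : R) : 2 <= r ->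
  exists2 C : R, 0 <= C & forall y a : R, `|(r - 2) * a| <= 1 / 2 ->
    y ^+ 2 * (1 + (r - 2) * a) <=
    2 / r * `|y| `^ r + (1 - 2 / r) + (r - 2) * a + (r - 2) * a ^+ 2 +
    C * `|a| ^+ 3.
Proof.
(* At [r = 2] the exponent [r / (r - 2)] degenerates, but the weight is 1 and the inequality is an
   equality. *)
rewrite le_eqVlt => /predU1P[<-|r2].
  exists 0 => // y a _; rewrite subrr !mul0r !addr0 mulr1 divff// mul1r subrr addr0.
  by rewrite (powR_mulrn 2)// -normrX ger0_norm// sqr_ge0.
pose k := r - 2; pose q := r / k.
have k0 : 0 < k by rewrite /k; lra.
have r0 : 0 < r by lra.
have q0 : 0 < q by rewrite divr_gt0.
have [C C0 HC] := powR_taylor3 q.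
exists ((1 - 2 / r) * C * k ^+ 3).
  apply: mulr_ge0; last by rewrite exprn_ge0// ltW.
  by apply: mulr_ge0 => //; rewrite subr_ge0 ler_pdivrMr// mul1r; lra.
move=> y a; rewrite -/k => ka.
have h1 : 0 <= 1 + k * a by move: ka; rewrite ler_norml => /andP[? ?]; lra.
have := @conjugate_powR R (y ^+ 2) (1 + k * a) (r / 2) q (sqr_ge0 _) h1 _ q0.
rewrite divr_gt0// => /(_ isT).
have -> : (r / 2)^-1 + q^-1 = 1.
  by rewrite /q /k; field; rewrite /k in k0; apply/andP; split; lra.
move=> /(_ erefl) /le_trans; apply.
have -> : (y ^+ 2) `^ (r / 2) = `|y| `^ r.
  rewrite -[y ^+ 2]ger0_norm ?sqr_ge0// normrX -powR_mulrn// -powRrM.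
  by congr powR; field.
have -> : `|y| `^ r / (r / 2) = 2 / r * `|y| `^ r by rewrite mulrC invf_div.
rewrite -!addrA lerD2l !addrA.
have qV : q^-1 = 1 - 2 / r by rewrite /q /k; field; rewrite /k in k0; lra.
have q0' : 0 <= q^-1 by rewrite invr_ge0 ltW.
have := ler_wpM2l q0' (HC _ ka); rewrite (normr_exp3_scale _ (ltW k0)) [X in X <= _]mulrC.
move=> /le_trans; apply; rewrite -qV.
(* The quadratic coefficient is [(q - 1) / 2 * k ^ 2 = k], because [q - 1 = 2 / k]. *)
rewrite (_ : q^-1 * _ = q^-1 + k * a + k * a ^+ 2 + q^-1 * C * k ^+ 3 * `|a| ^+ 3)//.
by rewrite /q /k; field; rewrite /k in k0; apply/andP; split; lra.
Qed.

(** Two tangent lines: [expR x >= 1 + x], then [ln P <= P - 1]. *)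
Lemma powRN_ge_tangent (R : realType) (P s : R) : 0 < P -> 0 <= s ->
  1 - s * (P - 1) <= P `^ (- s).
Proof.
move=> P0 s0; rewrite /powR gt_eqF//.
apply: le_trans (expR_ge1Dx _); rewrite mulNr lerD2l lerN2 ler_wpM2l//.
have := @le_ln1Dx R (P - 1); rewrite (_ : 1 + (P - 1) = P); last by ring.
by apply; lra.
Qed.

(** [lam] contributes [D + m] and the constraint contributes [(r - 2) * m], which add up to
    [D + (r - 1) * m]; every product of small quantities is cubic. *)
Lemma upper_arith (R : realType) (r K L C1 C3 D t m lam : R) :
    2 <= r -> 0 <= K -> 0 <= L -> 0 <= C1 -> 0 <= t -> 0 <= m ->
    m <= K * t ^+ 2 -> lam = D + m + C3 * t ^+ 3 ->
    lam - 1 <= L * t -> L * t <= 1 ->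
  lam * (1 + (r - 2) * m + C1 * K * t ^+ 3) <=
  D + (r - 1) * m + (C3 + L * (r * K) + 2 * (C1 * K)) * t ^+ 3.
Proof.
move=> r2 K0 L0 C10 t0 m0 mK lamE lam1 Lt.
have Lt0 : 0 <= L * t by rewrite mulr_ge0.
have k0 : 0 <= r - 2 by rewrite subr_ge0.
have h1 : (lam - 1) * ((r - 2) * m) <= L * (r * K) * t ^+ 3.
  have h : (r - 2) * m <= r * (K * t ^+ 2) by apply: ler_pM => //; rewrite lerBlDr lerDl.
  have -> : L * (r * K) * t ^+ 3 = L * t * (r * (K * t ^+ 2)) by ring.
  by apply: (@le_trans _ _ (L * t * ((r - 2) * m)));
    [rewrite ler_wpM2r// mulr_ge0|rewrite ler_wpM2l].
have h2 : lam * (C1 * K * t ^+ 3) <= 2 * (C1 * K) * t ^+ 3.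
  rewrite -[leRHS]mulrA ler_wpM2r//; first by rewrite !mulr_ge0// exprn_ge0.
  by clear - lam1 Lt; lra.
have -> : lam * (1 + (r - 2) * m + C1 * K * t ^+ 3) =
  lam + ((lam - 1) * ((r - 2) * m) + (r - 2) * m) + lam * (C1 * K * t ^+ 3) by ring.
clear - h1 h2 lamE; lra.
Qed.

(** Normalising the test vector costs the factor [1 - (r - 1) * m], half of the gain
    [2 * (r - 1) * m] of the form, which leaves the same [D + (r - 1) * m] as in the upper bound. *)
Lemma lower_arith (R : realType) (r K C2 D t m : R) :
    2 <= r -> 0 <= K -> 0 <= C2 -> 0 <= t -> t <= 1 -> 0 <= m ->
    m <= K * t ^+ 2 -> `|D - 1| <= K * t -> r * K * t <= 1 / 16 ->
  0 <= D + 2 * (r - 1) * m - K * t ^+ 3 /\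
  D + (r - 1) * m - (r * K * K + 2 * (r * K) ^+ 2 + K + 2 * (C2 * K)) * t ^+ 3 <=
  (1 - (r - 1) * m - C2 * K * t ^+ 3) * (D + 2 * (r - 1) * m - K * t ^+ 3).
Proof.
move=> r2 K0 C20 t0 t1 m0 mK; rewrite ler_norml => /andP[D1 D2] rKt.
have Kt0 : 0 <= K * t by rewrite mulr_ge0.
have Kt : K * t <= 1 / 32.
  have : 2 * (K * t) <= r * (K * t) by rewrite ler_wpM2r.
  by clear -rKt; lra.
have t30 : 0 <= t ^+ 3 by rewrite exprn_ge0.
have Kt3 : K * t ^+ 3 <= K * t by rewrite ler_wpM2l// -[leRHS]expr1 ler_wiXn2l.
have Kt30 : 0 <= K * t ^+ 3 by rewrite mulr_ge0.
have r10 : 0 <= r - 1 by clear -r2; lra.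
have rm0 : 0 <= (r - 1) * m by rewrite mulr_ge0.
have rmK : (r - 1) * m <= r * K * t ^+ 2.
  by rewrite -mulrA; apply: ler_pM => //; rewrite lerBlDr lerDl.
have rKt0 : 0 <= r * K * t by rewrite !mulr_ge0//; clear -r2; lra.
have rK0 : 0 <= r * K by rewrite mulr_ge0//; clear -r2; lra.
have rm16 : (r - 1) * m <= 1 / 16.
  by apply: (le_trans rmK); rewrite expr2 mulrA; apply: le_trans rKt; rewrite ler_piMr.
set X := D + 2 * (r - 1) * m - K * t ^+ 3.
have X0 : 0 <= X by rewrite /X; clear -D1 Kt Kt3 rm0; lra.
have X2 : X <= 2 by rewrite /X; clear -D2 Kt Kt30 rm16; lra.
split => //.
have e1 : - (r * K * K * t ^+ 3) <= (r - 1) * m * (1 - D).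
  have h : - (K * t) <= 1 - D by clear -D2; lra.
  apply: le_trans (ler_wpM2l rm0 h); rewrite mulrN lerN2.
  have -> : r * K * K * t ^+ 3 = r * K * t ^+ 2 * (K * t) by ring.
  by rewrite ler_wpM2r.
have e2 : ((r - 1) * m) ^+ 2 <= (r * K) ^+ 2 * t ^+ 3.
  apply: (@le_trans _ _ ((r * K * t ^+ 2) ^+ 2)).
    by rewrite lerXn2r// nnegrE// mulr_ge0// sqr_ge0.
  by rewrite exprMn ler_wpM2l ?sqr_ge0// -exprM ler_wiXn2l.
have e3 : C2 * K * t ^+ 3 * X <= 2 * (C2 * K) * t ^+ 3.
  by rewrite mulrC -[leRHS]mulrA ler_wpM2r// !mulr_ge0.
have e4 : 0 <= (r - 1) * m * (K * t ^+ 3) by rewrite mulr_ge0.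
rewrite /X in e3 *; clear -e1 e2 e3 e4 Kt30; lra.
Qed.

(** * Matching bounds for the form on the l^r ball of radius [n ^ (1 / r)] *)

Section extremes.
Context {R : realType} {n : nat}.
Variables (B : 'M[R]_n) (a : 'I_n -> R) (D K t r : R).
Hypothesis n0 : (0 < n)%N.
Hypothesis r2 : 2 <= r.
Hypothesis K1 : 1 <= K.
Hypothesis t0 : 0 < t.
Hypothesis Bsym : B^T = B.
Hypothesis rowB : forall i, \sum_j B i j = D + (r - 1) * a i.
Hypothesis sa : \sum_i a i = 0.
Hypothesis Dt : `|D - 1| <= K * t.
Hypothesis a2 : \sum_i a i ^+ 2 <= K * n%:R * t ^+ 2.
Hypothesis a4 : \sum_i a i ^+ 4 <= K * n%:R * t ^+ 4.
Hypothesis Ba : \sum_i mulmf B a i ^+ 2 <= K * n%:R * t ^+ 4.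
Hypothesis amax : forall i, `|a i| <= 1 / (4 * r).
Hypothesis gap : forall g, \sum_i g i = 0 ->
  qform B g <= 1 / 4 * \sum_i g i ^+ 2.

Let N0 : (0 : R) < n%:R. Proof. by rewrite ltr0n. Qed.
Let m := (\sum_i a i ^+ 2) / n%:R.

Let S2E : \sum_i a i ^+ 2 = n%:R * m.
Proof. by rewrite mulrC divfK// gt_eqF. Qed.

Let m0 : 0 <= m.
Proof. by rewrite divr_ge0 ?sumr_ge0// => i _; exact: sqr_ge0. Qed.

Let mt : m <= K * t ^+ 2.
Proof.
rewrite ler_pdivrMr// (le_trans a2)//.
by rewrite (_ : K * n%:R * t ^+ 2 = K * t ^+ 2 * n%:R)//; ring.
Qed.

Let r0 : 0 < r. Proof. by apply: lt_le_trans r2. Qed.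
Let K0 : 0 <= K. Proof. by apply: le_trans K1. Qed.
Let amax8 i : `|a i| <= 1 / 8.
Proof.
apply: (le_trans (amax i)); rewrite ler_pdivrMr ?mulr_gt0//.
by have r2' := r2; lra.
Qed.

(** Young's inequality is summed over the coordinates: the terms linear in [a] vanish, and [2 / r]
    and [1 - 2 / r] recombine to 1 under the constraint on [y]. *)
Lemma qform_upper (C C1 : R) : 0 <= C1 ->
    (forall y x : R, `|(r - 2) * x| <= 1 / 2 ->
      y ^+ 2 * (1 + (r - 2) * x) <=
      2 / r * `|y| `^ r + (1 - 2 / r) + (r - 2) * x + (r - 2) * x ^+ 2 +
      C1 * `|x| ^+ 3) ->
    (2 * K + 1) * t <= 1 / 8 ->
    2 * r * (2 * K + 1) * K + 2 * r * K + K +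
      12 * K * ((2 * K + 1) ^+ 2 * r ^+ 2 + 4 * r ^+ 2 + 1) <= C ->
    C * t ^+ 2 <= 1 ->
  forall y, \sum_i `|y i| `^ r <= n%:R ->
    qform B y <= n%:R * (D + (r - 1) * m +
      (C + (2 * K + 1) * (r * K) + 2 * (C1 * K)) * t ^+ 3).
Proof.
move=> C10 HC1 Lt HC Ct y yr.
have [lamP up] := qform_le_weighted n0 r2 K1 t0 Bsym rowB sa Dt a2 a4 Ba amax gap
  Lt HC Ct erefl.
apply: (le_trans (up y)).
set lam := D + _ + _ in lamP *.
move: lamP; rewrite ler_norml => /andP[lam1 lam2].
have lam0 : 0 <= lam by lra.
have L0 : 0 <= 2 * K + 1 by rewrite addr_ge0// mulr_ge0.
have r20 : 0 <= r - 2 by rewrite subr_ge0.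
apply: (@le_trans _ _ (lam * (n%:R * (1 + (r - 2) * m + C1 * K * t ^+ 3)))).
  apply: ler_wpM2l => //.
  apply: (@le_trans _ _ (\sum_i (2 / r * `|y i| `^ r + (1 - 2 / r) * 1 +
      (r - 2) * a i + (r - 2) * a i ^+ 2 + C1 * `|a i| ^+ 3))).
    apply: ler_sum => i _; rewrite mulr1; apply: HC1.
    rewrite normrM ger0_norm//.
    apply: (le_trans (ler_wpM2l r20 (amax i))).
    rewrite mulrA mulr1 ler_pdivrMr ?mulr_gt0//.
    by have r2' := r2; lra.
  rewrite !big_split/= -!mulr_sumr sa sumr_const card_ord S2E.
  have h1 : 2 / r * \sum_i `|y i| `^ r <= 2 / r * n%:R.
    by rewrite ler_wpM2l// divr_ge0// ltW.
  have h2 : C1 * \sum_i `|a i| ^+ 3 <= C1 * (K * n%:R * t ^+ 3).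
    by rewrite ler_wpM2l//; exact: sum_norm_a3.
  lra.
rewrite mulrCA; apply: ler_wpM2l; first exact: ltW.
have t0' := ltW t0; have Lt1 : (2 * K + 1) * t <= 1 by lra.
exact: (@upper_arith _ r K (2 * K + 1) C1 C D t m lam).
Qed.

(** The test vector is [1 + a] scaled onto the sphere by [c = p ^ (- 1 / r)], where [p], the mean of
    [(1 + a) ^ r], is at most [P]. As [2 / r] times [r * (r - 1) / 2] is [r - 1], the tangent bound
    gives [c ^ 2 >= 1 - (r - 1) * m] up to a cubic error. *)
Lemma qform_lower (C2 : R) : 0 <= C2 ->
    (forall x : R, `|x| <= 1 / 2 ->
      (1 + x) `^ r <= 1 + r * x + r * (r - 1) / 2 * x ^+ 2 + C2 * `|x| ^+ 3) ->
    t <= 1 -> r * K * t <= 1 / 16 ->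
  exists2 z, \sum_i `|z i| `^ r <= n%:R &
    n%:R * (D + (r - 1) * m -
     (r * K * K + 2 * (r * K) ^+ 2 + K + 2 * (C2 * K)) * t ^+ 3) <= qform B z.
Proof.
move=> C20 HC2 t1 rKt.
have [X0 lo] := lower_arith r2 K0 C20 (ltW t0) t1 m0 mt Dt rKt.
have t30 : 0 <= t ^+ 3 by rewrite exprn_ge0// ltW.
have pos i : 0 < 1 + a i.
  by have := amax8 i; rewrite ler_norml => /andP[h _]; lra.
pose p := (\sum_i `|1 + a i| `^ r) / n%:R.
have p0 : 0 < p.
  rewrite divr_gt0//.
  apply: (@lt_le_trans _ _ (`|1 + a (Ordinal n0)| `^ r)).
    by rewrite powR_gt0// normr_gt0 gt_eqF.
  rewrite (bigD1 (Ordinal n0))//= lerDl sumr_ge0// => i _; exact: powR_ge0.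
pose P := 1 + r * (r - 1) / 2 * m + C2 * K * t ^+ 3.
have pP : p <= P.
  rewrite ler_pdivrMr//.
  apply: (@le_trans _ _ (\sum_i (1 + r * a i + r * (r - 1) / 2 * a i ^+ 2 +
      C2 * `|a i| ^+ 3))).
    apply: ler_sum => i _; rewrite gtr0_norm//; apply: HC2.
    by apply: (le_trans (amax8 i)); lra.
  rewrite !big_split/= -!mulr_sumr sa sumr_const card_ord S2E.
  have h2 : C2 * \sum_i `|a i| ^+ 3 <= C2 * (K * n%:R * t ^+ 3).
    by rewrite ler_wpM2l//; exact: sum_norm_a3.
  rewrite /P; lra.
have P0 := lt_le_trans p0 pP.
pose c := p `^ (- r^-1).
exists (fun i => c * (1 + a i)).
  under eq_bigr do rewrite normrM powRM//.
  rewrite -mulr_sumr (ger0_norm (powR_ge0 _ _)) /c -powRrM mulNr mulVf ?gt_eqF//.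
  have -> : \sum_i `|1 + a i| `^ r = p * n%:R by rewrite divfK// gt_eqF.
  by rewrite powR_inv1 ?(ltW p0)// mulrA mulVf ?gt_eqF// mul1r.
rewrite qformZ (qform_1D_a Bsym rowB sa) S2E.
have cE : 1 - (r - 1) * m - C2 * K * t ^+ 3 <= c ^+ 2.
  have -> : c ^+ 2 = p `^ (- (2 / r)).
    rewrite /c -powR_mulrn ?powR_ge0// -powRrM; congr powR.
    by rewrite mulNr mulrC.
  have h0 : 0 <= 2 / r by rewrite divr_ge0// ltW.
  apply: (@le_trans _ _ (P `^ (- (2 / r)))); last first.
    rewrite !powRN lef_pV2 ?posrE ?powR_gt0//.
    by apply: ge0_ler_powR; rewrite ?nnegrE ?(ltW P0) ?(ltW p0).
  apply: le_trans (powRN_ge_tangent P0 h0).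
  have -> : 2 / r * (P - 1) = (r - 1) * m + 2 / r * (C2 * K * t ^+ 3).
    by rewrite /P; field; rewrite gt_eqF.
  have : 2 / r * (C2 * K * t ^+ 3) <= 1 * (C2 * K * t ^+ 3).
    apply: ler_wpM2r; first by apply: mulr_ge0 => //; exact: mulr_ge0.
    by rewrite ler_pdivrMr// mul1r.
  lra.
have sab : - (K * t ^+ 3) <= (\sum_i a i * mulmf B a i) / n%:R.
  rewrite ler_pdivlMr// mulNr mulrAC.
  have h := sum_norm_ab t0 a2 Ba.
  suff : `|\sum_i a i * mulmf B a i| <= K * n%:R * t ^+ 3.
    by rewrite ler_norml => /andP[].
  by apply: le_trans h; exact: ler_norm_sum.
have -> : c ^+ 2 * (n%:R * D + 2 * (r - 1) * (n%:R * m) +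
    \sum_i a i * mulmf B a i) =
  n%:R * (c ^+ 2 * (D + 2 * (r - 1) * m + (\sum_i a i * mulmf B a i) / n%:R)).
  by field; rewrite gt_eqF.
apply: ler_wpM2l; first exact: ltW.
apply: (le_trans lo).
apply: (@le_trans _ _ (c ^+ 2 * (D + 2 * (r - 1) * m - K * t ^+ 3))).
  by rewrite ler_wpM2r.
by rewrite ler_wpM2l ?sqr_ge0// lerD2l.
Qed.

End extremes.

Lemma qform_extremes (R : realType) (r K : R) : 2 <= r -> 1 <= K ->
  exists2 C : R, 0 <= C & forall (n : nat) (B : 'M[R]_n) (a : 'I_n -> R) (D t : R),
    (0 < n)%N -> 0 < t -> B^T = B ->
    (forall i, \sum_j B i j = D + (r - 1) * a i) -> \sum_i a i = 0 ->
    `|D - 1| <= K * t ->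
    \sum_i a i ^+ 2 <= K * n%:R * t ^+ 2 ->
    \sum_i a i ^+ 4 <= K * n%:R * t ^+ 4 ->
    \sum_i mulmf B a i ^+ 2 <= K * n%:R * t ^+ 4 ->
    (forall i, `|a i| <= 1 / (4 * r)) ->
    (forall g, \sum_i g i = 0 -> qform B g <= 1 / 4 * \sum_i g i ^+ 2) ->
    C * t <= 1 ->
    let v := D + (r - 1) * ((\sum_i a i ^+ 2) / n%:R) in
    (forall y, \sum_i `|y i| `^ r <= n%:R ->
       qform B y <= n%:R * (v + C * t ^+ 3)) /\
    (exists2 z, \sum_i `|z i| `^ r <= n%:R &
       n%:R * (v - C * t ^+ 3) <= qform B z).
Proof.
move=> r2 K1.
have [C1 C10 HC1] := weighted_sqr_le_powR r2.
have [C2 C20 HC2] := powR_taylor3 r.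
have K0 : 0 <= K by apply: le_trans K1.
have r0 : 0 <= r by apply: le_trans r2.
have L0 : 0 <= 2 * K + 1 by rewrite addr_ge0// mulr_ge0.
have [C3 C3E] : exists C3, C3 = 2 * r * (2 * K + 1) * K + 2 * r * K + K +
      12 * K * ((2 * K + 1) ^+ 2 * r ^+ 2 + 4 * r ^+ 2 + 1) by eexists.
have C30 : 0 <= C3.
  by rewrite C3E !addr_ge0// !mulr_ge0// !addr_ge0// !mulr_ge0// exprn_ge0.
have [Cu CuE] : exists Cu, Cu = C3 + (2 * K + 1) * (r * K) + 2 * (C1 * K) by eexists.
have Cu0 : 0 <= Cu by rewrite CuE !addr_ge0// !mulr_ge0.
have [Cl ClE] : exists Cl, Cl = r * K * K + 2 * (r * K) ^+ 2 + K + 2 * (C2 * K).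
  by eexists.
have Cl0 : 0 <= Cl by rewrite ClE !addr_ge0// !mulr_ge0// exprn_ge0// mulr_ge0.
have rK0 : 0 <= r * K by rewrite mulr_ge0.
(* A single constant dominates both errors [Cu] and [Cl] and makes [C * t <= 1] imply each smallness
   condition; 8 and 16 come from the thresholds [1 / 8] and [1 / 16]. *)
have [C CE] : exists C, C = 8 * (2 * K + 1) + C3 + Cu + Cl + 16 * (r * K).
  by eexists.
have le1 : 8 * (2 * K + 1) <= C by rewrite CE; clear -C30 Cu0 Cl0 rK0; lra.
have le2 : C3 <= C by rewrite CE; clear -L0 C30 Cu0 Cl0 rK0; lra.
have le3 : Cu <= C by rewrite CE; clear -L0 C30 Cu0 Cl0 rK0; lra.
have le4 : Cl <= C by rewrite CE; clear -L0 C30 Cu0 Cl0 rK0; lra.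
have le5 : 16 * (r * K) <= C by rewrite CE; clear -L0 C30 Cu0 Cl0 rK0; lra.
exists C; first exact: le_trans le2.
move=> n B a D t n0 t0 Bs rowB sa Dt a2 a4 Ba amax gap Ct v.
have sub (u : R) : u <= C -> u * t <= 1.
  by move=> uC; apply: le_trans Ct; rewrite ler_wpM2r// ltW.
have sub3 (u : R) : u <= C -> u * t ^+ 3 <= C * t ^+ 3.
  by move=> uC; rewrite ler_wpM2r// exprn_ge0// ltW.
have Lt : (2 * K + 1) * t <= 1 / 8 by have := sub _ le1; clear; lra.
have rKt : r * K * t <= 1 / 16 by have := sub _ le5; clear; lra.
have t1 : t <= 1.
  apply: le_trans (_ : (2 * K + 1) * t <= 1); last by clear -Lt; lra.
  by rewrite ler_peMl// ?ltW//; clear -K1; lra.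
have C3t : C3 * t ^+ 2 <= 1.
  rewrite expr2 mulrA; apply: le_trans (sub _ le2).
  by rewrite ler_piMr// mulr_ge0// ltW.
have := qform_upper n0 r2 K1 t0 Bs rowB sa Dt a2 a4 Ba amax gap C10 HC1 Lt
  (_ : _ <= C3) C3t; rewrite -C3E -CuE => /(_ (lexx _)) up.
have [z zr lo] := qform_lower n0 r2 K1 t0 Bs rowB sa Dt a2 a4 Ba amax C20 HC2 t1 rKt.
rewrite -ClE in lo.
have N0 : (0 : R) <= n%:R by [].
split.
  move=> y /up /le_trans; apply; rewrite ler_wpM2l// lerD2l; exact: sub3.
by exists z => //; apply: le_trans lo; rewrite ler_wpM2l// lerD2l lerN2; exact: sub3.
Qed.

(** * The maximum on the l^r ball *)

Section max_quad_form_facts.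
Context {R : realType} {n : nat}.
Variable r : R.
Hypothesis r0 : 0 < r.
Implicit Types (B : 'M[R]_n) (x : 'cV[R]_n).

Lemma quad_formE B x : (x^T *m B *m x) 0 0 = qform B (fun i => x i 0).
Proof.
rewrite mxE; under eq_bigr do rewrite mxE mulr_suml.
rewrite exchange_big/=; apply: eq_bigr => i _.
rewrite mulr_sumr; apply: eq_bigr => j _.
by rewrite !mxE mulrA.
Qed.

Lemma lr_norm_le1 x : (lr_norm r x <= 1) = (\sum_i `|x i 0| `^ r <= 1).
Proof.
set s := \sum_i _.
have s0 : 0 <= s by apply: sumr_ge0 => i _; exact: powR_ge0.
rewrite /lr_norm -/s; apply/idP/idP => h.
  have -> : s = (s `^ r^-1) `^ r by rewrite -powRrM mulVf ?gt_eqF// powRr1.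
  rewrite [leRHS](_ : 1 = 1 `^ r); last by rewrite powR1.
  by apply: ge0_ler_powR; rewrite ?nnegrE ?powR_ge0// ltW.
rewrite [leRHS](_ : 1 = 1 `^ r^-1); last by rewrite powR1.
by apply: ge0_ler_powR; rewrite ?nnegrE ?invr_ge0 ?(ltW r0).
Qed.

Lemma lr_norm_le1_entry x i : lr_norm r x <= 1 -> `|x i 0| <= 1.
Proof.
rewrite lr_norm_le1 => h; rewrite leNgt; apply/negP => x1.
have : 1 < `|x i 0| `^ r.
  by rewrite [ltLHS](_ : 1 = 1 `^ r); [apply: gt0_ltr_powR; rewrite ?nnegrE|rewrite powR1].
rewrite ltNge => /negP; apply; apply: le_trans h.
by rewrite (bigD1 i)//= lerDl sumr_ge0// => j _; exact: powR_ge0.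
Qed.

Let forms B := [set (x^T *m B *m x) 0 0 | x in [set x : 'cV[R]_n | lr_norm r x <= 1]].

Lemma has_sup_quad_forms B : has_sup (forms B).
Proof.
split.
  exists 0, 0 => /=; last by rewrite mulmx0 mxE.
  rewrite lr_norm_le1 big1// => i _.
  by rewrite mxE normr0 powR0// gt_eqF.
exists (\sum_i \sum_j `|B i j|) => _ [x /= x1 <-].
rewrite quad_formE; apply: ler_sum => i _.
rewrite mulr_sumr; apply: ler_sum => j _.
apply: (le_trans (ler_norm _)); rewrite !normrM.
have xi := lr_norm_le1_entry i x1; have xj := lr_norm_le1_entry j x1.
rewrite mulrCA ler_piMr// -[leRHS]mulr1; exact: ler_pM.
Qed.

Lemma quad_form_le_max B x : lr_norm r x <= 1 ->
  qform B (fun i => x i 0) <= max_quad_form r B.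
Proof.
move=> x1; rewrite -quad_formE; apply: ub_le_sup; last by exists x.
by have [] := has_sup_quad_forms B.
Qed.

Lemma max_quad_form_le B u :
  (forall x, lr_norm r x <= 1 -> qform B (fun i => x i 0) <= u) ->
  max_quad_form r B <= u.
Proof.
move=> h; apply: ge_sup; first by have [] := has_sup_quad_forms B.
by move=> _ [x /= x1 <-]; rewrite quad_formE; exact: h.
Qed.

End max_quad_form_facts.

(** Homogeneity: passing to the ball of radius [n ^ (1 / r)] multiplies the form by [n ^ (2 / r)],
    and [n ^ (- (1 - 2 / r))] is that factor divided by [n]. *)
Lemma max_quad_form_bounds (R : realType) (r u v : R) (n : nat) (A : 'M[R]_n) :
    0 < r -> (0 < n)%N ->
    (forall y, \sum_i `|y i| `^ r <= n%:R -> qform A y <= n%:R * u) ->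
    (exists2 z, \sum_i `|z i| `^ r <= n%:R & n%:R * v <= qform A z) ->
  v <= max_quad_form r (n%:R `^ (- (1 - 2 / r)) *: A) <= u.
Proof.
move=> r0 n0 up [z zr lo].
have N0 : (0 : R) < n%:R by rewrite ltr0n.
pose c : R := n%:R `^ r^-1.
have c0 : 0 < c by rewrite powR_gt0.
have cr : c `^ r = n%:R by rewrite /c -powRrM mulVf ?gt_eqF// powRr1// ltW.
have scale x : qform (n%:R `^ (- (1 - 2 / r)) *: A) x = n%:R^-1 * qform A (fun i => c * x i).
  have -> : n%:R `^ (- (1 - 2 / r)) = n%:R^-1 * c ^+ 2.
    rewrite opprB powRD; last by apply/implyP => _; rewrite gt_eqF.
    rewrite powRN powRr1 ?ltW// mulrC; congr (_ * _).
    by rewrite /c -powR_mulrn ?powR_ge0// -powRrM mulrC.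
  rewrite qformZ [RHS]mulrA /qform [RHS]mulr_sumr; apply: eq_bigr => i _.
  rewrite [RHS]mulrCA; congr (_ * _); rewrite mulr_sumr; apply: eq_bigr => j _.
  by rewrite mxE -mulrA.
have normc (x : R) : `|c * x| `^ r = n%:R * `|x| `^ r.
  by rewrite normrM powRM// gtr0_norm// cr.
apply/andP; split; last first.
  apply: max_quad_form_le => // x; rewrite lr_norm_le1// => x1.
  rewrite scale ler_pdivrMl//; apply: up.
  under eq_bigr do rewrite normc.
  by rewrite -mulr_sumr ler_piMr// ltW.
pose x : 'cV[R]_n := \col_i (c^-1 * z i).
have xE : (fun i => c * x i 0) = z.
  by apply/funext => i; rewrite mxE mulrA divff ?mul1r// gt_eqF.
have x1 : lr_norm r x <= 1.
  rewrite lr_norm_le1// -(ler_pM2l N0) mulr1 mulr_sumr.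
  apply: le_trans zr; apply: ler_sum => i _.
  by rewrite -normc mxE mulrA divff ?mul1r// gt_eqF.
apply: (@le_trans _ _ (qform (n%:R `^ (- (1 - 2 / r)) *: A) (fun i => x i 0))).
  by rewrite scale xE ler_pdivlMl.
exact: quad_form_le_max.
Qed.

(* Rounding each coordinate towards 0 keeps a vector in the l^r ball, so the
   rational points of the ball are dense in it. *)
Lemma rat_round_toward0 (R : realType) (x e : R) : 0 < e ->
  exists2 q : rat, `|x - ratr q| <= e & `|ratr q : R| <= `|x|.
Proof.
move=> e0; have [->|x0] := eqVneq x 0.
  by exists 0; rewrite rmorph0// subrr normr0 ltW.
have nx : 0 < `|x| by rewrite normr_gt0.
have : Num.max 0 (`|x| - e) < `|x| by rewrite gt_max nx/= ltrBlDr ltrDl.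
move=> /rat_in_itvoo[q]; rewrite in_itv/= gt_max => /andP[/andP[q0 q1] q2].
have [xp|xn] := leP 0 x.
  exists q; rewrite (ger0_norm xp) in q1 q2 *.
    by rewrite ger0_norm; lra.
  by rewrite ger0_norm; lra.
exists (- q); rewrite (ltr0_norm xn) in q1 q2 *; rewrite rmorphN/=.
  by rewrite ler0_norm; lra.
by rewrite normrN ger0_norm; lra.
Qed.

(** By density the supremum may be taken over the rational points of the ball, so each superlevel
    set is a countable union. Rational vectors are finite functions, a countable type. *)
Lemma measurable_max_quad_form (R : realType) (r : R) (n : nat)
    (d : measure_display) (T : measurableType d) (A : T -> 'M[R]_n) :
    0 < r -> (forall i j, measurable_fun setT (fun w => A w i j)) ->
  measurable_fun setT (fun w => max_quad_form r (A w)).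
Proof.
move=> r0 mA.
pose vec (q : 'I_n -> rat) : 'cV[R]_n := \col_i ratr (q i).
have mform (x : 'cV[R]_n) : measurable_fun setT (fun w => qform (A w) (fun i => x i 0)).
  apply: measurable_sum => i; apply: measurable_funM => //.
  by apply: measurable_sum => j; exact: measurable_funM.
have key w t : max_quad_form r (A w) <= t <->
    forall q : {ffun 'I_n -> rat}, lr_norm r (vec q) <= 1 ->
      qform (A w) (fun i => vec q i 0) <= t.
  split=> [h q q1|h]; first by apply: le_trans h; exact: quad_form_le_max.
  apply: max_quad_form_le => // x x1; apply/ler_addgt0Pr => e e0.
  (* Moving every coordinate by at most [e / s] inside the unit cube changes the form by at most
     [e]; the summand 1 only keeps [s] positive. *)
  pose s := 1 + 2 * \sum_i \sum_j `|A w i j|.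
  have s0 : 0 < s.
    by rewrite ltr_pwDl// mulr_ge0// sumr_ge0// => i _; exact: sumr_ge0.
  have es : 0 < e / s by rewrite divr_gt0.
  have /choice[q Hq] : forall i, exists q : rat,
      `|x i 0 - ratr q| <= e / s /\ `|ratr q : R| <= `|x i 0|.
    by move=> i; have [q q1 q2] := rat_round_toward0 (x i 0) es; exists q.
  pose qf := [ffun i => q i].
  have vE i : vec qf i 0 = ratr (q i) by rewrite mxE ffunE.
  have q1 : lr_norm r (vec qf) <= 1.
    rewrite (lr_norm_le1 r0); rewrite (lr_norm_le1 r0) in x1.
    apply: le_trans x1; apply: ler_sum => i _.
    apply: ge0_ler_powR; rewrite ?nnegrE ?(ltW r0)// vE.
    by have [] := Hq i.
  apply: le_trans (lerD (h qf q1) (lexx e)); rewrite -lerBlDl /qform -sumrB.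
  apply: (@le_trans _ _ (\sum_i \sum_j `|A w i j| * (2 * (e / s)))).
    apply: ler_sum => i _; rewrite !mulr_sumr -sumrB; apply: ler_sum => j _.
    rewrite vE vE; set xi := x i 0; set xj := x j 0.
    have [qi1 qi2] := Hq i; have [qj1 qj2] := Hq j.
    have xi1 : `|xi| <= 1 by exact: (lr_norm_le1_entry r0 i x1).
    have xj1 : `|xj| <= 1 by exact: (lr_norm_le1_entry r0 j x1).
    rewrite (_ : _ - _ = A w i j * ((xi - ratr (q i)) * xj + ratr (q i) * (xj - ratr (q j)))); last by ring.
    apply: (le_trans (ler_norm _)); rewrite normrM ler_wpM2l//.
    apply: (le_trans (ler_normD _ _)).
    rewrite (normrM _ xj) (normrM (ratr _)) mulr2n mulrDl mul1r lerD//.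
      by rewrite -[leRHS]mulr1 ler_pM.
    by rewrite -[leRHS]mul1r; apply: ler_pM => //; exact: le_trans qi2 xi1.
  under eq_bigr do rewrite -mulr_suml.
  rewrite -mulr_suml (_ : _ * _ = (2 * \sum_i \sum_j `|A w i j|) / s * e); last by ring.
  by rewrite ler_piMl ?(ltW e0)// ler_pdivrMr// mul1r /s lerDr ler01.
move=> _; apply: (measurability _ (RGenOInfty.measurableE R)) => //.
move=> _ [_ [t ->] <-].
have -> : (fun w => max_quad_form r (A w)) @^-1` `]t, +oo[ =
    \bigcup_(q : {ffun 'I_n -> rat}) [set w | lr_norm r (vec q) <= 1 /\
      t < qform (A w) (fun i => vec q i 0)].
  apply/seteqP; split=> w /=; rewrite in_itv/= andbT.
    move=> tw; apply: contrapT => h; move: tw; rewrite ltNge => /negP; apply.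
    apply/key => q q1; rewrite leNgt; apply/negP => tq; apply: h.
    by exists q.
  move=> [q _ [q1 tq]]; rewrite ltNge; apply/negP => /key /(_ q q1).
  by rewrite leNgt tq.
rewrite setTI; apply: countable_bigcupT_measurable => // q.
have [q1|q1] := pselect (lr_norm r (vec q) <= 1); last first.
  by rewrite (_ : [set _ | _] = set0)//; apply/seteqP; split=> w // [].
rewrite -[X in measurable X]setTI.
have := mform (vec q) measurableT _ (measurable_itv `]t, +oo[).
rewrite (_ : _ @^-1` _ = [set w | lr_norm r (vec q) <= 1 /\
  t < qform (A w) (fun i => vec q i 0)])//.
by apply/seteqP; split=> w /=; rewrite in_itv/= andbT => // -[].
Qed.

(** * Leave-one-out expectations *)

Section independent_pair.
Context d (T : measurableType d) (R : realType) (P : probability T R).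
Variables X Z : T -> R.
Hypothesis mX : measurable_fun setT X.
Hypothesis mZ : measurable_fun setT Z.
Hypothesis XZ_indep : forall B C : set R, measurable B -> measurable C ->
  P (X @^-1` B `&` Z @^-1` C) = (P (X @^-1` B) * P (Z @^-1` C))%E.

Let pX : {mfun T >-> R} := mfun_Sub (mem_set mX).
Let pZ : {mfun T >-> R} := mfun_Sub (mem_set mZ).
Let mXZ : measurable_fun setT (fun w => (X w, Z w)).
Proof. exact: measurable_fun_pair. Qed.
Let pXZ : {mfun T >-> (R * R)%type} := mfun_Sub (mem_set mXZ).

Let m1 := distribution P pX.
Let m2 := distribution P pZ.
Let m12 := distribution P pXZ.

(** Independence is agreement on rectangles, which determine the product measure; Tonelli and Fubini
    then apply to the pair. *)
Let joint_law S : measurable S -> (m1 \x m2)%E S = m12 S.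
Proof.
apply: product_measure_unique => A B mA mB.
exact: XZ_indep.
Qed.

Lemma integrableM_indep : P.-integrable setT (EFin \o X) ->
  P.-integrable setT (EFin \o Z) ->
  P.-integrable setT (EFin \o (fun w => X w * Z w)).
Proof.
move=> iX iZ.
have mXZ' : measurable_fun setT (fun w => X w * Z w) by exact: measurable_funM.
apply/integrableP; split; first exact/measurable_EFinP.
have mprod : measurable_fun setT (fun z : R * R => (`|z.1 * z.2|)%:E).
  by apply/measurable_EFinP/measurableT_comp => //; exact: measurable_funM.
have -> : (\int[P]_w `|(EFin \o (fun w => X w * Z w)%R) w| =
    \int[m12]_z (`|z.1 * z.2|)%:E)%E.
  by rewrite ge0_integral_distribution.
rewrite (eq_measure_integral (m1 \x m2)%E); last by move=> S mS _; exact/esym/joint_law.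
rewrite fubini_tonelli1//.
rewrite /fubini_F/=.
have fin (Y : T -> R) (mY : measurable_fun setT Y) : P.-integrable setT (EFin \o Y) ->
    (\int[distribution P (mfun_Sub (mem_set mY))]_y (`|y|)%:E < +oo)%E.
  move=> /integrableP[_]; rewrite ge0_integral_distribution//.
  by apply/measurable_EFinP; exact: normr_measurable.
have m20 : (0 <= \int[m2]_y (`|y|)%:E)%E by apply: integral_ge0.
have -> : (\int[m1]_x \int[m2]_y (`|x * y|)%:E =
    \int[m1]_x ((`|x|)%:E * \int[m2]_y (`|y|)%:E))%E.
  apply: eq_integral => x _; rewrite -ge0_integralZl//.
    by apply: eq_integral => y _; rewrite normrM.
  by apply/measurable_EFinP; exact: normr_measurable.
rewrite ge0_integralZr//; last by apply/measurable_EFinP; exact: normr_measurable.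
by rewrite lte_mul_pinfty ?fin// ?integral_ge0// ge0_fin_numE ?fin// integral_ge0.
Qed.

Lemma RintegralM_indep : P.-integrable setT (EFin \o X) ->
  P.-integrable setT (EFin \o Z) ->
  \int[P]_w (X w * Z w) = \int[P]_w X w * \int[P]_w Z w.
Proof.
move=> iX iZ; have iXZ := integrableM_indep iX iZ.
have mprod : measurable_fun setT (fun z : R * R => (z.1 * z.2)%:E).
  by apply/measurable_EFinP; exact: measurable_funM.
have idist (Y : T -> R) (mY : measurable_fun setT Y) : P.-integrable setT (EFin \o Y) ->
    (distribution P (mfun_Sub (mem_set mY))).-integrable setT (EFin : R -> \bar R).
  by move=> iY; apply: integrable_pushforward.
have i12 : m12.-integrable setT (fun z : R * R => (z.1 * z.2)%:E).
  exact: integrable_pushforward.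
have ipr : (m1 \x m2)%E.-integrable setT (fun z : R * R => (z.1 * z.2)%:E).
  apply/integrableP; split => //.
  have /integrableP[_] := i12; apply: le_lt_trans.
  rewrite le_eqVlt; apply/orP; left; apply/eqP.
  by apply: eq_measure_integral => S mS _; exact: joint_law.
have [iX' iZ'] := (idist X mX iX, idist Z mZ iZ).
rewrite /Rintegral.
have -> : (\int[P]_w (X w * Z w)%:E = \int[m12]_z (z.1 * z.2)%:E)%E.
  by rewrite integral_distribution.
rewrite (eq_measure_integral (m1 \x m2)%E); last by move=> S mS _; exact/esym/joint_law.
rewrite -integral12_prod_meas1// /fubini_F/=.
have -> : (\int[m1]_x \int[m2]_y (x * y)%:E =
    \int[m1]_x (x%:E * \int[m2]_y y%:E))%E.
  apply: eq_integral => x _; rewrite -integralZl//.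
have fin2 : (\int[m2]_y y%:E)%E \is a fin_num by exact: integrable_fin_num.
rewrite -(fineK fin2) integralZr// fineM//; last by exact: integrable_fin_num.
congr (fine _ * fine _).
  exact: (@integral_distribution _ _ _ _ _ P pX EFin).
rewrite fineK//; exact: (@integral_distribution _ _ _ _ _ P pZ EFin).
Qed.

End independent_pair.

Section leave_one_out.
Context d (T : measurableType d) (R : realType) (P : probability T R).
Context (I : finType) (D : {set I}) (X : I -> T -> R).
Hypothesis mX : forall i, measurable_fun setT (X i).
Hypothesis X_indep : mutually_independent P D X.

(** The cylinder events in the variables of [D] other than [X e]. They form a pi-system, and
    measurability for the sigma-algebra they generate expresses being a function of those
    variables. *)
Definition events_without (e : I) : set (set T) :=
  [set E | exists2 J : {set I}, J \subset D :\ e &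
    exists2 B : I -> set R, (forall i, measurable (B i)) &
      E = \bigcap_(i in [set` J]) (X i @^-1` B i)].

Let mpre i (B : set R) : measurable B -> measurable (X i @^-1` B).
Proof. by move=> mB; rewrite -[X in measurable X]setTI; exact: mX. Qed.

Lemma events_without_setI e : setI_closed (events_without e).
Proof.
move=> _ _ [J1 J1D [B1 mB1 ->]] [J2 J2D [B2 mB2 ->]].
exists (J1 :|: J2)%SET; first by rewrite finset.subUset J1D.
(* Each family is padded by [setT] outside its own index set, so that both live on the union. *)
exists (fun i => (if i \in J1 then B1 i else setT) `&`
                 (if i \in J2 then B2 i else setT)).
  by move=> i; apply: measurableI; case: ifP.
apply/seteqP; split=> w /=.
  move=> [h1 h2] i /=; rewrite inE => iJ; split.
    by case: ifP => // i1; exact: h1.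
  by case: ifP => // i2; exact: h2.
move=> h; split=> i /= iJ; have /h [] : [set` (J1 :|: J2)%SET] i.
- by rewrite /= inE iJ.
- by rewrite iJ.
- by rewrite /= inE iJ orbT.
- by rewrite iJ.
Qed.

Lemma events_without_measurable e : events_without e `<=` measurable.
Proof.
move=> _ [J _ [B mB ->]]; apply: fin_bigcap_measurable => // i _.
exact: mpre.
Qed.

Lemma measurable_events_without e f : f \in D -> f != e ->
  measurable_fun (setT : set (g_sigma_algebraType (events_without e))) (X f).
Proof.
move=> fD fe _ B mB; rewrite setTI; apply: sub_sigma_algebra.
exists [set f]%SET; first by rewrite finset.sub1set !inE fe.
exists (fun=> B) => //; apply/seteqP; split=> w /=.
  by move=> h i /=; rewrite inE => /eqP ->.
by apply; rewrite /= inE.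
Qed.

(** Pi-lambda argument: for fixed [B] both sides are finite measures in [E], and by mutual
    independence they agree on the cylinder events. *)
Lemma events_without_indep e B E : e \in D -> measurable B ->
  <<s events_without e >> E ->
  P (X e @^-1` B `&` E) = (P (X e @^-1` B) * P E)%E.
Proof.
move=> eD mB sE.
have mXB := mpre e mB.
have fin : P (X e @^-1` B) \is a fin_num by exact: fin_num_measure.
have k0 : 0 <= fine (P (X e @^-1` B)) by exact: fine_ge0.
pose k := NngNum k0.
have := @g_sigma_algebra_measure_unique _ _ _ (events_without e)
  (@events_without_measurable e) (fun=> setT) _ _ (mrestr P mXB) (mscale k P).
rewrite /mscale/= /mrestr => h.
rewrite setIC -(fineK fin); apply: h => //.
- move=> _; exists finset.set0; first by rewrite finset.sub0set.
  by exists (fun=> setT) => //; apply/seteqP; split=> w.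
- by apply/seteqP; split=> w //= _; exists 0%N.
- exact: events_without_setI.
- move=> _ [J JD [C mC ->]]; rewrite /mscale/= fineK//.
  have eJ : e \notin J by apply/negP => /(fintype.subsetP JD); rewrite !inE eqxx.
  pose C' i := if i == e then B else C i.
  have mC' i : measurable (C' i) by rewrite /C'; case: ifP.
  have JsD : J \subset D by exact: (fintype.subset_trans JD (finset.subD1set _ _)).
  have C'C i : i \in J -> C' i = C i.
    by move=> iJ; rewrite /C'; case: eqP => // ie; move: eJ; rewrite -ie iJ.
  have -> : \bigcap_(i in [set` J]) (X i @^-1` C i) `&` X e @^-1` B =
      \bigcap_(i in [set` (e |: J)%SET]) (X i @^-1` C' i).
    apply/seteqP; split=> w /=.
      move=> [h1 h2] i /=; rewrite !inE => /orP[/eqP ->|iJ].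
        by rewrite /C' eqxx.
      by rewrite /preimage/= C'C//; exact: h1.
    move=> h1; split.
      move=> i /= iJ; have := h1 i; rewrite /= !inE iJ orbT => /(_ isT).
      by rewrite /preimage/= C'C.
    by have := h1 e; rewrite /= !inE eqxx => /(_ isT); rewrite /preimage/= /C' eqxx.
  rewrite X_indep//; last by rewrite finset.subUset finset.sub1set eD.
  rewrite X_indep// big_setU1//= /C' eqxx; congr (_ * _)%E.
  by apply: eq_bigr => i iJ; rewrite -/(C' i) C'C.
- by move=> _; rewrite (le_lt_trans (probability_le1 _ _)) ?ltry// setTI.
Qed.

Lemma leave_one_out e (phi : R -> R) (Z : T -> R) : e \in D ->
    measurable_fun setT phi ->
    measurable_fun (setT : set (g_sigma_algebraType (events_without e))) Z ->
    P.-integrable setT (EFin \o (fun w => phi (X e w))) ->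
    P.-integrable setT (EFin \o Z) ->
  P.-integrable setT (EFin \o (fun w => phi (X e w) * Z w)) /\
  \int[P]_w (phi (X e w) * Z w) = \int[P]_w phi (X e w) * \int[P]_w Z w.
Proof.
move=> eD mphi mZ ipX iZ.
have mpX : measurable_fun setT (fun w => phi (X e w)) by exact: measurableT_comp.
have mZ' : measurable_fun setT Z.
  by move/integrableP : iZ => [/measurable_EFinP].
have ind (B C : set R) : measurable B -> measurable C ->
    P ((fun w => phi (X e w)) @^-1` B `&` Z @^-1` C) =
    (P ((fun w => phi (X e w)) @^-1` B) * P (Z @^-1` C))%E.
  move=> mB mC.
  have mpB : measurable (phi @^-1` B) by rewrite -[X in measurable X]setTI; exact: mphi.
  apply: (@events_without_indep e (phi @^-1` B)) => //.
  have := mZ measurableT C mC; rewrite setTI; exact.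
by split; [exact: integrableM_indep|exact: RintegralM_indep].
Qed.

End leave_one_out.

(** * Integrability, and second moments of orthogonal sums *)

Section expectation_facts.
Context d (T : measurableType d) (R : realType) (P : probability T R).
Implicit Types X Y : T -> R.

Local Notation L1 X := (P.-integrable setT (EFin \o X)).

Lemma integrable_dominated X Y : measurable_fun setT X ->
  (forall w, `|X w| <= Y w) -> L1 Y -> L1 X.
Proof.
move=> mX XY; apply: le_integrable => //; first exact/measurable_EFinP.
move=> w _ /=; rewrite lee_fin; exact: le_trans (XY w) (ler_norm _).
Qed.

Lemma integrable_const (c : R) : L1 (fun=> c).
Proof.
exact: finite_measure_integrable_cst.
Qed.

Lemma integrable_add X Y : L1 X -> L1 Y -> L1 (fun w => X w + Y w).
Proof. by move=> iX iY; exact: (integrableD measurableT iX iY). Qed.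

Lemma integrable_scale (c : R) X : L1 X -> L1 (fun w => c * X w).
Proof. by move=> iX; exact: (integrableZl measurableT c iX). Qed.

Lemma integrable_fsum (J : Type) (s : seq J) (Q : pred J) (X : J -> T -> R) :
  (forall i, Q i -> L1 (X i)) -> L1 (fun w => \sum_(i <- s | Q i) X i w).
Proof.
move=> iX; elim: s => [|j s IH].
  by under eq_fun do rewrite big_nil; exact: integrable_const.
have [Qj|/negPf Qj] := boolP (Q j); under eq_fun do rewrite big_cons Qj //.
  by apply: integrable_add => //; exact: iX.
exact: IH.
Qed.

Lemma Rintegral_fsum (J : Type) (s : seq J) (Q : pred J) (X : J -> T -> R) :
  (forall i, Q i -> L1 (X i)) ->
  \int[P]_w (\sum_(i <- s | Q i) X i w) = \sum_(i <- s | Q i) \int[P]_w X i w.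
Proof.
move=> iX; elim: s => [|j s IH].
  rewrite big_nil; under eq_Rintegral do rewrite big_nil.
  by rewrite Rintegral_cst// mul0r.
rewrite big_cons; have [Qj|/negPf Qj] := boolP (Q j);
  under eq_Rintegral do rewrite big_cons Qj //.
  by rewrite -IH RintegralD//; [exact: iX|exact: integrable_fsum].
exact: IH.
Qed.

Lemma Rintegral_const (c : R) : \int[P]_w c = c.
Proof.
rewrite Rintegral_cst// (_ : fine _ = 1) ?mulr1//.
exact: (congr1 fine (probability_setT P)).
Qed.

Lemma Rintegral_le X Y : L1 X -> L1 Y -> (forall w, X w <= Y w) ->
  \int[P]_w X w <= \int[P]_w Y w.
Proof. by move=> iX iY XY; apply: le_Rintegral. Qed.

(** Pythagoras: the cross terms integrate to zero. The second-moment bounds for sums of monomials in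
    the entries all come from here. *)
Lemma orthogonal_sum (J : finType) (Q : pred J) (Y : J -> T -> R) (b : J -> R)
    (M : R) :
    (forall i j, Q i -> Q j -> L1 (fun w => Y i w * Y j w)) ->
    (forall i j, Q i -> Q j -> i != j -> \int[P]_w (Y i w * Y j w) = 0) ->
    (forall i, Q i -> \int[P]_w (Y i w ^+ 2) <= M) ->
  L1 (fun w => (\sum_(i | Q i) b i * Y i w) ^+ 2) /\
  \int[P]_w ((\sum_(i | Q i) b i * Y i w) ^+ 2) <= M * \sum_(i | Q i) b i ^+ 2.
Proof.
move=> iY oY YM.
have E w : (\sum_(i | Q i) b i * Y i w) ^+ 2 =
    \sum_(i | Q i) \sum_(j | Q j) b i * b j * (Y i w * Y j w).
  rewrite expr2 mulr_suml; apply: eq_bigr => i Qi.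
  by rewrite mulr_sumr; apply: eq_bigr => j Qj; ring.
under eq_fun do rewrite E.
have i2 i j : Q i -> Q j -> L1 (fun w => b i * b j * (Y i w * Y j w)).
  by move=> Qi Qj; apply: integrable_scale; exact: iY.
have i1 i : Q i -> L1 (fun w => \sum_(j | Q j) b i * b j * (Y i w * Y j w)).
  by move=> Qi; apply: integrable_fsum => j; exact: i2.
split; first exact: integrable_fsum.
rewrite Rintegral_fsum// mulr_sumr; apply: ler_sum => i Qi.
rewrite Rintegral_fsum//; last by move=> j; exact: i2.
rewrite (bigD1 i)//= big1 ?addr0.
  rewrite RintegralZl//; last exact: iY.
  by rewrite -expr2 mulrC ler_wpM2r ?sqr_ge0//; exact: YM.
move=> j /andP[Qj ji]; rewrite RintegralZl//; last exact: iY.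
by rewrite oY ?mulr0// eq_sym.
Qed.

End expectation_facts.

(** * Moments of products of independent centered variables *)

Section centered_family.
Context d (T : measurableType d) (R : realType) (P : probability T R).
Context (I : finType) (D : {set I}) (X : I -> T -> R).
Variables (mu v M4 : R).
Hypothesis mX : forall i, measurable_fun setT (X i).
Hypothesis X_indep : mutually_independent P D X.

Local Notation L1 X := (P.-integrable setT (EFin \o X)).
Let xi e w := X e w - mu.

Hypothesis xi4 : forall e, e \in D -> L1 (fun w => xi e w ^+ 4).
Hypothesis xi_mean : forall e, e \in D -> \int[P]_w xi e w = 0.
Hypothesis xi_var : forall e, e \in D -> \int[P]_w (xi e w ^+ 2) = v.
Hypothesis xi_m4 : forall e, e \in D -> \int[P]_w (xi e w ^+ 4) <= M4.

Let mxi e : measurable_fun setT (xi e).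
Proof. exact: measurable_funB. Qed.

(** With this, a finite fourth moment supplies the integrability of all lower powers. *)
Lemma pow4_dominates (x : R) : [/\ `|x| <= 1 + x ^+ 4, x ^+ 2 <= 1 + x ^+ 4 &
  `|x| ^+ 3 <= 1 + x ^+ 4].
Proof.
have -> : x ^+ 4 = `|x| ^+ 4 by rewrite -normrX ger0_norm// exprn_even_ge0.
have -> : x ^+ 2 = `|x| ^+ 2 by rewrite -normrX ger0_norm// sqr_ge0.
have y0 := normr_ge0 x; set y := `|x| in y0 *.
have -> : y ^+ 4 = (y ^+ 2) ^+ 2 by ring.
have -> : y ^+ 3 = y * y ^+ 2 by ring.
have y2 := sqr_ge0 y.
have h1 := sqr_ge0 (y ^+ 2 - 1 / 2); have h2 := sqr_ge0 (y ^+ 2 - y).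
have h3 := sqr_ge0 (y - 1 / 2).
by split; nra.
Qed.

Let L1_sub (e : I) (phi : R -> R) : e \in D -> measurable_fun setT phi ->
  (forall x, `|phi x| <= 1 + x ^+ 4) -> L1 (fun w => phi (xi e w)).
Proof.
move=> eD mphi le; apply: (@integrable_dominated _ _ _ _ _ (fun w => 1 + xi e w ^+ 4)) => //.
- exact: measurableT_comp.
- by apply: integrable_add; [exact: integrable_const|exact: xi4].
Qed.

Lemma L1_xi e : e \in D -> L1 (xi e).
Proof.
move=> eD; apply: (L1_sub (phi := id)) => // x.
by have [] := pow4_dominates x.
Qed.

Lemma L1_xi2 e : e \in D -> L1 (fun w => xi e w ^+ 2).
Proof.
move=> eD; apply: (L1_sub (phi := fun x => x ^+ 2)) => // x.
by rewrite /= ger0_norm ?sqr_ge0//; have [] := pow4_dominates x.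
Qed.

Lemma L1_xi3 e : e \in D -> L1 (fun w => `|xi e w| ^+ 3).
Proof.
move=> eD; apply: (L1_sub (phi := fun x => `|x| ^+ 3)) => // [|x].
  by apply: measurable_funX; exact: normr_measurable.
by rewrite /= ger0_norm ?exprn_ge0//; have [] := pow4_dominates x.
Qed.

Lemma L1_xixi e f : e \in D -> f \in D -> L1 (fun w => xi e w * xi f w).
Proof.
move=> eD fD; apply: (@integrable_dominated _ _ _ _ _
    (fun w => xi e w ^+ 2 + xi f w ^+ 2)).
- exact: measurable_funM.
- move=> w; rewrite normrM -(real_normK (num_real (xi e w))).
  rewrite -(real_normK (num_real (xi f w))).
  have := sqr_ge0 (`|xi e w| - `|xi f w|); have := sqr_ge0 (`|xi e w| + `|xi f w|).
  nra.
- by apply: integrable_add; exact: L1_xi2.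
Qed.

Lemma L1_xi22 e f : e \in D -> f \in D -> L1 (fun w => xi e w ^+ 2 * xi f w ^+ 2).
Proof.
move=> eD fD; apply: (@integrable_dominated _ _ _ _ _
    (fun w => xi e w ^+ 4 + xi f w ^+ 4)).
- by apply: measurable_funM; exact: measurable_funX.
- move=> w; rewrite ger0_norm; last by rewrite mulr_ge0 ?sqr_ge0.
  rewrite (_ : xi e w ^+ 4 = (xi e w ^+ 2) ^+ 2); last by ring.
  rewrite (_ : xi f w ^+ 4 = (xi f w ^+ 2) ^+ 2); last by ring.
  have := sqr_ge0 (xi e w ^+ 2 - xi f w ^+ 2).
  have := sqr_ge0 (xi e w ^+ 2 + xi f w ^+ 2); nra.
- by apply: integrable_add; exact: xi4.
Qed.

Lemma L1_xi4 e f g h : e \in D -> f \in D -> g \in D -> h \in D ->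
  L1 (fun w => xi e w * xi f w * (xi g w * xi h w)).
Proof.
move=> eD fD gD hD; apply: (@integrable_dominated _ _ _ _ _
    (fun w => xi e w ^+ 2 * xi f w ^+ 2 + xi g w ^+ 2 * xi h w ^+ 2)).
- by apply: measurable_funM; exact: measurable_funM.
- move=> w; rewrite normrM -!exprMn -[leRHS]/(_ ^+ 2 + _ ^+ 2).
  rewrite -(real_normK (num_real (xi e w * xi f w))).
  rewrite -(real_normK (num_real (xi g w * xi h w))).
  set a := `|xi e w * _|; set b := `|xi g w * _|.
  have := sqr_ge0 (a - b); have := sqr_ge0 (a + b); nra.
- by apply: integrable_add; exact: L1_xi22.
Qed.

Lemma L1_xi_triple f g h : f \in D -> g \in D -> h \in D ->
  L1 (fun w => xi f w * (xi g w * xi h w)).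
Proof.
move=> fD gD hD; apply: (@integrable_dominated _ _ _ _ _
    (fun w => xi f w ^+ 2 + xi g w ^+ 2 * xi h w ^+ 2)).
- by apply: measurable_funM => //; exact: measurable_funM.
- move=> w; rewrite normrM -!exprMn.
  rewrite -(real_normK (num_real (xi f w))).
  rewrite -(real_normK (num_real (xi g w * xi h w))).
  set a := `|xi f w|; set b := `|xi g w * _|.
  have := sqr_ge0 (a - b); have := sqr_ge0 (a + b); nra.
- by apply: integrable_add; [exact: L1_xi2|exact: L1_xi22].
Qed.

Let mwo e f : f \in D -> f != e ->
  measurable_fun (setT : set (g_sigma_algebraType (events_without D X e))) (xi f).
Proof.
by move=> fD fe; apply: measurable_funB => //; exact: measurable_events_without.
Qed.

Let mphi (k : nat) : measurable_fun setT (fun x : R => (x - mu) ^+ k).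
Proof. by apply: measurable_funX; exact: measurable_funB. Qed.

Lemma Ex_xi_mul e (Z : T -> R) : e \in D ->
    measurable_fun (setT : set (g_sigma_algebraType (events_without D X e))) Z ->
    L1 Z -> L1 (fun w => xi e w * Z w) /\ \int[P]_w (xi e w * Z w) = 0.
Proof.
move=> eD mZ iZ.
have m1 : measurable_fun setT (fun x : R => x - mu) by exact: measurable_funB.
have [i ->] := leave_one_out mX X_indep eD m1 mZ (L1_xi eD) iZ.
by rewrite -/(xi e) xi_mean// mul0r.
Qed.

Lemma Ex_xi2_mul e (Z : T -> R) : e \in D ->
    measurable_fun (setT : set (g_sigma_algebraType (events_without D X e))) Z ->
    L1 Z -> L1 (fun w => xi e w ^+ 2 * Z w) /\
  \int[P]_w (xi e w ^+ 2 * Z w) = v * \int[P]_w Z w.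
Proof.
move=> eD mZ iZ.
have [i ->] := leave_one_out mX X_indep eD (mphi 2) mZ (L1_xi2 eD) iZ.
by split => //; rewrite -(xi_var eD).
Qed.

Lemma Ex_xixi e f : e \in D -> f \in D -> e != f -> \int[P]_w (xi e w * xi f w) = 0.
Proof.
move=> eD fD ef; apply: (Ex_xi_mul eD _ (L1_xi fD)).2.
by apply: mwo; rewrite // eq_sym.
Qed.

Lemma Ex_xi22 e f : e \in D -> f \in D -> e != f ->
  \int[P]_w (xi e w ^+ 2 * xi f w ^+ 2) = v ^+ 2.
Proof.
move=> eD fD ef; rewrite (Ex_xi2_mul eD _ (L1_xi2 fD)).2 ?xi_var//.
by apply: measurable_funX; apply: mwo; rewrite // eq_sym.
Qed.

Let Ex_xi4_aux e f g h : e \in D -> f \in D -> g \in D -> h \in D ->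
  e != f -> e != g -> e != h ->
  \int[P]_w (xi e w * xi f w * (xi g w * xi h w)) = 0.
Proof.
move=> eD fD gD hD ef eg eh.
under eq_Rintegral do rewrite -mulrA.
apply: (Ex_xi_mul eD _ (L1_xi_triple fD gD hD)).2.
by apply: measurable_funM; [|apply: measurable_funM]; apply: mwo; rewrite // eq_sym.
Qed.

(** One of [e], [f] differs from the three other indices, and its mean-zero factor splits off by
    independence. *)
Lemma Ex_xi4 e f g h : e \in D -> f \in D -> g \in D -> h \in D ->
  e != f -> ~~ ((e \in [:: g; h]) && (f \in [:: g; h])) ->
  \int[P]_w (xi e w * xi f w * (xi g w * xi h w)) = 0.
Proof.
move=> eD fD gD hD ef; rewrite negb_and !inE !negb_or => /orP[]/andP[h1 h2].
  exact: Ex_xi4_aux.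
under eq_Rintegral do rewrite (mulrC (xi e _)).
by apply: Ex_xi4_aux; rewrite // eq_sym.
Qed.

Lemma sum_xi_L2 (b : I -> R) :
  L1 (fun w => (\sum_(e in D) b e * xi e w) ^+ 2) /\
  \int[P]_w ((\sum_(e in D) b e * xi e w) ^+ 2) <= v * \sum_(e in D) b e ^+ 2.
Proof.
apply: orthogonal_sum => [i j|i j|i].
- exact: L1_xixi.
- exact: Ex_xixi.
- by move=> /xi_var ->.
Qed.

(** The summands are centered and independent, and each has variance [E xi ^ 4 - v ^ 2 <= M4]. *)
Lemma sum_xi2_L2 (b : I -> R) :
  L1 (fun w => (\sum_(e in D) b e * (xi e w ^+ 2 - v)) ^+ 2) /\
  \int[P]_w ((\sum_(e in D) b e * (xi e w ^+ 2 - v)) ^+ 2) <=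
    M4 * \sum_(e in D) b e ^+ 2.
Proof.
have E i j : i \in D -> j \in D -> forall w, (xi i w ^+ 2 - v) * (xi j w ^+ 2 - v) =
   xi i w ^+ 2 * xi j w ^+ 2 + (- v * xi i w ^+ 2 + (- v * xi j w ^+ 2 + v ^+ 2)).
  by move=> iD jD w; ring.
have i3 i j : i \in D -> j \in D ->
    L1 (fun w => - v * xi i w ^+ 2 + (- v * xi j w ^+ 2 + v ^+ 2)).
  move=> iD jD; apply: integrable_add; first by apply: integrable_scale; exact: L1_xi2.
  apply: integrable_add; first by apply: integrable_scale; exact: L1_xi2.
  exact: integrable_const.
have E3 i j : i \in D -> j \in D ->
    \int[P]_w (- v * xi i w ^+ 2 + (- v * xi j w ^+ 2 + v ^+ 2)) = - v ^+ 2.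
  move=> iD jD; rewrite RintegralD//; last 2 first.
  - by apply: integrable_scale; exact: L1_xi2.
  - apply: integrable_add; last exact: integrable_const.
    by apply: integrable_scale; exact: L1_xi2.
  rewrite RintegralD//; last 2 first.
  - by apply: integrable_scale; exact: L1_xi2.
  - exact: integrable_const.
  rewrite Rintegral_const !RintegralZl ?xi_var//; try exact: L1_xi2.
  by ring.
apply: (orthogonal_sum (Y := fun e w => xi e w ^+ 2 - v)) => [i j iD jD|i j iD jD ij|i iD].
- under eq_fun do rewrite E//.
  by apply: integrable_add; [exact: L1_xi22|exact: i3].
- under eq_Rintegral do rewrite E//.
  rewrite RintegralD//; [|exact: L1_xi22|exact: i3].
  by rewrite Ex_xi22// E3// subrr.
- under eq_Rintegral do rewrite expr2 E//.
  rewrite RintegralD//; [|exact: L1_xi22|exact: i3].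
  rewrite E3//; have -> : \int[P]_w (xi i w ^+ 2 * xi i w ^+ 2) = \int[P]_w (xi i w ^+ 4).
    by apply: eq_Rintegral => w _; ring.
  by rewrite lerBlDr (le_trans (xi_m4 iD))// lerDl sqr_ge0.
Qed.

(** The last hypothesis says that each unordered pair is listed at most once; products over
    different pairs are orthogonal by [Ex_xi4]. *)
Lemma sum_pairs_L2 (J : finType) (Q : pred J) (e1 e2 : J -> I) (b : J -> R) :
    (forall i, Q i -> [/\ e1 i \in D, e2 i \in D & e1 i != e2 i]) ->
    (forall i j, Q i -> Q j -> e1 i \in [:: e1 j; e2 j] -> e2 i \in [:: e1 j; e2 j] ->
       i = j) ->
  L1 (fun w => (\sum_(i | Q i) b i * (xi (e1 i) w * xi (e2 i) w)) ^+ 2) /\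
  \int[P]_w ((\sum_(i | Q i) b i * (xi (e1 i) w * xi (e2 i) w)) ^+ 2) <=
    v ^+ 2 * \sum_(i | Q i) b i ^+ 2.
Proof.
move=> e12 inj; apply: (orthogonal_sum (Y := fun i w => xi (e1 i) w * xi (e2 i) w)) =>
  [i j Qi Qj|i j Qi Qj ij|i Qi].
- have [i1 i2 _] := e12 _ Qi; have [j1 j2 _] := e12 _ Qj; exact: L1_xi4.
- have [i1 i2 ne] := e12 _ Qi; have [j1 j2 _] := e12 _ Qj.
  apply: Ex_xi4 => //; apply/negP => /andP[h1 h2].
  by move: ij; rewrite (inj i j)// eqxx.
- have [i1 i2 ne] := e12 _ Qi.
  by under eq_Rintegral do rewrite exprMn; rewrite Ex_xi22.
Qed.

End centered_family.

(** * Statistics of the centered matrix *)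

Lemma sum_delta (R : pzRingType) (I : finType) (i : I) (F : I -> R) :
  \sum_a (a == i)%:R * F a = F i.
Proof.
rewrite (bigD1 i)//= eqxx mul1r big1 ?addr0// => a /negPf ->.
by rewrite mul0r.
Qed.

Section centered_matrix.
Context d (T : measurableType d) (R : realType) (P : probability T R) (n : nat).
Variables (A : T -> 'M[R]_n) (mu v kap : R).
Hypothesis mA : forall i j, measurable_fun setT (fun w => A w i j).
Hypothesis A_sym : forall w, (A w)^T = A w.
Let D := [set ij : 'I_n * 'I_n | (ij.1 < ij.2)%N]%SET.
Let X (e : 'I_n * 'I_n) w := A w e.1 e.2.
Hypothesis A_indep : mutually_independent P D X.

Local Notation L1 X := (P.-integrable setT (EFin \o X)).
Hypothesis v0 : 0 <= v.
Hypothesis kap0 : 0 <= kap.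
Hypothesis xi4 : forall e, e \in D -> L1 (fun w => (X e w - mu) ^+ 4).
Hypothesis xi_mean : forall e, e \in D -> \int[P]_w (X e w - mu) = 0.
Hypothesis xi_var : forall e, e \in D -> \int[P]_w ((X e w - mu) ^+ 2) = v.
Hypothesis xi_m4 : forall e, e \in D -> \int[P]_w ((X e w - mu) ^+ 4) <= kap * v.

(** The diagonal is set to 0 rather than [- mu], so that row sums and squares involve only centered
    variables. *)
Definition centered_mx (w : T) (i j : 'I_n) : R :=
  if i == j then 0 else A w i j - mu.
Local Notation W := centered_mx.

Let mX e : measurable_fun setT (X e).
Proof. exact: mA. Qed.

Lemma centered_mx_sym w i j : W w i j = W w j i.
Proof. by rewrite /W eq_sym -[in LHS]A_sym mxE. Qed.

(** Independence concerns the entries above the diagonal; this picks the representative of a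
    symmetric pair there. *)
Let edge (i j : 'I_n) := if (i < j)%N then (i, j) else (j, i).

Let edgeD i j : i != j -> edge i j \in D.
Proof.
move=> ij; rewrite inE /edge; case: (ltnP i j) => //= ji.
by rewrite ltn_neqAle ji andbT eq_sym.
Qed.

Let W_edge w i j : i != j -> W w i j = X (edge i j) w - mu.
Proof.
move=> ij; rewrite /W (negbTE ij) /X /edge; case: ifP => //= _.
by rewrite -[in LHS]A_sym mxE.
Qed.

Let edge_eq i j k l : edge i j = edge k l ->
  (i = k :> nat /\ j = l :> nat) \/ (i = l :> nat /\ j = k :> nat).
Proof. by rewrite /edge; do 2 case: ifP => _; case=> -> ->; auto. Qed.

(** A path of two edges with centre [a.1.1] and leaves [a.1.2 < a.2]. Ordering the leaves lists
    every unordered pair of adjacent edges once. *)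
Let cherry (a : 'I_n * 'I_n * 'I_n) :=
  [&& (a.1.2 < a.2)%N, a.1.1 != a.1.2 & a.1.1 != a.2].

(** Terms in which the centre is a leaf vanish with the diagonal, and folding the two orders of the
    leaves symmetrises the coefficient. *)
Lemma cherries_sumE w (c : 'I_n -> 'I_n -> 'I_n -> R) :
  \sum_k \sum_i \sum_(j | j != i) c k i j * (W w k i * W w k j) =
  \sum_(a | cherry a) (c a.1.1 a.1.2 a.2 + c a.1.1 a.2 a.1.2) *
    ((X (edge a.1.1 a.1.2) w - mu) * (X (edge a.1.1 a.2) w - mu)).
Proof.
transitivity (\sum_k \sum_(i < n) \sum_(j < n | (i < j)%N)
   (c k i j + c k j i) * (W w k i * W w k j)).
  apply: eq_bigr => k _.
  have -> : \sum_i \sum_(j | j != i) c k i j * (W w k i * W w k j) =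
      \sum_(i < n) \sum_(j < n | (i < j)%N) c k i j * (W w k i * W w k j) +
      \sum_(i < n) \sum_(j < n | (j < i)%N) c k i j * (W w k i * W w k j).
    rewrite -big_split/=; apply: eq_bigr => i _.
    rewrite (bigID (fun j : 'I_n => (i < j)%N))/=; congr (_ + _); apply: eq_bigl => j.
      by rewrite andb_idl// => ij; rewrite -val_eqE/= gtn_eqF.
    by rewrite -leqNgt [RHS]ltn_neqAle.
  rewrite [X in _ + X](exchange_big_dep xpredT)//= -big_split/=.
  apply: eq_bigr => i _; rewrite -big_split/=; apply: eq_bigr => j ij.
  by ring.
under eq_bigr do rewrite pair_big_dep/=.
rewrite pair_big_dep/=.
rewrite (reindex (fun a : 'I_n * 'I_n * 'I_n => (a.1.1, (a.1.2, a.2))))/=; last first.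
  by exists (fun b => (b.1, b.2.1, b.2.2)) => [[[? ?] ?]|[? [? ?]]].
rewrite (bigID (fun a : 'I_n * 'I_n * 'I_n => (a.1.1 != a.1.2) && (a.1.1 != a.2)))/=.
rewrite [X in _ + X]big1 ?addr0; last first.
  move=> [[k i] j] /=; rewrite negb_and !negbK => /andP[_ /orP[]/eqP ->].
    by rewrite /W eqxx; ring.
  by rewrite /W eqxx; ring.
by apply: eq_bigr => -[[k i] j] /= /and3P[ij ki kj]; rewrite !W_edge.
Qed.

Lemma cherries_L2 (c : 'I_n -> 'I_n -> 'I_n -> R) :
  L1 (fun w => (\sum_k \sum_i \sum_(j | j != i) c k i j * (W w k i * W w k j)) ^+ 2) /\
  \int[P]_w ((\sum_k \sum_i \sum_(j | j != i) c k i j * (W w k i * W w k j)) ^+ 2) <=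
  v ^+ 2 * (2 * \sum_k \sum_i \sum_j c k i j ^+ 2).
Proof.
have E : (fun w => (\sum_k \sum_i \sum_(j | j != i) c k i j * (W w k i * W w k j)) ^+ 2) =
   (fun w => (\sum_(a | cherry a) (c a.1.1 a.1.2 a.2 + c a.1.1 a.2 a.1.2) *
    ((X (edge a.1.1 a.1.2) w - mu) * (X (edge a.1.1 a.2) w - mu))) ^+ 2).
  by apply/funext => w; rewrite cherries_sumE.
rewrite E.
have [a Qa|a b Qa Qb h1 h2|iC le] := @sum_pairs_L2 _ _ _ P _ D X mu v mX A_indep
  xi4 xi_mean xi_var _ cherry (fun a => edge a.1.1 a.1.2) (fun a => edge a.1.1 a.2)
  (fun a => c a.1.1 a.1.2 a.2 + c a.1.1 a.2 a.1.2).
- move: Qa => /and3P[ij ki kj]; split; [exact: edgeD|exact: edgeD|].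
  apply/eqP => /edge_eq; move: ij ki kj; rewrite -!val_eqE/=; lia.
- move: a b Qa Qb h1 h2 => [[k i] j] [[k' i'] j'] /and3P/= [ij ki kj].
  move=> /and3P/= [ij' ki' kj']; rewrite !inE => h1 h2.
  have hh : forall x, (x == edge k' i') || (x == edge k' j') ->
    x = edge k' i' \/ x = edge k' j' by move=> x /orP[]/eqP; [left|right].
  move: (hh _ h1) (hh _ h2) => {hh h1 h2} h1 h2.
  (* Two distinct adjacent edges determine the centre as their common vertex, and the ordering then
     fixes the leaves. *)
  have [e1 e2 e3] : [/\ k = k' :> nat, i = i' :> nat & j = j' :> nat].
    move: ki kj ki' kj'; rewrite -!val_eqE/= => ki kj ki' kj'.
    by move: h1 h2 => [/edge_eq h1|/edge_eq h1] [/edge_eq h2|/edge_eq h2];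
      split; lia.
  by rewrite (val_inj e1) (val_inj e2) (val_inj e3).
split => //; apply: (le_trans le); apply: ler_wpM2l; first exact: sqr_ge0.
apply: (@le_trans _ _ (\sum_(a | cherry a)
    (2 * c a.1.1 a.1.2 a.2 ^+ 2 + 2 * c a.1.1 a.2 a.1.2 ^+ 2))).
  apply: ler_sum => a _; have := sqr_ge0 (c a.1.1 a.1.2 a.2 - c a.1.1 a.2 a.1.2).
  by nra.
pose F k i j := 2 * c k i j ^+ 2.
have F0 k i j : 0 <= F k i j by rewrite /F mulr_ge0 ?sqr_ge0.
have -> : 2 * (\sum_k \sum_i \sum_j c k i j ^+ 2) = \sum_k \sum_i \sum_j F k i j.
  rewrite mulr_sumr; apply: eq_bigr => k _; rewrite mulr_sumr; apply: eq_bigr => i _.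
  by rewrite mulr_sumr.
have -> : \sum_k \sum_i \sum_j F k i j =
    \sum_(a : 'I_n * 'I_n * 'I_n) F a.1.1 a.1.2 a.2.
  by rewrite !pair_bigA/=.
(* The first half runs over triples with ordered leaves, the swapped half over triples with reversed
   leaves. The two ranges are disjoint, so the full sum bounds both together. *)
rewrite big_split/= (bigID cherry predT)/= lerD2l.
pose sw (a : 'I_n * 'I_n * 'I_n) := (a.1.1, a.2, a.1.2).
rewrite (reindex sw)/=; last by exists sw => -[[? ?] ?].
rewrite big_mkcond [leRHS]big_mkcond/=; apply: ler_sum => -[[k i] j] _.
rewrite /cherry/sw/= -/(F k i j); case: ifPn => [/and3P[ji ki kj]|_]; last by case: ifP.
by rewrite ltnNge (ltnW ji).
Qed.

(** The two symmetric positions are folded into one edge, as for cherries; this covers the diagonal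
    of the squared matrix, as [cherries_L2] covers the rest. *)
Lemma squares_L2 (c : 'I_n -> 'I_n -> R) :
  L1 (fun w => (\sum_i \sum_(j | j != i) c i j * (W w i j ^+ 2 - v)) ^+ 2) /\
  \int[P]_w ((\sum_i \sum_(j | j != i) c i j * (W w i j ^+ 2 - v)) ^+ 2) <=
  kap * v * (2 * \sum_i \sum_j c i j ^+ 2).
Proof.
have E w : \sum_i \sum_(j | j != i) c i j * (W w i j ^+ 2 - v) =
    \sum_(e in D) (c e.1 e.2 + c e.2 e.1) * ((X e w - mu) ^+ 2 - v).
  have -> : \sum_i \sum_(j | j != i) c i j * (W w i j ^+ 2 - v) =
      \sum_(i < n) \sum_(j < n | (i < j)%N) c i j * (W w i j ^+ 2 - v) +
      \sum_(i < n) \sum_(j < n | (j < i)%N) c i j * (W w i j ^+ 2 - v).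
    rewrite -big_split/=; apply: eq_bigr => i _.
    rewrite (bigID (fun j : 'I_n => (i < j)%N))/=; congr (_ + _); apply: eq_bigl => j.
      by rewrite andb_idl// => ij; rewrite -val_eqE/= gtn_eqF.
    by rewrite -leqNgt [RHS]ltn_neqAle.
  rewrite [X in _ + X](exchange_big_dep xpredT)//= -big_split/=.
  rewrite [RHS](eq_bigl (fun e : 'I_n * 'I_n => (e.1 < e.2)%N)); last first.
    by move=> e; rewrite inE.
  under eq_bigr => i _ do rewrite -big_split/=.
  rewrite pair_big_dep/=; apply: eq_bigr => -[i j] /= ij.
  have ne : i != j by rewrite -val_eqE/= ltn_eqF.
  by rewrite (centered_mx_sym w j i) W_edge// /edge ij; ring.
have EF : (fun w => (\sum_i \sum_(j | j != i) c i j * (W w i j ^+ 2 - v)) ^+ 2) =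
    (fun w => (\sum_(e in D) (c e.1 e.2 + c e.2 e.1) * ((X e w - mu) ^+ 2 - v)) ^+ 2).
  by apply/funext => w; rewrite E.
rewrite EF.
have [iC le] := sum_xi2_L2 mX A_indep xi4 xi_var xi_m4 (fun e => c e.1 e.2 + c e.2 e.1).
split => //; apply: (le_trans le); apply: ler_wpM2l; first exact: mulr_ge0.
apply: (@le_trans _ _ (\sum_(e in D) (2 * c e.1 e.2 ^+ 2 + 2 * c e.2 e.1 ^+ 2))).
  by apply: ler_sum => e _; have := sqr_ge0 (c e.1 e.2 - c e.2 e.1); nra.
have -> : 2 * (\sum_i \sum_j c i j ^+ 2) = \sum_(e : 'I_n * 'I_n) 2 * c e.1 e.2 ^+ 2.
  by rewrite pair_bigA/= mulr_sumr.
rewrite big_split/= [leRHS](bigID (mem D))/= lerD2l.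
pose sw (e : 'I_n * 'I_n) := (e.2, e.1).
rewrite (reindex sw)/=; last by exists sw => -[? ?].
rewrite big_mkcond [leRHS]big_mkcond/=; apply: ler_sum => -[i j] _.
rewrite !inE/=; have h : 0 <= 2 * c i j ^+ 2 by rewrite mulr_ge0 ?sqr_ge0.
case: ifPn => [ji|_]; last by case: ifP.
by rewrite ltnNge (ltnW ji).
Qed.

Lemma edge_sum_L2 :
  L1 (fun w => (\sum_(e in D) (X e w - mu)) ^+ 2) /\
  \int[P]_w ((\sum_(e in D) (X e w - mu)) ^+ 2) <= v * n%:R ^+ 2.
Proof.
have E : (fun w => (\sum_(e in D) (X e w - mu)) ^+ 2) =
    (fun w => (\sum_(e in D) 1 * (X e w - mu)) ^+ 2).
  by apply/funext => w; under [in RHS]eq_bigr do rewrite mul1r.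
rewrite E; have [i1 le] := sum_xi_L2 mX A_indep xi4 xi_mean xi_var (fun=> 1).
split => //; apply: (le_trans le); apply: ler_wpM2l => //.
under eq_bigr do rewrite expr1n; rewrite sumr_const.
rewrite -natrX ler_nat (leq_trans (max_card _))// card_prod card_ord.
by rewrite expnS expn1.
Qed.
End centered_matrix.

Section matrix_statistics.
Context {R : realType} {n : nat}.
Implicit Types (M : 'I_n -> 'I_n -> R) (v : R).

Definition sqmx M i j : R := \sum_k M i k * M k j.

(* For the centered matrix, each square divided here has expectation at most a
   constant times its denominator. *)
Definition excess_stat v M : R :=
  (\sum_i sqmx M i i ^+ 2 +
   \sum_i \sum_(j | j != i) sqmx M i j ^+ 2 +
   \sum_i (\sum_(j | j != i) sqmx M i j) ^+ 2 +
   \sum_i ((\sum_j M i j) ^+ 2 - sqmx M i i) ^+ 2 +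
   (\sum_i \sum_(j | j != i) sqmx M i j) ^+ 2) / (n%:R ^+ 3 * v ^+ 2) +
  ((\sum_i sqmx M i i - n%:R * (n%:R - 1) * v) ^+ 2 +
   (\sum_(e : 'I_n * 'I_n | (e.1 < e.2)%N) M e.1 e.2) ^+ 2) / (n%:R ^+ 2 * v).

End matrix_statistics.

Lemma natrb_sqr (R : pzRingType) (b : bool) : (b%:R : R) ^+ 2 = b%:R.
Proof. by case: b; rewrite ?expr1n ?expr0n. Qed.

(** * The expectation of the excess statistic *)

Section stat_expectation.
Context d (T : measurableType d) (R : realType) (P : probability T R) (n : nat).
Variables (A : T -> 'M[R]_n) (mu v kap : R).
Hypothesis mA : forall i j, measurable_fun setT (fun w => A w i j).
Hypothesis A_sym : forall w, (A w)^T = A w.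
Let D := [set ij : 'I_n * 'I_n | (ij.1 < ij.2)%N]%SET.
Let X (e : 'I_n * 'I_n) w := A w e.1 e.2.
Hypothesis A_indep : mutually_independent P D X.

Local Notation L1 X := (P.-integrable setT (EFin \o X)).
Hypothesis v0 : 0 <= v.
Hypothesis kap0 : 0 <= kap.
Hypothesis xi4 : forall e, e \in D -> L1 (fun w => (X e w - mu) ^+ 4).
Hypothesis xi_mean : forall e, e \in D -> \int[P]_w (X e w - mu) = 0.
Hypothesis xi_var : forall e, e \in D -> \int[P]_w ((X e w - mu) ^+ 2) = v.
Hypothesis xi_m4 : forall e, e \in D -> \int[P]_w ((X e w - mu) ^+ 4) <= kap * v.

Local Notation W := (centered_mx A mu).
Local Notation bounded f c := (L1 f /\ \int[P]_w f w <= c).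

Let CL2 c := cherries_L2 mA A_sym A_indep v0 kap0 xi4 xi_mean xi_var c.
Let SL2 c := squares_L2 mA A_sym A_indep v0 kap0 xi4 xi_var xi_m4 c.

Let Wii w i : W w i i = 0. Proof. by rewrite /centered_mx eqxx. Qed.
Let Wsym w i j : W w i j = W w j i. Proof. exact: centered_mx_sym. Qed.

Let bounded_ext (f g : T -> R) c : f =1 g -> bounded f c -> bounded g c.
Proof. by move=> /funext ->. Qed.

Let bounded_add (f g : T -> R) c c' : bounded f c -> bounded g c' ->
  bounded (fun w => f w + g w) (c + c').
Proof.
move=> [h1 h2] [h3 h4]; split; first exact: integrable_add.
by rewrite RintegralD// lerD.
Qed.

Let bounded_scale (f : T -> R) k c : 0 <= k -> bounded f c ->
  bounded (fun w => k * f w) (k * c).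
Proof.
move=> k0 [h1 h2]; split; first exact: integrable_scale.
by rewrite RintegralZl// ler_wpM2l.
Qed.

Let bounded_sum (J : finType) (Q : pred J) (f : J -> T -> R) c :
  0 <= c -> (forall i, Q i -> bounded (f i) c) ->
  bounded (fun w => \sum_(i | Q i) f i w) (#|J|%:R * c).
Proof.
move=> c0 fc; split; first by apply: integrable_fsum => i /fc[].
rewrite Rintegral_fsum; last by move=> i /fc[].
apply: (@le_trans _ _ (\sum_(i | Q i) c)); first by apply: ler_sum => i /fc[].
by rewrite sumr_const -[leLHS]mulr_natl ler_wpM2r// ler_nat max_card.
Qed.

Let sqmx_diag w i : sqmx (W w) i i = \sum_(j | j != i) W w i j ^+ 2.
Proof.
rewrite /sqmx (bigD1 i)//= Wii mul0r add0r; apply: eq_bigr => j _.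
by rewrite (Wsym w j i) expr2.
Qed.

Let sum_offdiag_const (c : R) (i : 'I_n) : \sum_(j | j != i) c = (n%:R - 1) * c.
Proof.
have : \sum_(j < n) c = c + \sum_(j | j != i) c by rewrite (bigD1 i).
rewrite sumr_const card_ord => h.
by rewrite mulrBl mul1r mulr_natl h addrC addKr.
Qed.

(** This bound and those named [C1] to [C4] and [S3] specialise [SL2] or [CL2]: indicator
    coefficients select an entry or a row, and the sum of their squares counts the selected
    terms. *)
Let S1 i : bounded (fun w => (sqmx (W w) i i - (n%:R - 1) * v) ^+ 2)
  (2 * kap * v * n%:R).
Proof.
have := SL2 (fun a b => (a == i)%:R).
have -> : \sum_(a < n) \sum_(b < n) (a == i)%:R ^+ 2 = n%:R :> R.
  transitivity (\sum_(a < n) (a == i)%:R * n%:R : R); last exact: sum_delta.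
  by apply: eq_bigr => a _; rewrite sumr_const card_ord -[LHS]mulr_natr natrb_sqr.
rewrite (_ : kap * v * _ = 2 * kap * v * n%:R); last by ring.
apply: bounded_ext => w; congr (_ ^+ 2).
under eq_bigr do rewrite -mulr_sumr.
by rewrite sum_delta sqmx_diag big_split/= sumrN sum_offdiag_const.
Qed.

(** As [n * v >= 1], the variance, of order [kap * n * v], is dominated by [kap] times the squared
    mean, of order [(n * v) ^ 2]. *)
Let S2 i : 1 <= n%:R * v ->
  bounded (fun w => sqmx (W w) i i ^+ 2) ((4 * kap + 2) * n%:R ^+ 2 * v ^+ 2).
Proof.
move=> nv.
have h := bounded_scale (ler0n _ 2) (S1 i).
have h' : bounded (fun _ : T => 2 * ((n%:R - 1) * v) ^+ 2) (2 * ((n%:R - 1) * v) ^+ 2).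
  by split; [exact: integrable_const|rewrite Rintegral_const].
have [i1 le1] := bounded_add h h'.
have i2 : L1 (fun w => sqmx (W w) i i ^+ 2).
  apply: integrable_dominated i1; last first.
    move=> w; rewrite ger0_norm ?sqr_ge0//.
    set x := sqmx _ _ _; set y := (n%:R - 1) * v.
    by have := sqr_ge0 (x - y - y); nra.
  apply: measurable_funX; apply: measurable_sum => k; apply: measurable_funM.
    by rewrite /centered_mx; case: eqP => _ //; exact: measurable_funB.
  by rewrite /centered_mx; case: eqP => _ //; exact: measurable_funB.
split => //; apply: (@le_trans _ _ (2 * (2 * kap * v * n%:R) +
    2 * ((n%:R - 1) * v) ^+ 2)).
  apply: le_trans le1; apply: Rintegral_le => // w.
  set x := sqmx _ _ _; set y := (n%:R - 1) * v.
  by have := sqr_ge0 (x - y - y); nra.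
have n0 : 0 < n%:R :> R.
  by rewrite lt_neqAle ler0n andbT eq_sym; apply/eqP => n0; move: nv; rewrite n0 mul0r ler10.
have n1 : 1 <= n%:R :> R by rewrite ler1n -(ltr0n R).
have e1 : 4 * kap * (v * n%:R) <= 4 * kap * ((v * n%:R) * (v * n%:R)).
  rewrite ler_wpM2l ?mulr_ge0// ler_peMl ?mulr_ge0 ?(ltW n0)//.
  by rewrite mulrC.
have e2 : ((n%:R - 1) * v) ^+ 2 <= (n%:R * v) ^+ 2.
  rewrite lerXn2r ?nnegrE ?mulr_ge0 ?(ltW n0) ?subr_ge0//.
  by rewrite ler_wpM2r// gerBl.
nra.
Qed.

Let C1 i j : i != j -> bounded (fun w => sqmx (W w) i j ^+ 2) (2 * v ^+ 2 * n%:R).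
Proof.
move=> ij; have := CL2 (fun k a b => (a == i)%:R * (b == j)%:R).
have -> : \sum_(k < n) \sum_(a < n) \sum_(b < n) ((a == i)%:R * (b == j)%:R) ^+ 2 = n%:R :> R.
  transitivity (\sum_(k < n) 1 : R); last by rewrite sumr_const card_ord.
  apply: eq_bigr => k _.
  transitivity (\sum_(a < n) (a == i)%:R * (\sum_(b < n) (b == j)%:R * 1) : R).
    apply: eq_bigr => a _; rewrite mulr_sumr; apply: eq_bigr => b _.
    by rewrite exprMn !natrb_sqr mulr1.
  by rewrite sum_delta sum_delta.
rewrite (_ : v ^+ 2 * _ = 2 * v ^+ 2 * n%:R); last by ring.
apply: bounded_ext => w; congr (_ ^+ 2); apply: eq_bigr => k _.
transitivity (\sum_(a < n) (a == i)%:R * (\sum_(b | b != a) (b == j)%:R * (W w k a * W w k b))).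
  by apply: eq_bigr => a _; rewrite mulr_sumr; apply: eq_bigr => b _; rewrite [RHS]mulrA.
rewrite sum_delta (bigD1 j) 1?eq_sym//= eqxx mul1r big1 ?addr0 ?(Wsym w k i)//.
by move=> b /andP[_ /negPf ->]; rewrite mul0r.
Qed.

Let C2 i : bounded (fun w => (\sum_(j | j != i) sqmx (W w) i j) ^+ 2)
  (2 * v ^+ 2 * n%:R ^+ 2).
Proof.
have := CL2 (fun k a b => (a == i)%:R).
have -> : \sum_(k < n) \sum_(a < n) \sum_(b < n) (a == i)%:R ^+ 2 = n%:R ^+ 2 :> R.
  transitivity (\sum_(k < n) n%:R : R); last by rewrite sumr_const card_ord -[LHS]mulr_natr expr2.
  apply: eq_bigr => k _.
  transitivity (\sum_(a < n) (a == i)%:R * n%:R : R); last exact: sum_delta.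
  by apply: eq_bigr => a _; rewrite sumr_const card_ord -[LHS]mulr_natr natrb_sqr.
rewrite (_ : v ^+ 2 * _ = 2 * v ^+ 2 * n%:R ^+ 2); last by ring.
apply: bounded_ext => w; congr (_ ^+ 2).
under eq_bigr => k _.
  under eq_bigr do rewrite -mulr_sumr.
  rewrite sum_delta.
  over.
rewrite exchange_big/=; apply: eq_bigr => j _; apply: eq_bigr => k _.
by rewrite (Wsym w k i).
Qed.

Let C3 : bounded (fun w => (\sum_i \sum_(j | j != i) sqmx (W w) i j) ^+ 2)
  (2 * v ^+ 2 * n%:R ^+ 3).
Proof.
have := CL2 (fun k a b => 1).
have -> : \sum_(k < n) \sum_(a < n) \sum_(b < n) 1 ^+ 2 = n%:R ^+ 3 :> R.
  by rewrite !sumr_const card_ord expr1n -!mulrnA -natrX.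
rewrite (_ : v ^+ 2 * _ = 2 * v ^+ 2 * n%:R ^+ 3); last by ring.
apply: bounded_ext => w; congr (_ ^+ 2).
rewrite exchange_big/=; apply: eq_bigr => i _.
rewrite exchange_big/=; apply: eq_bigr => j _; apply: eq_bigr => k _.
by rewrite (Wsym w k i) mul1r.
Qed.

(** Squaring a row sum and removing the diagonal products leaves exactly the cherries centred at
    [i]. *)
Let C4 i : bounded (fun w => ((\sum_j W w i j) ^+ 2 - sqmx (W w) i i) ^+ 2)
  (2 * v ^+ 2 * n%:R ^+ 2).
Proof.
have := CL2 (fun k a b => (k == i)%:R).
have -> : \sum_(k < n) \sum_(a < n) \sum_(b < n) (k == i)%:R ^+ 2 = n%:R ^+ 2 :> R.
  transitivity (\sum_(k < n) (k == i)%:R * (n%:R ^+ 2) : R); last exact: sum_delta.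
  apply: eq_bigr => a _; rewrite natrb_sqr !sumr_const card_ord -mulrnA.
  by rewrite -[LHS]mulr_natr natrM expr2.
rewrite (_ : v ^+ 2 * _ = 2 * v ^+ 2 * n%:R ^+ 2); last by ring.
apply: bounded_ext => w; congr (_ ^+ 2).
under eq_bigr => k _.
  under eq_bigr do rewrite -mulr_sumr.
  rewrite -mulr_sumr.
  over.
rewrite sum_delta.
have -> : (\sum_j W w i j) ^+ 2 = \sum_a (W w i a * W w i a + \sum_(b | b != a) W w i a * W w i b).
  rewrite expr2 mulr_suml; apply: eq_bigr => a _.
  by rewrite mulr_sumr (bigD1 a).
rewrite big_split/= [X in _ = X + _ - _](_ : _ = sqmx (W w) i i).
  by rewrite addrC addKr.
by apply: eq_bigr => k _; rewrite (Wsym w k i).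
Qed.

Let S3 : bounded (fun w => (\sum_i sqmx (W w) i i - n%:R * (n%:R - 1) * v) ^+ 2)
  (2 * kap * v * n%:R ^+ 2).
Proof.
have := SL2 (fun a b => 1).
have -> : \sum_(a < n) \sum_(b < n) 1 ^+ 2 = n%:R ^+ 2 :> R.
  by rewrite !sumr_const card_ord expr1n -!mulrnA -natrX.
rewrite (_ : kap * v * _ = 2 * kap * v * n%:R ^+ 2); last by ring.
apply: bounded_ext => w; congr (_ ^+ 2).
under eq_bigr => i _.
  under eq_bigr do rewrite mul1r.
  rewrite big_split/= sumrN sum_offdiag_const -sqmx_diag.
  over.
rewrite big_split/= sumrN sumr_const card_ord; congr (_ - _).
by rewrite -[LHS]mulr_natl mulrA.
Qed.

Let S4 : bounded (fun w => (\sum_(e : 'I_n * 'I_n | (e.1 < e.2)%N) W w e.1 e.2) ^+ 2)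
  (v * n%:R ^+ 2).
Proof.
have := edge_sum_L2 mA A_indep v0 xi4 xi_mean xi_var.
apply: bounded_ext => w; congr (_ ^+ 2); apply: eq_big => e; rewrite inE//.
by move=> ij; rewrite /centered_mx -val_eqE/= ltn_eqF.
Qed.

Lemma excess_stat_expectation : 1 <= n%:R * v ->
  L1 (fun w => excess_stat v (W w)) /\
  \int[P]_w excess_stat v (W w) <= 6 * kap + 11.
Proof.
move=> nv.
have n0 : 0 < n%:R :> R.
  by rewrite lt_neqAle ler0n andbT eq_sym; apply/eqP => n0; move: nv; rewrite n0 mul0r ler10.
have vp : 0 < v.
  by rewrite lt_neqAle v0 andbT eq_sym; apply/eqP => v0'; move: nv; rewrite v0' mulr0 ler10.
have N2 : 0 <= n%:R ^+ 2 :> R by rewrite exprn_ge0// ltW.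
have vv : 0 <= v ^+ 2 by exact: sqr_ge0.
have b1 : bounded (fun w => \sum_i sqmx (W w) i i ^+ 2)
    (n%:R * ((4 * kap + 2) * n%:R ^+ 2 * v ^+ 2)).
  have := @bounded_sum _ xpredT _ _ _ (fun i _ => S2 i nv); rewrite card_ord; apply.
  by rewrite !mulr_ge0// addr_ge0// mulr_ge0.
have b2 : bounded (fun w => \sum_i \sum_(j | j != i) sqmx (W w) i j ^+ 2)
    (n%:R * (n%:R * (2 * v ^+ 2 * n%:R))).
  have := @bounded_sum _ xpredT (fun i w => \sum_(j | j != i) sqmx (W w) i j ^+ 2)
    (n%:R * (2 * v ^+ 2 * n%:R)); rewrite card_ord; apply; first by rewrite !mulr_ge0.
  move=> i _; have := @bounded_sum _ (fun j => j != i)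
    (fun j w => sqmx (W w) i j ^+ 2) (2 * v ^+ 2 * n%:R).
  rewrite card_ord; apply; first by rewrite !mulr_ge0.
  by move=> j ji; apply: C1; rewrite eq_sym.
have b3 : bounded (fun w => \sum_i (\sum_(j | j != i) sqmx (W w) i j) ^+ 2)
    (n%:R * (2 * v ^+ 2 * n%:R ^+ 2)).
  have := @bounded_sum _ xpredT _ _ _ (fun i _ => C2 i); rewrite card_ord; apply.
  by rewrite !mulr_ge0.
have b4 : bounded (fun w => \sum_i ((\sum_j W w i j) ^+ 2 - sqmx (W w) i i) ^+ 2)
    (n%:R * (2 * v ^+ 2 * n%:R ^+ 2)).
  have := @bounded_sum _ xpredT _ _ _ (fun i _ => C4 i); rewrite card_ord; apply.
  by rewrite !mulr_ge0.
have c1 : 0 <= (n%:R ^+ 3 * v ^+ 2)^-1 by rewrite invr_ge0 mulr_ge0// exprn_ge0// ltW.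
have c2 : 0 <= (n%:R ^+ 2 * v)^-1 by rewrite invr_ge0 mulr_ge0.
have := bounded_add (bounded_scale c1 (bounded_add (bounded_add (bounded_add
  (bounded_add b1 b2) b3) b4) C3)) (bounded_scale c2 (bounded_add S3 S4)).
set c := (X in _ /\ _ <= X) => h.
(* The first quotient contributes [(4 * kap + 2) + 4 * 2], the second [2 * kap + 1]. *)
have -> : 6 * kap + 11 = c by rewrite /c; field; rewrite !gt_eqF.
by apply: bounded_ext h => w; rewrite /excess_stat mulrC [X in _ + X]mulrC.
Qed.

End stat_expectation.

(** * Deterministic expansion of the maximum *)

Lemma gt0_le_sum_mul (R : realType) (x y s : R) : 0 < s ->
  x * y <= 1 / 2 * (s^-1 * x ^+ 2 + s * y ^+ 2).
Proof.
move=> s0; rewrite -subr_ge0.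
have -> : 1 / 2 * (s^-1 * x ^+ 2 + s * y ^+ 2) - x * y =
  1 / 2 * s^-1 * (x - s * y) ^+ 2 by field; rewrite gt_eqF.
by rewrite mulr_ge0 ?sqr_ge0// mulr_ge0 ?invr_ge0 ?(ltW s0).
Qed.

Lemma sqr_le_norm (R : realType) (x y : R) : 0 <= y -> x ^+ 2 <= y ^+ 2 -> `|x| <= y.
Proof.
by move=> y0 xy; rewrite -ler_sqr ?nnegrE// real_normK// num_real.
Qed.

(** * Deterministic consequences of a bounded excess statistic *)

Section excess_consequences.
Context {R : realType} {n : nat}.
Variables (M : 'I_n -> 'I_n -> R) (v K : R).
Hypothesis n0 : (0 < n)%N.
Hypothesis v0 : 0 < v.
Hypothesis K1 : 1 <= K.
Hypothesis Msym : forall i j, M i j = M j i.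
Hypothesis Mii : forall i, M i i = 0.
Hypothesis stat : excess_stat v M <= K.

Let N : R := n%:R.
Let N0 : 0 < N. Proof. by rewrite ltr0n. Qed.
Let c := N ^+ 3 * v ^+ 2.
Let c0 : 0 < c. Proof. by rewrite mulr_gt0 ?exprn_gt0. Qed.
Let K0 : 0 < K. Proof. by apply: lt_le_trans K1. Qed.

Definition rowsums i : R := \sum_j M i j.
Local Notation eta := rowsums.
Definition edgesum : R := \sum_(e : 'I_n * 'I_n | (e.1 < e.2)%N) M e.1 e.2.
Local Notation S := edgesum.

Let sum_ge0 (J : Type) (s : seq J) (Q : pred J) (f : J -> R) :
  0 <= \sum_(i <- s | Q i) f i ^+ 2.
Proof. by apply: sumr_ge0 => i _; exact: sqr_ge0. Qed.

Let sum2_ge0 : 0 <= \sum_i \sum_(j | j != i) sqmx M i j ^+ 2.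
Proof. by apply: sumr_ge0 => i _; exact: sum_ge0. Qed.

Lemma excess_split :
  [/\ \sum_i sqmx M i i ^+ 2 <= K * c,
   \sum_i \sum_(j | j != i) sqmx M i j ^+ 2 <= K * c,
   \sum_i (\sum_(j | j != i) sqmx M i j) ^+ 2 <= K * c,
   \sum_i (eta i ^+ 2 - sqmx M i i) ^+ 2 <= K * c &
   (\sum_i \sum_(j | j != i) sqmx M i j) ^+ 2 <= K * c] /\
  (\sum_i sqmx M i i - N * (N - 1) * v) ^+ 2 <= K * (N ^+ 2 * v) /\
  S ^+ 2 <= K * (N ^+ 2 * v).
Proof.
have c20 : 0 < N ^+ 2 * v by rewrite mulr_gt0 ?exprn_gt0.
move: stat; rewrite /excess_stat -/N -/c.
have := sum_ge0 (index_enum _) xpredT (fun i => sqmx M i i).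
have := sum2_ge0.
have := sum_ge0 (index_enum _) xpredT (fun i => \sum_(j | j != i) sqmx M i j).
have := sum_ge0 (index_enum _) xpredT (fun i => eta i ^+ 2 - sqmx M i i).
have := sqr_ge0 (\sum_i \sum_(j | j != i) sqmx M i j).
have := sqr_ge0 (\sum_i sqmx M i i - N * (N - 1) * v).
have := sqr_ge0 S.
rewrite /eta /S.
set x7 := (X in 0 <= X -> _); move=> h7.
set x6 := (X in 0 <= X -> _); move=> h6.
set x5 := (X in 0 <= X -> _); move=> h5.
set x4 := (X in 0 <= X -> _); move=> h4.
set x3 := (X in 0 <= X -> _); move=> h3.
set x2 := (X in 0 <= X -> _); move=> h2.
set x1 := (X in 0 <= X -> _); move=> h1 h.
have p1 : 0 <= (x1 + x2 + x3 + x4 + x5) / c by rewrite divr_ge0 ?addr_ge0 ?(ltW c0).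
have p2 : 0 <= (x6 + x7) / (N ^+ 2 * v) by rewrite divr_ge0 ?addr_ge0 ?(ltW c20).
have g1 : x1 + x2 + x3 + x4 + x5 <= K * c.
  by rewrite -ler_pdivrMr//; apply: le_trans h; rewrite lerDl.
have g2 : x6 + x7 <= K * (N ^+ 2 * v).
  by rewrite -ler_pdivrMr//; apply: le_trans h; rewrite lerDr.
clear h p1 p2.
split; last by rewrite -/x6 -/x7; split; lra.
by split; rewrite -/x1 -/x2 -/x3 -/x4 -/x5; lra.
Qed.

Let sum4 (f : 'I_n -> R) : \sum_i f i ^+ 4 = \sum_i (f i ^+ 2) ^+ 2.
Proof. by apply: eq_bigr => i _; rewrite -exprM. Qed.

(** No fourth power is expanded: [eta i ^ 2] is a diagonal entry of the squared matrix plus a cherry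
    sum, and the statistic controls both in l^2. *)
Lemma rowsum4 : \sum_i eta i ^+ 4 <= 4 * K * c.
Proof.
have [[h1 _ _ h4 _] _] := excess_split.
apply: (@le_trans _ _ (2 * (\sum_i (eta i ^+ 2 - sqmx M i i) ^+ 2) +
    2 * \sum_i sqmx M i i ^+ 2)).
  rewrite sum4 !mulr_sumr -big_split/=; apply: ler_sum => i _.
  by have := sqr_ge0 (eta i ^+ 2 - sqmx M i i - sqmx M i i); nra.
by lra.
Qed.

(** Weighted AM-GM at the typical size [N * v] of [eta i ^ 2] reduces this to the fourth powers. *)
Lemma rowsum2 : \sum_i eta i ^+ 2 <= 3 * K * (N ^+ 2 * v).
Proof.
have Nv : 0 < N * v by rewrite mulr_gt0.
apply: (@le_trans _ _ (\sum_i 1 / 2 * ((N * v)^-1 * eta i ^+ 4 + N * v * 1))).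
  apply: ler_sum => i _; have := gt0_le_sum_mul (eta i ^+ 2) 1 Nv.
  by rewrite mulr1 expr1n -exprM.
rewrite -mulr_sumr big_split/= -mulr_sumr sumr_const card_ord -[X in _ + X]mulr_natl -/N.
have h : (N * v)^-1 * \sum_i eta i ^+ 4 <= (N * v)^-1 * (4 * K * c).
  by rewrite ler_wpM2l ?invr_ge0 ?(ltW Nv)//; exact: rowsum4.
have e : (N * v)^-1 * (4 * K * c) = 4 * K * (N ^+ 2 * v).
  by rewrite /c; field; rewrite !gt_eqF.
have K1' : N ^+ 2 * v <= K * (N ^+ 2 * v).
  by rewrite ler_peMl// mulr_ge0 ?exprn_ge0// ltW.
rewrite e in h.
apply: (@le_trans _ _ (1 / 2 * (4 * K * (N ^+ 2 * v) + N * (N * v * 1)))).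
  by rewrite ler_wpM2l ?divr_ge0// lerD2r.
have X0 : 0 <= N ^+ 2 * v by rewrite mulr_ge0 ?exprn_ge0 ?(ltW v0) ?(ltW N0).
by lra.
Qed.

Lemma sum_rowsums : \sum_i eta i = 2 * S.
Proof.
rewrite /eta pair_bigA/= (bigID (fun e : 'I_n * 'I_n => (e.1 < e.2)%N))/= -/S.
rewrite (bigID (fun e : 'I_n * 'I_n => (e.2 < e.1)%N))/=.
rewrite [X in _ + (_ + X)]big1 ?addr0; last first.
  move=> [i j] /=; rewrite -!leqNgt => /andP[ji ij].
  by rewrite (_ : i = j) ?Mii//; apply/val_inj/eqP; rewrite eqn_leq ij ji.
rewrite (reindex (fun e : 'I_n * 'I_n => (e.2, e.1)))/=; last first.
  by exists (fun e => (e.2, e.1)) => -[? ?].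
rewrite [X in _ + X](_ : _ = S); first by ring.
apply: eq_big => [[i j]|[i j] _] /=; last exact: Msym.
by rewrite andb_idl// => ij; rewrite -leqNgt ltnW.
Qed.

Definition rowmean : R := (\sum_i eta i) / N.

Lemma rowmean2 : rowmean ^+ 2 <= 4 * K * v.
Proof.
have [_ [_ h]] := excess_split.
rewrite /rowmean sum_rowsums exprMn exprVn ler_pdivrMr ?exprn_gt0// exprMn.
by nra.
Qed.

(** Divided by [(r - 1) * n * mu], these become the perturbation [a] of the constant vector. *)
Definition devsum i : R := eta i - rowmean.
Local Notation del := devsum.

Lemma sum_devsum : \sum_i del i = 0.
Proof.
rewrite /devsum sumrB sumr_const card_ord -[X in _ - X]mulr_natl /rowmean -/N.
by rewrite mulrC divfK ?subrr// gt_eqF.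
Qed.

Lemma sum_devsum2E : \sum_i del i ^+ 2 = \sum_i eta i ^+ 2 - N * rowmean ^+ 2.
Proof.
have h : \sum_i eta i = N * rowmean by rewrite /rowmean mulrC divfK// gt_eqF.
transitivity (\sum_i (eta i ^+ 2 + (- 2 * rowmean) * eta i + rowmean ^+ 2)).
  by apply: eq_bigr => i _; rewrite /devsum; ring.
rewrite !big_split/= -mulr_sumr h sumr_const card_ord -[X in _ + X]mulr_natl -/N.
by ring.
Qed.

Lemma devsum2 : \sum_i del i ^+ 2 <= 3 * K * (N ^+ 2 * v).
Proof.
by rewrite sum_devsum2E; apply: le_trans rowsum2; rewrite gerBl mulr_ge0 ?sqr_ge0.
Qed.

Let Nle (k : nat) : N ^+ k <= N ^+ k.+1.
Proof. by rewrite exprS ler_peMl ?exprn_ge0 ?(ltW N0)// ler1n. Qed.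

(** From [(x - y) ^ 4 <= 8 * (x ^ 4 + y ^ 4)]: the row sums contribute [8 * 4] and their mean
    [8 * 16]. *)
Lemma devsum4 : \sum_i del i ^+ 4 <= 160 * K ^+ 2 * c.
Proof.
apply: (@le_trans _ _ (8 * (\sum_i eta i ^+ 4) + N * (8 * (rowmean ^+ 2) ^+ 2))).
  have -> : N * (8 * (rowmean ^+ 2) ^+ 2) = \sum_(i < n) 8 * (rowmean ^+ 2) ^+ 2.
    by rewrite sumr_const card_ord -[RHS]mulr_natl.
  rewrite mulr_sumr -big_split/=.
  apply: ler_sum => i _; rewrite /devsum; set x := eta i; set y := rowmean.
  have h1 : (x - y) ^+ 2 <= 2 * (x ^+ 2 + y ^+ 2) by have := sqr_ge0 (x + y); nra.
  have h2 : ((x - y) ^+ 2) ^+ 2 <= (2 * (x ^+ 2 + y ^+ 2)) ^+ 2.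
    by rewrite lerXn2r ?nnegrE ?sqr_ge0// mulr_ge0// addr_ge0 ?sqr_ge0.
  have := sqr_ge0 (x ^+ 2 - y ^+ 2).
  rewrite (_ : (x - y) ^+ 4 = ((x - y) ^+ 2) ^+ 2); last by ring.
  rewrite (_ : x ^+ 4 = (x ^+ 2) ^+ 2); last by ring.
  nra.
have h4 := rowsum4.
have h2 : (rowmean ^+ 2) ^+ 2 <= (4 * K * v) ^+ 2.
  rewrite lerXn2r ?nnegrE ?sqr_ge0 ?rowmean2// mulr_ge0 ?(ltW v0)// mulr_ge0//.
  exact: ltW.
have h2' : N * (8 * (rowmean ^+ 2) ^+ 2) <= 128 * K ^+ 2 * c.
  apply: (@le_trans _ _ (N * (8 * (4 * K * v) ^+ 2))).
    by rewrite ler_wpM2l ?(ltW N0)// ler_wpM2l.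
  rewrite (_ : N * _ = 128 * K ^+ 2 * (N ^+ 1 * v ^+ 2)); last by ring.
  rewrite /c ler_wpM2l//; first by rewrite mulr_ge0 ?sqr_ge0.
  by rewrite ler_wpM2r ?sqr_ge0//; exact: le_trans (Nle 1) (Nle 2).
have K2 : 4 * K * c <= 4 * K ^+ 2 * c.
  rewrite ler_wpM2r ?(ltW c0)// ler_wpM2l// expr2 ler_peMl// ltW//.
lra.
Qed.

Definition actM (x : 'I_n -> R) i : R := \sum_j M i j * x j.

(** Applying [M] to its own row sums gives the row sums of [M^2], whose diagonal and off-diagonal
    parts the statistic controls; subtracting the mean costs [rowmean * eta i]. The constant is
    [3 * (1 + 1 + 12)]. *)
Lemma actM_devsum2 : \sum_i actM del i ^+ 2 <= 42 * K ^+ 2 * c.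
Proof.
have [[h1 _ h3 _ _] _] := excess_split.
have E i : actM del i = sqmx M i i + \sum_(j | j != i) sqmx M i j - rowmean * eta i.
  rewrite /actM /devsum; under eq_bigr do rewrite mulrBr.
  rewrite sumrB; congr (_ - _); last first.
    by rewrite /eta mulr_sumr; apply: eq_bigr => j _; rewrite mulrC.
  transitivity (\sum_j sqmx M i j); last by rewrite (bigD1 i).
  rewrite /sqmx exchange_big/=; apply: eq_bigr => j _.
  by rewrite /eta mulr_sumr.
apply: (@le_trans _ _ (3 * (\sum_i sqmx M i i ^+ 2 +
    \sum_i (\sum_(j | j != i) sqmx M i j) ^+ 2 + rowmean ^+ 2 * \sum_i eta i ^+ 2))).
  rewrite [rowmean ^+ 2 * _]mulr_sumr -!big_split/= mulr_sumr; apply: ler_sum => i _.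
  rewrite E; set x := sqmx M i i; set y := \sum_(j | _) _; set z := eta i.
  have := sqr_ge0 (x - y); have := sqr_ge0 (x + rowmean * z).
  have := sqr_ge0 (y + rowmean * z); rewrite -exprMn; nra.
have h : rowmean ^+ 2 * (\sum_i eta i ^+ 2) <= 12 * K ^+ 2 * c.
  apply: (@le_trans _ _ (4 * K * v * (3 * K * (N ^+ 2 * v)))).
    by apply: ler_pM; rewrite ?sqr_ge0 ?sum_ge0 ?rowmean2 ?rowsum2.
  rewrite (_ : _ * _ = 12 * K ^+ 2 * (N ^+ 2 * v ^+ 2)); last by ring.
  rewrite /c ler_wpM2l//; first by rewrite mulr_ge0 ?sqr_ge0.
  by rewrite ler_wpM2r ?sqr_ge0.
have K2 : K * c <= K ^+ 2 * c.
  rewrite ler_wpM2r ?(ltW c0)// expr2 ler_peMl// ltW//.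
nra.
Qed.

Lemma sqmx_frobenius : \sum_i \sum_j sqmx M i j ^+ 2 <= 2 * K * c.
Proof.
have [[h1 h2 _ _ _] _] := excess_split.
rewrite (_ : \sum_i _ = \sum_i sqmx M i i ^+ 2 + \sum_i \sum_(j | j != i) sqmx M i j ^+ 2).
  lra.
by rewrite -big_split/=; apply: eq_bigr => i _; rewrite (bigD1 i).
Qed.

(* The 4th moment bound |M|_op <= |M^2|_F^(1/2). *)
Lemma form_gap (nu : R) (g : 'I_n -> R) : 0 < nu -> 2 * K * c <= nu ^+ 4 ->
  \sum_i g i * actM g i <= nu * \sum_i g i ^+ 2.
Proof.
move=> nu0 small; set G := \sum_i g i ^+ 2.
have [G0|G0] := eqVneq G 0.
  rewrite G0 mulr0 big1// => i _.
  have /eqP : g i ^+ 2 = 0.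
    by apply: (psumr_eq0P _ G0) => // j _; exact: sqr_ge0.
  by rewrite sqrf_eq0 => /eqP ->; rewrite mul0r.
have Gp : 0 < G by rewrite lt_neqAle eq_sym G0 sum_ge0.
have act2 : \sum_i actM g i ^+ 2 <= nu ^+ 2 * G.
  have -> : \sum_i actM g i ^+ 2 = \sum_i \sum_j sqmx M i j * (g i * g j).
    transitivity (\sum_k \sum_i \sum_j (M k i * M k j) * (g i * g j)).
      apply: eq_bigr => k _; rewrite expr2 /actM mulr_suml; apply: eq_bigr => i _.
      by rewrite mulr_sumr; apply: eq_bigr => j _; ring.
    rewrite exchange_big/=; apply: eq_bigr => i _.
    rewrite exchange_big/=; apply: eq_bigr => j _.
    by rewrite /sqmx mulr_suml; apply: eq_bigr => k _; rewrite (Msym k i).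
  (* This weight balances the squared Frobenius norm, at most [nu ^ 4], against [G ^ 2], the sum of
     the squares of [g i * g j]; each side contributes [nu ^ 2 * G / 2]. *)
  have s0 : 0 < nu ^+ 2 / G by rewrite divr_gt0// exprn_gt0.
  apply: (@le_trans _ _ (1 / 2 * ((nu ^+ 2 / G)^-1 * (\sum_i \sum_j sqmx M i j ^+ 2) +
      (nu ^+ 2 / G) * (G * G)))).
    rewrite {3}/G mulr_suml !mulr_sumr -big_split/= mulr_sumr; apply: ler_sum => i _.
    rewrite /G !mulr_sumr -big_split/= mulr_sumr; apply: ler_sum => j _.
    by rewrite -/G -exprMn; exact: gt0_le_sum_mul.
  have h := ler_wpM2l (ltW s0) sqmx_frobenius.
  have : (nu ^+ 2 / G)^-1 * (\sum_i \sum_j sqmx M i j ^+ 2) <= nu ^+ 2 * G.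
    apply: (@le_trans _ _ ((nu ^+ 2 / G)^-1 * (nu ^+ 4))).
      rewrite ler_wpM2l ?invr_ge0 ?(ltW s0)//.
      by apply: le_trans small; exact: sqmx_frobenius.
    have Gn0 : G != 0 by rewrite gt_eqF.
    rewrite le_eqVlt; apply/orP; left; apply/eqP; move: (G) Gn0 => G' Gn0.
    by field; rewrite Gn0 gt_eqF.
  have -> : nu ^+ 2 / G * (G * G) = nu ^+ 2 * G by rewrite mulrA divfK// gt_eqF.
  lra.
apply: (@le_trans _ _ (1 / 2 * (nu^-1 * (\sum_i actM g i ^+ 2) + nu * G))).
  rewrite /G !mulr_sumr -big_split/= mulr_sumr; apply: ler_sum => i _.
  by rewrite mulrC; exact: gt0_le_sum_mul.
have : nu^-1 * (\sum_i actM g i ^+ 2) <= nu * G.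
  by rewrite ler_pdivrMl// mulrA -expr2.
lra.
Qed.

(** The squared row sums add up to the sum of all entries of [M^2]: its trace concentrates at
    [N * (N - 1) * v] and the rest is the cherry sum. In the last term, 4 comes from [rowmean] and 1
    from replacing [N * (N - 1)] by [N ^ 2]. *)
Lemma devsum2_lln (sg sn : R) : 0 <= sg -> sg ^+ 2 = v -> 0 <= sn -> sn ^+ 2 = N ->
  `|\sum_i del i ^+ 2 - N ^+ 2 * v| <= K * (N * sg) + K * (N * sn * v) + 5 * K * (N * v).
Proof.
move=> sg0 sgv sn0 snN.
have [[_ _ _ _ h5] [h6 _]] := excess_split.
set V := \sum_i \sum_(j | j != i) sqmx M i j in h5.
set u := \sum_i sqmx M i i in h6.
have E : \sum_i eta i ^+ 2 = u + V.
  rewrite -big_split/=; under [RHS]eq_bigr => i _.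
    rewrite (_ : _ + _ = \sum_j sqmx M i j); last by rewrite [RHS](bigD1 i).
    over.
  rewrite exchange_big/= /sqmx; under [RHS]eq_bigr do rewrite exchange_big/=.
  rewrite [RHS]exchange_big/=; apply: eq_bigr => k _.
  rewrite expr2 /eta mulr_suml; apply: eq_bigr => i _.
  by rewrite mulr_sumr; apply: eq_bigr => j _; rewrite [in RHS](Msym j k) mulrC.
have K0' := K0; have N0' := N0; have v0' := v0; have K1' := K1.
have hV : `|V| <= K * (N * sn * v).
  apply: sqr_le_norm; first by rewrite !mulr_ge0// ltW.
  apply: (le_trans h5).
  rewrite (_ : (K * (N * sn * v)) ^+ 2 = K * (K * (N ^+ 2 * sn ^+ 2 * v ^+ 2))); last by ring.
  rewrite snN (_ : N ^+ 2 * N * v ^+ 2 = c); last by rewrite /c; ring.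
  by apply: ler_wpM2l; [exact: ltW|rewrite ler_peMl// ltW].
have hu : `|u - N * (N - 1) * v| <= K * (N * sg).
  apply: sqr_le_norm; first by rewrite !mulr_ge0// ltW.
  apply: (le_trans h6).
  rewrite (_ : (K * (N * sg)) ^+ 2 = K * (K * (N ^+ 2 * sg ^+ 2))); last by ring.
  rewrite sgv; apply: ler_wpM2l; first exact: ltW.
  by rewrite ler_peMl// ltW// mulr_gt0 ?exprn_gt0.
have hr := rowmean2.
have hr' : N * rowmean ^+ 2 <= 4 * K * (N * v).
  by rewrite (_ : 4 * K * (N * v) = N * (4 * K * v)); [rewrite ler_wpM2l ?(ltW N0)|ring].
have hr0 : 0 <= N * rowmean ^+ 2 by rewrite mulr_ge0 ?sqr_ge0 ?(ltW N0).
have Kv : N * v <= K * (N * v) by rewrite ler_peMl// mulr_ge0 ?(ltW N0) ?(ltW v0).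
have Nv : 0 <= N * v by rewrite mulr_ge0 ?(ltW N0) ?(ltW v0).
rewrite sum_devsum2E E.
move: hV hu; rewrite !ler_norml => /andP[V1 V2] /andP[u1 u2].
have -> : u + V - N * rowmean ^+ 2 - N ^+ 2 * v =
  (u - N * (N - 1) * v) + V - N * rowmean ^+ 2 - N * v by ring.
move: (u - N * (N - 1) * v) u1 u2 => u' u1 u2.
clear E hr.
by apply/andP; split; lra.
Qed.

End excess_consequences.

Lemma max_quad_form_expansion (R : realType) (r K : R) : 2 <= r -> 1 <= K ->
  exists2 C : R, 0 <= C & forall (n : nat) (A : 'M[R]_n) (mu sn t : R),
    (0 < n)%N -> 0 < mu -> 0 < sn -> sn ^+ 2 = n%:R -> A^T = A ->
    (forall i, A i i = 0) -> n%:R^-1 <= t -> C * t <= 1 -> C * (n%:R * t ^+ 4) <= 1 ->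
    let sg := sn * mu * t in
    let M i j := if i == j then 0 else A i j - mu in
    excess_stat (sg ^+ 2) M <= K ->
  `|sg^-1 * (max_quad_form r (n%:R `^ (- (1 - 2 / r)) *: A) -
      ((n%:R - 1) * mu + sg ^+ 2 / ((r - 1) * mu))) - 2 * edgesum M / (n%:R * sg)| <=
  C * (sn * t ^+ 2) + K / (n%:R * mu) + 6 * K * t.
Proof.
move=> r2 K1.
(* The constant of [devsum4], the largest one required; the bounds for [D], [a2] and [Ba] need only
   [3 * K], [3 * K] and [90 * K ^ 2]. *)
pose K' := 160 * K ^+ 2.
have K'1 : 1 <= K' by rewrite /K' expr2; nra.
have [C1 C10 HC1] := qform_extremes r2 K'1.
(* The three summands serve the cubic error, the bound on the largest [|a i|], and the spectral gap,
   where [512 = 2 * 4 ^ 4]. *)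
exists (C1 + K' * (4 * r) ^+ 4 + 512 * K).
  have r0 : 0 <= r by apply: le_trans r2.
  have K0 : 0 <= K by apply: le_trans K1.
  apply: addr_ge0; last by apply: mulr_ge0 K0; exact: ler0n.
  apply: (addr_ge0 C10); apply: mulr_ge0; first by apply: le_trans K'1.
  by apply: exprn_ge0; exact: mulr_ge0.
set C := C1 + _ + _.
move=> n A mu sn t n0 mu0 sn0 snN Asym Aii nt Ct Cnt sg M stat.
have N0 : 0 < n%:R :> R by rewrite ltr0n.
have t0 : 0 < t by apply: lt_le_trans nt; rewrite invr_gt0.
have sg0 : 0 < sg by rewrite !mulr_gt0.
have v0 : 0 < sg ^+ 2 by rewrite exprn_gt0.
have vE : sg ^+ 2 = n%:R * mu ^+ 2 * t ^+ 2 by rewrite /sg !exprMn snN.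
have K0 : 0 < K by apply: lt_le_trans K1.
have r1 : 1 <= r - 1 by rewrite lerBrDr.
have r10 : 0 < r - 1 by apply: lt_le_trans r1.
have Msym i j : M i j = M j i.
  by rewrite /M eq_sym -[in LHS]Asym mxE.
have Mii i : M i i = 0 by rewrite /M eqxx.
have [N' N'E] : exists N' : R, N' = n%:R * mu by eexists.
have N'0 : 0 < N' by rewrite N'E mulr_gt0.
(* [A] is [mu] times the all-ones matrix, minus [mu] times the identity, plus [M]. *)
have AM i x : \sum_j A i j * x j = mu * (\sum_j x j) - mu * x i + actM M x i.
  rewrite /actM (bigD1 i)//= Aii mul0r add0r.
  have e1 : \sum_j x j = x i + \sum_(j | j != i) x j by rewrite (bigD1 i).
  have e2 : \sum_j M i j * x j = \sum_(j | j != i) M i j * x j.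
    by rewrite (bigD1 i)//= Mii mul0r add0r.
  rewrite e1 e2 (_ : mu * (x i + _) - mu * x i = mu * \sum_(j | j != i) x j); last by ring.
  rewrite mulr_sumr -big_split/=.
  by apply: eq_bigr => j ji; rewrite /M eq_sym (negbTE ji); ring.
pose del := devsum M; pose rm := rowmean M.
pose a i := del i / ((r - 1) * N'); pose D := ((n%:R - 1) * mu + rm) / N'.
pose B := N'^-1 *: A.
have qB x : qform A x = N' * qform B x.
  rewrite /qform mulr_sumr; apply: eq_bigr => i _; rewrite mulrCA; congr (_ * _).
  rewrite /mulmf mulr_sumr; apply: eq_bigr => j _.
  by rewrite mxE !mulrA divff ?mul1r// gt_eqF.
have mB x i : mulmf B x i = N'^-1 * (mu * (\sum_j x j) - mu * x i + actM M x i).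
  rewrite -AM /mulmf mulr_sumr; apply: eq_bigr => j _; by rewrite mxE mulrA.
have sa : \sum_i a i = 0 by rewrite /a -mulr_suml sum_devsum// mul0r.
have Bs : B^T = B by apply/matrixP => i j; rewrite !mxE -[in LHS]Asym mxE.
have rowB i : \sum_j B i j = D + (r - 1) * a i.
  have -> : \sum_j B i j = mulmf B (fun=> 1) i.
    by apply: eq_bigr => j _; rewrite mulr1.
  rewrite mB sumr_const card_ord /a /D /del /devsum -/rm.
  rewrite (_ : actM M (fun=> 1) i = rowsums M i); last first.
    by apply: eq_bigr => j _; rewrite mulr1.
  by rewrite N'E; field; rewrite !gt_eqF.
have K2 : K <= K ^+ 2 by rewrite expr2 ler_peMl// ltW.
have r1inv (k : nat) : (r - 1) ^- k <= 1.
  by rewrite invf_le1 ?exprn_gt0// exprn_ege1.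
have c4 : n%:R ^+ 3 * (sg ^+ 2) ^+ 2 = N' ^+ 4 * (n%:R * t ^+ 4).
  by rewrite vE N'E; ring.
have c2 : n%:R ^+ 2 * sg ^+ 2 = N' ^+ 2 * (n%:R * t ^+ 2).
  by rewrite vE N'E; ring.
have a2 : \sum_i a i ^+ 2 <= K' * n%:R * t ^+ 2.
  have -> : \sum_i a i ^+ 2 = (r - 1) ^- 2 * (N' ^- 2 * \sum_i del i ^+ 2).
    rewrite !mulr_sumr; apply: eq_bigr => i _; rewrite /a.
    by field; rewrite !gt_eqF.
  have h : N' ^- 2 * \sum_i del i ^+ 2 <= K' * n%:R * t ^+ 2.
    rewrite ler_pdivrMl ?exprn_gt0//; apply: (le_trans (devsum2 n0 v0 K1 stat)).
    rewrite c2 (_ : N' ^+ 2 * (K' * _ * _) = K' * (N' ^+ 2 * (n%:R * t ^+ 2))); last by ring.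
    rewrite ler_wpM2r ?mulr_ge0 ?exprn_ge0 ?(ltW t0) ?(ltW N'0)//.
    by rewrite /K'; lra.
  apply: le_trans h; rewrite ler_piMl ?r1inv// mulr_ge0 ?invr_ge0 ?exprn_ge0 ?(ltW N'0)//.
  by apply: sumr_ge0 => i _; exact: sqr_ge0.
have a4 : \sum_i a i ^+ 4 <= K' * n%:R * t ^+ 4.
  have -> : \sum_i a i ^+ 4 = (r - 1) ^- 4 * (N' ^- 4 * \sum_i del i ^+ 4).
    rewrite !mulr_sumr; apply: eq_bigr => i _; rewrite /a.
    by field; rewrite !gt_eqF.
  have h : N' ^- 4 * \sum_i del i ^+ 4 <= K' * n%:R * t ^+ 4.
    rewrite ler_pdivrMl ?exprn_gt0//; apply: (le_trans (devsum4 n0 v0 K1 Msym Mii stat)).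
    by rewrite c4 (_ : N' ^+ 4 * (K' * _ * _) = K' * (N' ^+ 4 * (n%:R * t ^+ 4))); last by ring.
  apply: le_trans h; rewrite ler_piMl ?r1inv// mulr_ge0 ?invr_ge0 ?exprn_ge0 ?(ltW N'0)//.
  by apply: sumr_ge0 => i _; rewrite exprn_even_ge0.
have n1 : 1 <= n%:R :> R by rewrite ler1n.
have Ba : \sum_i mulmf B a i ^+ 2 <= K' * n%:R * t ^+ 4.
  have E i : mulmf B a i = (r - 1)^-1 * (N' ^- 2 * (actM M del i - mu * del i)).
    rewrite mB sa mulr0 sub0r (_ : actM M a i = (N'^-1 / (r - 1)) * actM M del i).
      by rewrite /a; field; rewrite !gt_eqF.
    rewrite /actM mulr_sumr; apply: eq_bigr => j _; rewrite /a.
    by field; rewrite !gt_eqF.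
  have h1 := actM_devsum2 n0 v0 K1 Msym Mii stat.
  have h2 := devsum2 n0 v0 K1 stat.
  rewrite c4 in h1; rewrite c2 in h2.
  (* The zero diagonal of [A] produces [mu * del i]; because [n^-1 <= t], it is no larger in order
     than [actM M del i]. *)
  have h3 : mu ^+ 2 * (\sum_i del i ^+ 2) <= 3 * K * (N' ^+ 4 * (n%:R * t ^+ 4)).
    apply: (@le_trans _ _ (mu ^+ 2 * (3 * K * (N' ^+ 2 * (n%:R * t ^+ 2))))).
      by rewrite ler_wpM2l ?exprn_ge0 ?(ltW mu0).
    have nt2 : 1 <= n%:R ^+ 2 * t ^+ 2.
      rewrite -exprMn exprn_ege1//; move: nt; rewrite -(ler_pM2l N0) divff ?gt_eqF//.
    have -> : 3 * K * (N' ^+ 4 * (n%:R * t ^+ 4)) =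
        (n%:R ^+ 2 * t ^+ 2) * (mu ^+ 2 * (3 * K * (N' ^+ 2 * (n%:R * t ^+ 2)))).
      by rewrite N'E; ring.
    by rewrite ler_peMl// !mulr_ge0 ?exprn_ge0 ?(ltW t0) ?(ltW N'0) ?(ltW mu0) ?(ltW K0).
  apply: (@le_trans _ _ (N' ^- 4 * (2 * ((\sum_i actM M del i ^+ 2) + mu ^+ 2 * (\sum_i del i ^+ 2))))).
    rewrite [mu ^+ 2 * _]mulr_sumr -big_split/= !mulr_sumr; apply: ler_sum => i _.
    rewrite E !exprMn exprVn (_ : (N' ^- 2) ^+ 2 = N' ^- 4); last by rewrite -exprVn -exprM exprVn.
    apply: (@le_trans _ _ (1 * (N' ^- 4 * (actM M del i - mu * del i) ^+ 2))).
      rewrite ler_wpM2r ?r1inv// mulr_ge0 ?sqr_ge0// invr_ge0 exprn_ge0// ltW//.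
    rewrite mul1r ler_wpM2l ?invr_ge0 ?exprn_ge0 ?(ltW N'0)//.
    by have := sqr_ge0 (actM M del i + mu * del i); nra.
  rewrite ler_pdivrMl ?exprn_gt0//.
  have -> : N' ^+ 4 * (K' * n%:R * t ^+ 4) = K' * (N' ^+ 4 * (n%:R * t ^+ 4)) by ring.
  have X0 : 0 <= N' ^+ 4 * (n%:R * t ^+ 4).
    by rewrite !mulr_ge0 ?exprn_ge0 ?(ltW t0) ?(ltW N'0).
  have KX : K * (N' ^+ 4 * (n%:R * t ^+ 4)) <= K ^+ 2 * (N' ^+ 4 * (n%:R * t ^+ 4)).
    by rewrite ler_wpM2r.
  rewrite /K'; clear -h1 h3 X0 KX; nra.
have K'0 : 0 <= K' by rewrite /K' mulr_ge0 ?sqr_ge0.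
have r0 : 0 < r by apply: lt_le_trans r2.
have Xr0 : 0 <= K' * (4 * r) ^+ 4.
  by rewrite mulr_ge0// exprn_ge0// mulr_ge0// ltW.
have CK0 : 0 <= 512 * K by apply: mulr_ge0 (ltW K0); exact: ler0n.
have nt4 : 0 <= n%:R * t ^+ 4 by rewrite mulr_ge0 ?exprn_ge0 ?(ltW N0) ?(ltW t0).
(* One entry is bounded by the whole sum of fourth powers, of order [n * t ^ 4], which [Cnt] makes
   small. *)
have amax i : `|a i| <= 1 / (4 * r).
  have r40 : 0 < 4 * r by rewrite mulr_gt0.
  rewrite leNgt; apply/negP => h.
  have h4 : (1 / (4 * r)) ^+ 4 < a i ^+ 4.
    rewrite -[ltRHS]ger0_norm ?exprn_even_ge0// normrX ltrXn2r ?nnegrE//.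
    by rewrite divr_ge0// ltW.
  have h5 : a i ^+ 4 <= K' * n%:R * t ^+ 4.
    apply: le_trans a4; rewrite (bigD1 i)//= lerDl; apply: sumr_ge0 => j _.
    by rewrite exprn_even_ge0.
  have h6 : (4 * r) ^+ 4 * (K' * n%:R * t ^+ 4) <= 1.
    apply: le_trans Cnt; rewrite (_ : _ * _ = K' * (4 * r) ^+ 4 * (n%:R * t ^+ 4)); last by ring.
    by rewrite ler_wpM2r// /C; lra.
  have := lt_le_trans h4 h5; rewrite expr_div_n expr1n -(ltr_pM2l (exprn_gt0 4 r40)).
  by rewrite mul1r divff ?gt_eqF ?exprn_gt0// ltNge h6.
(* On mean-zero vectors the all-ones part vanishes and the diagonal part is nonpositive, so only the
   spectral norm of [M] matters. *)
have gap g : \sum_i g i = 0 -> qform B g <= 1 / 4 * \sum_i g i ^+ 2.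
  move=> g0; rewrite -(ler_pM2l N'0) -qB.
  have -> : qform A g = \sum_i g i * actM M g i - mu * \sum_i g i ^+ 2.
    rewrite mulr_sumr -sumrB; apply: eq_bigr => i _.
    by rewrite /mulmf AM g0; ring.
  have nu0 : 0 < N' / 4 by rewrite divr_gt0.
  have small : 2 * K * (n%:R ^+ 3 * (sg ^+ 2) ^+ 2) <= (N' / 4) ^+ 4.
    rewrite c4 expr_div_n ler_pdivlMr ?exprn_gt0//.
    have h : 512 * K * (n%:R * t ^+ 4) <= 1.
      by apply: le_trans Cnt; rewrite ler_wpM2r// /C; lra.
    have -> : 2 * K * (N' ^+ 4 * (n%:R * t ^+ 4)) * 4 ^+ 4 =
      N' ^+ 4 * (512 * K * (n%:R * t ^+ 4)) by ring.
    by rewrite ler_piMr// exprn_ge0// ltW.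
  have h := form_gap n0 v0 Msym stat g nu0 small.
  have hm : 0 <= mu * \sum_i g i ^+ 2.
    by rewrite mulr_ge0 ?(ltW mu0)//; apply: sumr_ge0 => i _; exact: sqr_ge0.
  clear -h hm; lra.
have rm2 : rm ^+ 2 <= 4 * K * sg ^+ 2 := rowmean2 n0 v0 Msym Mii stat.
have snt : sn <= n%:R.
  by rewrite -snN expr2 ler_peMl ?(ltW sn0)// -(@ler_pXn2r _ 2)// ?nnegrE ?(ltW sn0)// expr1n snN.
have Dt : `|D - 1| <= K' * t.
  have -> : D - 1 = N'^-1 * (rm - mu) by rewrite /D N'E; field; rewrite !gt_eqF.
  rewrite normrM gtr0_norm ?invr_gt0// ler_pdivrMl//.
  have hrm : `|rm| <= 2 * K * (N' * t).
    apply: sqr_le_norm; first by rewrite !mulr_ge0 ?(ltW N'0) ?(ltW K0) ?(ltW t0).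
    apply: (le_trans rm2).
    have -> : (2 * K * (N' * t)) ^+ 2 = 4 * K ^+ 2 * ((n%:R * mu * t) ^+ 2) by rewrite N'E; ring.
    have h1 : 4 * K * sg ^+ 2 <= 4 * K ^+ 2 * sg ^+ 2.
      by apply: ler_wpM2r; [exact: sqr_ge0|exact: ler_wpM2l].
    apply: (le_trans h1); apply: ler_wpM2l; first by apply: mulr_ge0 => //; exact: sqr_ge0.
    have h2 : sg <= n%:R * mu * t.
      by rewrite /sg -!mulrA; apply: ler_wpM2r => //; rewrite mulr_ge0 ?(ltW mu0) ?(ltW t0).
    by rewrite lerXn2r// nnegrE ?(ltW sg0)//; apply: le_trans h2; exact: ltW.
  have hmu : mu <= N' * t.
    rewrite N'E mulrAC ler_peMl ?(ltW mu0)//.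
    by move: nt; rewrite -(ler_pM2l N0) divff ?gt_eqF.
  have NT0 : 0 <= N' * t by rewrite mulr_ge0 ?(ltW N'0) ?(ltW t0).
  have KT : K * (N' * t) <= K ^+ 2 * (N' * t) by rewrite ler_wpM2r.
  have K1T : N' * t <= K * (N' * t) by rewrite ler_peMl.
  apply: (le_trans (ler_normB _ _)); rewrite (gtr0_norm mu0) /K'.
  clear -hrm hmu NT0 KT K1T; lra.
have C1t : C1 * t <= 1.
  apply: le_trans Ct; rewrite ler_wpM2r ?(ltW t0)// /C.
  by clear -Xr0 CK0; lra.
have [up lo] := HC1 n B a D t n0 t0 Bs rowB sa Dt a2 a4 Ba amax gap C1t.
set vv := D + _ in up lo.
have t30 : 0 <= t ^+ 3 by rewrite exprn_ge0// ltW.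
have main : N' * (vv - C1 * t ^+ 3) <=
    max_quad_form r (n%:R `^ (- (1 - 2 / r)) *: A) <= N' * (vv + C1 * t ^+ 3).
  apply: max_quad_form_bounds => //.
    by move=> y /up h; rewrite qB [leRHS]mulrCA; apply: ler_wpM2l => //; exact: ltW.
  have [z zr hz] := lo; exists z => //.
  by rewrite qB [leLHS]mulrCA; apply: ler_wpM2l => //; exact: ltW.
set mq := max_quad_form _ _ in main *.
pose V2 := \sum_i del i ^+ 2.
have vvE : N' * vv = (n%:R - 1) * mu + rm + V2 / ((r - 1) * (n%:R ^+ 2 * mu)).
  rewrite /vv; have -> : \sum_i a i ^+ 2 = V2 / ((r - 1) * N') ^+ 2.
    by rewrite /V2 mulr_suml; apply: eq_bigr => i _; rewrite /a expr_div_n.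
  by rewrite /D N'E; field; rewrite !gt_eqF.
have lln := devsum2_lln n0 v0 K1 Msym Mii stat (ltW sg0) (erefl _) (ltW sn0) snN.
rewrite -/del -/V2 in lln.
have rmE : 2 * edgesum M / (n%:R * sg) = rm / sg.
  by rewrite /rm /rowmean sum_rowsums//; field; rewrite !gt_eqF.
(* The linear statistic cancels exactly against [rm]; what remains is the cubic error and the
   deviation of [V2] from [n ^ 2 * sg ^ 2]. *)
have E : sg^-1 * (mq - ((n%:R - 1) * mu + sg ^+ 2 / ((r - 1) * mu))) -
    2 * edgesum M / (n%:R * sg) = sg^-1 * (mq - N' * vv) +
    (V2 - n%:R ^+ 2 * sg ^+ 2) / ((r - 1) * (n%:R ^+ 2 * mu * sg)).
  by rewrite rmE vvE; field; rewrite !gt_eqF.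
rewrite E; apply: (le_trans (ler_normD _ _)); rewrite -addrA; apply: lerD.
  have h : `|mq - N' * vv| <= N' * (C1 * t ^+ 3).
    by rewrite ler_distl -mulrBr -mulrDr.
  rewrite normrM gtr0_norm ?invr_gt0// ler_pdivrMl//; apply: (le_trans h).
  have -> : sg * (C * (sn * t ^+ 2)) = C * (sn ^+ 2 * mu * t ^+ 3) by rewrite /sg; ring.
  rewrite snN (_ : N' * (C1 * t ^+ 3) = C1 * (n%:R * mu * t ^+ 3)); last by rewrite N'E; ring.
  apply: ler_wpM2r; last by rewrite /C; clear -Xr0 CK0; lra.
  by apply: mulr_ge0 => //; apply: mulr_ge0; exact: ltW.
have q0 : 0 < n%:R ^+ 2 * mu * sg by rewrite !mulr_gt0 ?exprn_gt0.
rewrite normrM [X in _ * X]gtr0_norm; last by rewrite invr_gt0 mulr_gt0.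
rewrite ler_pdivrMr ?mulr_gt0//.
apply: (@le_trans _ _ ((K / (n%:R * mu) + 6 * K * t) * (n%:R ^+ 2 * mu * sg))); last first.
  rewrite ler_wpM2l//; last by rewrite ler_peMl// ltW.
  by rewrite addr_ge0 ?divr_ge0 ?mulr_ge0 ?(ltW K0) ?(ltW mu0) ?(ltW t0).
apply: (le_trans lln).
have -> : (K / (n%:R * mu) + 6 * K * t) * (n%:R ^+ 2 * mu * sg) =
    K * (n%:R * sg) + 6 * K * (n%:R * (n%:R * mu * t) * sg).
  by field; rewrite !gt_eqF.
have snsg : n%:R * mu * t = sn * sg by rewrite -snN /sg; ring.
rewrite snsg.
have e1 : n%:R * (sn * sg) * sg = n%:R * sn * sg ^+ 2 by ring.
rewrite e1.
have sn1 : 1 <= sn.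
  by rewrite -(@ler_pXn2r _ 2)// ?nnegrE ?(ltW sn0)// expr1n snN.
have e2 : n%:R * sg ^+ 2 <= n%:R * sn * sg ^+ 2.
  by rewrite mulrAC ler_peMr// mulr_ge0 ?(ltW v0).
have e3 : 5 * K * (n%:R * sg ^+ 2) <= 5 * K * (n%:R * sn * sg ^+ 2).
  by rewrite ler_wpM2l// mulr_ge0// ltW.
clear -e3; lra.
Qed.

(** * The Stein equation *)

Section gaussian_weight.
Context {R : realType}.
Local Notation leb := (@lebesgue_measure R).

(** The standard deviation is [sqrt 2], so the density satisfies [2 * w' = - x * w], which makes it
    the integrating factor of the Stein operator. *)
Definition gdens : R -> R := normal_pdf 0 (Num.sqrt 2).

Let sq2 : Num.sqrt 2 != 0 :> R. Proof. by rewrite gt_eqF// sqrtr_gt0. Qed.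

Lemma gdensE x : gdens x = normal_peak (Num.sqrt 2) * expR (- (x ^+ 2 / 4)).
Proof.
rewrite /gdens normal_pdfE//= /normal_fun subr0 sqr_sqrtr//.
by congr (_ * expR _); rewrite mulNr -mulr_natr -natrM.
Qed.

Lemma gdens_gt0 x : 0 < gdens x.
Proof. by rewrite gdensE mulr_gt0 ?expR_gt0 ?normal_peak_gt0. Qed.

Lemma is_derive_gdens (x : R) : is_derive x (1 : R) gdens (- (x / 2) * gdens x).
Proof.
have -> : gdens = (fun x => normal_peak (Num.sqrt 2) * expR ((- 4^-1) * x ^+ 2)).
  by apply/funext => y; rewrite gdensE; congr (_ * expR _); rewrite mulNr mulrC.
have -> : - (x / 2) * (normal_peak (Num.sqrt 2) * expR (- 4^-1 * x ^+ 2)) =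
    normal_peak (Num.sqrt 2) * (expR (- 4^-1 * x ^+ 2) * (- 4^-1 * (2 * x))).
  by field.
apply: is_deriveZ_fun; apply: is_derive_comp_fun.
by apply: is_deriveZ_fun; exact: is_derive_sqr.
Qed.

Lemma continuous_gdens : continuous gdens.
Proof. exact: continuous_normal_pdf. Qed.

Lemma integrable_gdens : leb.-integrable setT (EFin \o gdens).
Proof. exact: integrable_normal_pdf. Qed.

Lemma gdensN x : gdens (- x) = gdens x.
Proof. by rewrite !gdensE sqrrN. Qed.

Lemma gdens_cvg0 : gdens x @[x --> +oo] --> (0 : R).
Proof.
rewrite -[X in _ --> X](mulr0 (normal_peak (Num.sqrt (2 : R)))).
under eq_fun do rewrite gdensE.
apply: cvgMr; apply: (@squeeze_cvgr _ _ _ _ (fun=> 0) (fun x => expR (- x))).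
- near=> x; rewrite expR_ge0/= ler_expR lerN2 ler_pdivlMr// mulrC expr2.
  by rewrite ler_wpM2r//; near: x; exact: nbhs_pinfty_ge.
- exact: cvg_cst.
- exact: cvgr_expR.
Unshelve. all: by end_near. Qed.

(** For [t >= 1] the integrand is at most [t * gdens t], which has the primitive [- 2 * gdens t]. *)
Lemma gdens_tail (x : R) : 1 <= x ->
  (\int[leb]_(t in `[x, +oo[) (gdens t)%:E <= (2 * gdens x)%:E)%E.
Proof.
move=> x1.
have dF (t : R) : is_derive t (1 : R) (fun t => - 2 * gdens t) (t * gdens t).
  rewrite (_ : t * gdens t = - 2 * (- (t / 2) * gdens t)); last by field.
  exact/is_deriveZ_fun/is_derive_gdens.
have E : (\int[leb]_(t in `[x, +oo[) (t * gdens t)%:E = (2 * gdens x)%:E)%E.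
  rewrite (@ge0_continuous_FTC2y R (fun t => t * gdens t) (fun t => - 2 * gdens t) x 0).
  - by rewrite -EFinD sub0r mulNr opprK.
  - move=> t xt; rewrite mulr_ge0 ?(ltW (gdens_gt0 _))//.
    by rewrite (le_trans _ xt)// (le_trans _ x1).
  - apply: continuous_subspaceT => t; apply: cvgM; first exact: cvg_id.
    exact: continuous_gdens.
  - rewrite -[X in _ --> X](mulr0 (- 2)); apply: cvgMr; exact: gdens_cvg0.
  - by move=> t _; exact: ex_derive.
  - apply: cvg_at_right_filter; apply: cvgMr; exact: continuous_gdens.
  - by move=> t _; rewrite derive1E; exact: derive_val.
rewrite -E; apply: ge0_le_integral => //.
- by move=> t _; rewrite lee_fin ltW// gdens_gt0.
- apply/measurable_EFinP/measurable_funTS.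
  by apply: continuous_measurable_fun; exact: continuous_gdens.
- apply/measurable_EFinP/measurable_funTS; apply: measurable_funM => //.
  by apply: continuous_measurable_fun; exact: continuous_gdens.
- move=> t; rewrite /= in_itv/= andbT => xt.
  rewrite lee_fin ler_peMl ?(ltW (gdens_gt0 _))//; exact: le_trans xt.
Qed.

End gaussian_weight.

(** If [y x0] exceeded [c = 2 * K / x0], then [expR (- x ^ 2 / 4) * (y x - c)] would be
    nondecreasing beyond [x0], its derivative being a positive factor times [c * x / 2 + k x]. Then
    [y] would grow like [expR (x ^ 2 / 4)], against its boundedness; the value of [B] does not enter
    the conclusion. *)
Lemma stein_growth (R : realType) (y k : R -> R) (K B x0 : R) :
  (forall x : R, is_derive x (1 : R) y (1 / 2 * x * y x + k x)) ->
  (forall x, `|k x| <= K) -> (forall x, `|y x| <= B) ->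
  0 < x0 -> x0 * y x0 <= 2 * K.
Proof.
move=> dy kK yB x00; rewrite leNgt; apply/negP => big.
have K0 : 0 <= K by apply: le_trans (kK 0).
pose e x : R := expR (- 4^-1 * x ^+ 2).
have de (x : R) : is_derive x (1 : R) e (- (x / 2) * e x).
  rewrite (_ : - (x / 2) * e x = e x * (- 4^-1 * (2 * x))); last by field.
  apply: is_derive_comp_fun; apply: is_deriveZ_fun; exact: is_derive_sqr.
have e0 x : 0 < e x by exact: expR_gt0.
pose c := 2 * K / x0.
have dz (x : R) : is_derive x (1 : R) (fun x => e x * (y x - c))
    (- (x / 2) * e x * (y x - c) + e x * (1 / 2 * x * y x + k x - 0)).
  exact: (is_deriveM_fun (de x) (is_deriveB_fun (dy x) (is_derive_cst c x (1 : R)))).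
have cE : c * x0 = 2 * K by rewrite divfK// gt_eqF.
have kap0 : 0 < e x0 * (y x0 - c).
  by rewrite mulr_gt0// subr_gt0 /c ltr_pdivrMr// [ltRHS]mulrC.
set kap := e x0 * _ in kap0.
have mono x : x0 <= x -> kap <= e x * (y x - c).
  rewrite le_eqVlt => /predU1P[<-//|x0x].
  have cont : {within `[x0, x], continuous (fun x => e x * (y x - c))}.
    by apply: derivable_within_continuous => z _; apply: ex_derive; exact: dz.
  have [z] := MVT x0x (fun z _ => dz z) cont.
  rewrite in_itv/= => /andP[z1 z2] E; rewrite -subr_ge0 E mulr_ge0//; last first.
    by rewrite subr_ge0 ltW.
  rewrite (_ : _ + _ = e z * (c * z / 2 + k z)); last by field.
  rewrite mulr_ge0 ?(ltW (e0 _))//.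
  have h1 : K <= c * z / 2.
    have : c * x0 <= c * z.
      by rewrite ler_wpM2l ?(ltW z1)// divr_ge0 ?mulr_ge0 ?(ltW x00).
    rewrite cE; clear; lra.
  have := kK z; rewrite ler_norml => /andP[h2 _]; clear -h1 h2; lra.
have B0 : 0 <= B by apply: le_trans (yB 0).
have c0 : 0 <= c by rewrite divr_ge0 ?mulr_ge0 ?(ltW x00).
have grow x : x0 <= x -> kap * (1 + 4^-1 * x ^+ 2) <= B.
  move=> /mono h.
  have ex : e x * expR (4^-1 * x ^+ 2) = 1.
    by rewrite /e mulNr mulrC expRxMexpNx_1.
  have h1 : kap * expR (4^-1 * x ^+ 2) <= y x - c.
    have := ler_wpM2r (expR_ge0 (4^-1 * x ^+ 2)) h.
    by rewrite [X in _ <= X -> _]mulrAC ex mul1r.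
  have h2 : y x - c <= B.
    have := yB x; rewrite ler_norml => /andP[_ h2].
    by clear -h2 c0; lra.
  apply: le_trans h2; apply: le_trans h1.
  by rewrite ler_wpM2l ?(ltW kap0)//; exact: expR_ge1Dx.
(* Being at least 2 and at least [4 * B / kap], this point has [x1 ^ 2 / 4 >= 2 * B / kap], enough
   to exceed the bound. *)
pose x1 := x0 + 2 + 4 * B / kap.
have q0 : 0 <= B / kap by rewrite divr_ge0 ?(ltW kap0).
have x01 : x0 <= x1 by rewrite /x1 -mulrA; clear -q0; lra.
have := grow _ x01; apply/negP; rewrite -ltNge.
have x12 : 2 <= x1 by rewrite /x1 -mulrA; clear -q0 x00; lra.
have x1q : 4 * (B / kap) <= x1 by rewrite /x1 -mulrA; clear -q0 x00; lra.
have h3 : 2 * (4 * (B / kap)) <= x1 ^+ 2.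
  by rewrite expr2; apply: ler_pM => //; rewrite mulr_ge0.
have h4 : 1 + B / kap <= 1 + 4^-1 * x1 ^+ 2 by clear -h3 q0; lra.
apply: lt_le_trans (ler_wpM2l (ltW kap0) h4).
by rewrite mulrDr mulr1 mulrCA divff ?mulr1 ?gt_eqF// ltrDr.
Qed.

(** The class of equations is stable under [y -> - y] and [x -> - x], which yields the remaining
    signs. *)
Lemma stein_growth_norm (R : realType) (y k : R -> R) (K B : R) :
  (forall x : R, is_derive x (1 : R) y (1 / 2 * x * y x + k x)) ->
  (forall x, `|k x| <= K) -> (forall x, `|y x| <= B) ->
  forall x, `|x * y x| <= 2 * K.
Proof.
move=> dy kK yB.
have K0 : 0 <= K by apply: le_trans (kK 0).
have dN (x : R) : is_derive x (1 : R) (fun x => - y x) (1 / 2 * x * (- y x) + - k x).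
  have := @is_deriveZ_fun R y (-1) x _ (dy x).
  rewrite (_ : (fun _ => _) = (fun x => - y x)); last by apply/funext => z; rewrite mulN1r.
  by rewrite (_ : -1 * _ = 1 / 2 * x * (- y x) + - k x)//; ring.
have dR (x : R) : is_derive x (1 : R) (fun x => y (- x)) (1 / 2 * x * y (- x) + - k (- x)).
  have dopp : is_derive x (1 : R) (fun x : R => - x) (-1) by exact: is_deriveNid.
  have := is_derive_comp_fun (f := y) (dy (- x)) dopp.
  by rewrite (_ : _ * -1 = 1 / 2 * x * y (- x) + - k (- x))//; ring.
have dRN (x : R) : is_derive x (1 : R) (fun x => - y (- x))
    (1 / 2 * x * (- y (- x)) + k (- x)).
  have := @is_deriveZ_fun R (fun x => y (- x)) (-1) x _ (dR x).
  rewrite (_ : (fun _ => _) = (fun x => - y (- x))); last by apply/funext => z; rewrite mulN1r.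
  by rewrite (_ : -1 * _ = 1 / 2 * x * (- y (- x)) + k (- x))//; ring.
have [nN nR nB] : [/\ (forall x, `|- k x| <= K), (forall x, `|- k (- x)| <= K) &
    (forall x, `|- y x| <= B)] by split=> x; rewrite normrN.
move=> x; have [x0|x0|<-] := ltgtP 0 x; last by rewrite mul0r normr0 mulr_ge0.
- rewrite ler_norml; apply/andP; split.
    have := stein_growth dN nN nB x0; rewrite mulrN; clear; lra.
  exact: stein_growth dy kK yB x0.
- have x0' : 0 < - x by rewrite oppr_gt0.
  have := stein_growth dR nR (fun x => yB (- x)) x0'.
  have := stein_growth dRN (fun x => kK (- x)) (fun x => nB (- x)) x0'.
  rewrite opprK mulrNN mulNr => h1 h2; rewrite ler_norml; apply/andP; split => //.
  by clear -h2; lra.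
Qed.

Lemma derive_bounded_lipschitz (R : realType) (f df : R -> R) (K : R) :
    (forall x : R, is_derive x (1 : R) f (df x)) -> (forall x, `|df x| <= K) ->
  forall x y, `|f x - f y| <= K * `|x - y|.
Proof.
move=> fd dfK x y; wlog xy : x y / y < x.
  move=> H; have [xy|xy|->] := ltgtP x y.
  - by rewrite distrC [X in _ <= _ * X]distrC; exact: H.
  - exact: H.
  - by rewrite !subrr normr0 mulr0.
have cont : {within `[y, x], continuous f}.
  by apply: derivable_within_continuous => z _; apply: ex_derive; exact: fd.
have [z _ ->] := MVT xy (fun z _ => fd z) cont.
by rewrite normrM ler_wpM2r.
Qed.

Section stein_solution.
Context {R : realType}.
Local Notation leb := (@lebesgue_measure R).
Local Notation w := (@gdens R).
Variables (f df : R -> R) (L : R).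
Hypothesis f0 : forall x, 0 <= f x.
Hypothesis f1 : forall x, f x <= 1.
Hypothesis fd : forall x : R, is_derive x (1 : R) f (df x).
Hypothesis dfL : forall x, `|df x| <= L.

Definition gmean : R := \int[leb]_x (f x * w x).

Let cf : continuous f.
Proof.
move=> x; apply: differentiable_continuous; apply/derivable1_diffP.
by apply: ex_derive; exact: fd.
Qed.

Let mf : measurable_fun setT f. Proof. exact: continuous_measurable_fun. Qed.
Let mw : measurable_fun setT w.
Proof. by apply: continuous_measurable_fun; exact: continuous_gdens. Qed.
Let w0 x : 0 <= w x. Proof. exact/ltW/gdens_gt0. Qed.

Lemma integrable_f_gdens : leb.-integrable setT (EFin \o (fun x => f x * w x)).
Proof.
apply: (le_integrable _ _ _ integrable_gdens) => //.
  by apply/measurable_EFinP; exact: measurable_funM.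
move=> x _ /=; rewrite lee_fin !ger0_norm ?mulr_ge0//.
by rewrite ler_piMl.
Qed.

Let int_w : \int[leb]_x w x = 1.
Proof. by rewrite /Rintegral integral_normal_pdf. Qed.

Lemma gmean01 : 0 <= gmean <= 1.
Proof.
apply/andP; split; first by apply: Rintegral_ge0 => x _; rewrite mulr_ge0.
rewrite -int_w; apply: le_Rintegral => //.
- exact: integrable_f_gdens.
- exact: integrable_gdens.
- by move=> x _; rewrite ler_piMl.
Qed.

Let h x := f x - gmean.
Let h1 x : `|h x| <= 1.
Proof.
have /andP[m0 m1] := gmean01; have a0 := f0 x; have a1 := f1 x.
by rewrite ler_norml /h; apply/andP; split; lra.
Qed.

Let hw x := h x * w x.
Let ihw : leb.-integrable setT (EFin \o hw).
Proof.
apply: (le_integrable _ _ _ integrable_gdens) => //.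
  apply/measurable_EFinP; apply: measurable_funM => //.
  exact: measurable_funB.
move=> x _ /=; rewrite lee_fin normrM [leRHS]ger0_norm// [X in _ * X]ger0_norm//.
by rewrite ler_piMl.
Qed.

Let int_hw : \int[leb]_x hw x = 0.
Proof.
have -> : \int[leb]_x hw x = \int[leb]_x (f x * w x - gmean * w x).
  by apply: eq_Rintegral => x _; rewrite /hw /h mulrBl.
rewrite RintegralB//; first last.
- exact: (integrableZl measurableT gmean integrable_gdens).
- exact: integrable_f_gdens.
rewrite RintegralZl//; last exact: integrable_gdens.
by rewrite int_w mulr1 -/gmean subrr.
Qed.

(** Variation of constants: [G / (2 * w)] solves the Stein equation. As [hw] has integral 0, [G] is
    also minus the integral over the right tail, which makes it comparable to [w] at both ends. *)
Let G x := \int[leb]_(t in [set` Interval -oo%O (BRight x)]) hw t.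

Let ihwS (A : set R) : measurable A -> leb.-integrable A (EFin \o hw).
Proof. by move=> mA; apply: integrableS ihw. Qed.

Let chw : continuous hw.
Proof.
move=> x; apply: cvgM; last exact: continuous_gdens.
by apply: cvgB; [exact: cf|exact: cvg_cst].
Qed.

Let dG (x : R) : is_derive x (1 : R) G (hw x).
Proof.
have := @continuous_FTC1 R hw -oo%O x (x + 1) _ _ _ (chw (x := x)).
rewrite ltrDl ltr01 => /(_ isT); rewrite ltNyr => /(_ _ isT) [].
  exact: ihwS.
by move=> d1 d2; apply: (DeriveDef d1); rewrite -derive1E; exact: d2.
Qed.

Let integral_Rint (A : set R) : measurable A ->
  (\int[leb]_(t in A) (w t)%:E = (\int[leb]_(t in A) w t)%:E)%E.
Proof.
move=> mA; rewrite /Rintegral fineK//; apply: integrable_fin_num => //.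
exact: integrableS integrable_gdens.
Qed.

Let int_abs (A : set R) : measurable A -> `|\int[leb]_(t in A) hw t| <= \int[leb]_(t in A) w t.
Proof.
move=> mA; apply: (@le_trans _ _ (\int[leb]_(t in A) `|hw t|)).
  by apply: le_normr_Rintegral => //; exact: ihwS.
apply: le_Rintegral => //.
- exact/integrable_norm/ihwS.
- exact: integrableS integrable_gdens.
- by move=> x _; rewrite normrM [X in _ * X]ger0_norm// ler_piMl.
Qed.

Let G_right x : 1 <= x -> `|G x| <= 2 * w x.
Proof.
move=> x1.
have E : - G x = \int[leb]_(t in `]x, +oo[) hw t.
  have := @Rintegral_itvB R hw -oo%O +oo%O x; rewrite set_itvNyy int_hw sub0r.
  by move=> <- //; rewrite ?bnd_simp.
rewrite -normrN E; apply: (le_trans (int_abs _)) => //.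
rewrite -lee_fin -integral_Rint//.
apply: le_trans (gdens_tail x1); apply: ge0_subset_integral => //.
- by apply/measurable_EFinP/measurable_funTS.
- by move=> t _; rewrite lee_fin.
- by apply: subset_itvr; rewrite bnd_simp.
Qed.

Let G_left x : x <= -1 -> `|G x| <= 2 * w x.
Proof.
move=> x1; apply: (le_trans (int_abs _)) => //.
rewrite -lee_fin -integral_Rint//.
have := @ge0_integration_by_substitutionNy R w (- x); rewrite opprK => ->.
- rewrite -[w x]gdensN; apply: le_trans (gdens_tail _); last by rewrite lerNr.
  by under eq_integral do rewrite /= gdensN.
- by apply: continuous_subspaceT; exact: continuous_gdens.
- by move=> t _.
Qed.

Let winv x : R := (normal_peak (Num.sqrt 2))^-1 * expR (4^-1 * x ^+ 2).
Let winvE x : w x * winv x = 1.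
Proof.
rewrite gdensE /winv mulrACA divff ?mul1r; last first.
  by rewrite gt_eqF// normal_peak_gt0// gt_eqF// sqrtr_gt0.
by rewrite mulrC (mulrC (x ^+ 2)) expRxMexpNx_1.
Qed.

Let winv0 x : 0 < winv x.
Proof.
by rewrite -(pmulr_rgt0 _ (gdens_gt0 x)) winvE.
Qed.

Let dwinv (x : R) : is_derive x (1 : R) winv (x / 2 * winv x).
Proof.
rewrite /winv (_ : x / 2 * _ = (normal_peak (Num.sqrt 2))^-1 *
  (expR (4^-1 * x ^+ 2) * (4^-1 * (2 * x)))); last by field;
  rewrite gt_eqF// normal_peak_gt0// gt_eqF// sqrtr_gt0.
apply: is_deriveZ_fun; apply: is_derive_comp_fun.
by apply: is_deriveZ_fun; exact: is_derive_sqr.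
Qed.

(** 2 covers the tails beyond distance 1; on the middle interval [|G| <= 1] and
    [1 / w <= winv 1]. *)
Let B0 : R := 2 + winv 1.

Let G_bound x : `|G x| <= B0 * w x.
Proof.
have [x1|x1] := leP 1 x.
  apply: (le_trans (G_right x1)); rewrite ler_wpM2r// /B0 lerDl; exact: ltW.
have [x2|x2] := leP x (-1).
  apply: (le_trans (G_left x2)); rewrite ler_wpM2r// /B0 lerDl; exact: ltW.
apply: (@le_trans _ _ 1).
  apply: (le_trans (int_abs _)) => //; rewrite -lee_fin -integral_Rint//.
  have -> : 1%:E = (\int[leb]_t (w t)%:E)%E by rewrite integral_normal_pdf.
  apply: ge0_subset_integral => //; first exact/measurable_EFinP.
  by move=> t _; rewrite lee_fin.
have wi : winv x <= winv 1.
  rewrite /winv ler_wpM2l ?invr_ge0 ?normal_peak_ge0// ler_expR ler_wpM2l//.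
  rewrite expr1n -real_normK ?num_real// expr_le1// ler_norml.
  by apply/andP; split; exact: ltW.
rewrite -(winvE x) mulrC ler_wpM2r// /B0; apply: (le_trans wi).
by rewrite lerDr.
Qed.

Let g x : R := 1 / 2 * (G x * winv x).
Let dg x : R := 1 / 2 * (h x + x * g x).

Let dgP (x : R) : is_derive x (1 : R) g (dg x).
Proof.
have -> : dg x = 1 / 2 * (hw x * winv x + G x * (x / 2 * winv x)).
  rewrite /dg /g /hw -(mulrA (h x)) winvE mulr1; congr (_ * (_ + _)).
  by field.
by apply: is_deriveZ_fun; exact: is_deriveM_fun.
Qed.

Let gB x : `|g x| <= 1 / 2 * B0.
Proof.
rewrite /g normrM (ger0_norm (_ : 0 <= 1 / 2)) ?divr_ge0// ler_wpM2l ?divr_ge0//.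
rewrite normrM (gtr0_norm (winv0 x)).
apply: (le_trans (ler_wpM2r (ltW (winv0 x)) (G_bound x))).
by rewrite -mulrA winvE mulr1.
Qed.

Let xg x : `|x * g x| <= 1.
Proof.
have := @stein_growth_norm R g (fun x => 1 / 2 * h x) (1 / 2) (1 / 2 * B0).
move=> H; apply: (le_trans (H _ _ gB x)); last by rewrite mulrA mulr1 divff.
  move=> z; rewrite (_ : _ + _ = dg z); last by rewrite /dg; ring.
  exact: dgP.
move=> z; rewrite normrM ger0_norm ?divr_ge0//.
by rewrite ler_piMr ?divr_ge0.
Qed.

Let dg1 x : `|dg x| <= 1.
Proof.
rewrite /dg normrM ger0_norm ?divr_ge0//.
have := ler_normD (h x) (x * g x); have := h1 x; have := xg x.
by move: `|h x + _| `|h x| `|x * g x| => a b c; lra.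
Qed.

Let L0 : 0 <= L. Proof. by apply: le_trans (dfL 0). Qed.

(** Differentiating the equation shows that [dg] solves one of the same type, so the growth bound
    applies again and controls the second derivative. *)
Let ddg (x : R) : is_derive x (1 : R) dg (1 / 2 * x * dg x + 1 / 2 * (df x + g x)).
Proof.
rewrite (_ : _ + _ = 1 / 2 * ((df x - 0) + (1 * g x + x * dg x))); last by ring.
have dh : is_derive x (1 : R) h (df x - 0).
  exact: (is_deriveB_fun (fd x) (is_derive_cst gmean x (1 : R))).
apply: is_deriveZ_fun; apply: (is_deriveD_fun dh).
exact: (is_deriveM_fun (is_derive_id x (1 : R)) (dgP x)).
Qed.

Let Kg := 1 / 2 * (L + 1 / 2 * B0).
Let kB x : `|1 / 2 * (df x + g x)| <= Kg.
Proof.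
rewrite normrM ger0_norm ?divr_ge0// ler_wpM2l ?divr_ge0//.
by apply: (le_trans (ler_normD _ _)); rewrite lerD.
Qed.

Let xdg x : `|x * dg x| <= 2 * Kg.
Proof. exact: stein_growth_norm ddg kB dg1 x. Qed.

Let dg_lip x y : `|dg x - dg y| <= 2 * Kg * `|x - y|.
Proof.
apply: (derive_bounded_lipschitz ddg) => z; apply: (le_trans (ler_normD _ _)).
rewrite -mulrA normrM (ger0_norm (_ : 0 <= 1 / 2)) ?divr_ge0//.
have := xdg z; have := kB z; move: `|1 / 2 * (_ + _)| `|z * _| => p q; lra.
Qed.

Lemma stein_equation_solvable : exists g dg : R -> R, exists2 C : R, 0 <= C &
  [/\ (forall x : R, is_derive x (1 : R) g (dg x)),
      (forall x, 2 * dg x - x * g x = f x - gmean),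
      (forall x, `|g x| <= C), (forall x, `|dg x| <= C) &
      (forall x y, `|dg x - dg y| <= C * `|x - y|)].
Proof.
have B00 : 0 <= B0 by rewrite /B0 addr_ge0// ltW.
have Kg0 : 0 <= Kg by rewrite mulr_ge0 ?divr_ge0// addr_ge0// mulr_ge0 ?divr_ge0.
have [b b0 gb] : exists2 b, 0 <= b & forall x, `|g x| <= b.
  exists (1 / 2 * B0); last exact: gB.
  by apply: mulr_ge0 => //; exact: divr_ge0.
have [k k0 dgk] : exists2 k, 0 <= k & forall x y, `|dg x - dg y| <= k * `|x - y|.
  by exists (2 * Kg); [exact: mulr_ge0|exact: dg_lip].
exists g, dg, (b + 1 + k); first by rewrite !addr_ge0.
split => [||x|x|x y].
- exact: dgP.
- by move=> x; rewrite /dg /h; field.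
- by apply: (le_trans (gb x)); rewrite -addrA lerDl addr_ge0.
- by apply: (le_trans (dg1 x)); rewrite addrAC lerDr addr_ge0.
- by apply: (le_trans (dgk x y)); rewrite ler_wpM2r// lerDr addr_ge0.
Qed.

End stein_solution.

(** * Stein's method for sums of independent variables *)

Lemma measurable_fsum d (T : measurableType d) (R : realType) (J : Type)
    (s : seq J) (Q : pred J) (X : J -> T -> R) :
  (forall i, Q i -> measurable_fun setT (X i)) ->
  measurable_fun setT (fun w => \sum_(i <- s | Q i) X i w).
Proof.
move=> mX; elim: s => [|j s IH]; first by under eq_fun do rewrite big_nil; exact: measurable_cst.
have [Qj|/negPf Qj] := boolP (Q j); under eq_fun do rewrite big_cons Qj //.
  by apply: measurable_funD => //; exact: mX.
exact: IH.
Qed.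

Lemma lipschitz_derive_expansion (R : realType) (g dg : R -> R) (C : R) :
    (forall x : R, is_derive x (1 : R) g (dg x)) ->
    (forall x y, `|dg x - dg y| <= C * `|x - y|) ->
  forall x y, `|g y - g x - dg x * (y - x)| <= C * (y - x) ^+ 2.
Proof.
move=> dgP lip x y.
have C0 : 0 <= C.
  by have := le_trans (normr_ge0 _) (lip 1 0); rewrite subr0 normr1 mulr1.
have cont a b : {within `[a, b], continuous g}.
  by apply: derivable_within_continuous => z _; apply: ex_derive; exact: dgP.
suff [z zx ->] : exists2 z : R, `|z - x| <= `|y - x| & g y - g x = dg z * (y - x).
  rewrite -mulrBl normrM -(real_normK (num_real (y - x))) expr2 mulrA ler_wpM2r//.
  by apply: (le_trans (lip _ _)); rewrite ler_wpM2l.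
have [xy|yx|<-] := ltgtP x y; last by exists x => //; rewrite !subrr mulr0.
- have [z] := MVT xy (fun z _ => dgP z) (cont _ _).
  rewrite in_itv/= => /andP[z1 z2] E; exists z => //.
  by rewrite !gtr0_norm ?subr_gt0// lerD2r ltW.
- have [z] := MVT yx (fun z _ => dgP z) (cont _ _).
  rewrite in_itv/= => /andP[z1 z2] E; exists z.
    by rewrite !ltr0_norm ?subr_lt0// lerN2 lerD2r ltW.
  by rewrite -[LHS]opprB E -mulrN opprB.
Qed.

Section stein_method.
Context d (T : measurableType d) (R : realType) (P : probability T R).
Context (I : finType) (D : {set I}) (X : I -> T -> R).
Variables (mu s M3 : R).
Hypothesis mX : forall i, measurable_fun setT (X i).
Hypothesis X_indep : mutually_independent P D X.

Local Notation L1 X := (P.-integrable setT (EFin \o X)).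
Let xi e w := X e w - mu.

Hypothesis s0 : 0 < s.
Hypothesis xi4 : forall e, e \in D -> L1 (fun w => xi e w ^+ 4).
Hypothesis xi_mean : forall e, e \in D -> \int[P]_w xi e w = 0.
Hypothesis xi_var : forall e, e \in D -> \int[P]_w (xi e w ^+ 2) = s ^+ 2.
Hypothesis xi_m3 : forall e, e \in D -> \int[P]_w (`|xi e w| ^+ 3) <= M3 * s ^+ 2.

Variables (g dg : R -> R) (C : R).
Hypothesis C0 : 0 <= C.
Hypothesis dgP : forall x : R, is_derive x (1 : R) g (dg x).
Hypothesis gC : forall x, `|g x| <= C.
Hypothesis dgC : forall x, `|dg x| <= C.
Hypothesis lip : forall x y, `|dg x - dg y| <= C * `|x - y|.
Variable c : R.
Hypothesis c0 : 0 <= c.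

Let zeta w := \sum_(e in D) c * xi e w.
Let zeta' e w := \sum_(f in D :\ e) c * xi f w.

Let mxi e : measurable_fun setT (xi e). Proof. exact: measurable_funB. Qed.

Let zetaE e w : e \in D -> zeta w = zeta' e w + c * xi e w.
Proof.
move=> eD; rewrite /zeta (bigD1 e)//= addrC; congr (_ + _).
by apply: eq_bigl => f; rewrite !inE andbC.
Qed.

Let cdg : continuous dg.
Proof.
move=> x; apply/cvgrPdist_le => /= e e0; near=> y.
apply: (le_trans (lip _ _)).
apply: (@le_trans _ _ ((C + 1) * `|x - y|)).
  by rewrite ler_wpM2r// lerDl.
rewrite mulrC -ler_pdivlMr; last by rewrite ltr_wpDl.
near: y; apply: cvgr_dist_le; first exact: cvg_id.
by rewrite divr_gt0// ltr_wpDl.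
Unshelve. all: by end_near. Qed.

Let mg : measurable_fun setT g.
Proof.
apply: continuous_measurable_fun => x.
apply: differentiable_continuous; apply/derivable1_diffP.
by apply: ex_derive; exact: dgP.
Qed.

Let mdg : measurable_fun setT dg. Proof. exact: continuous_measurable_fun. Qed.

Let mzeta : measurable_fun setT zeta.
Proof. by apply: measurable_fsum => e _; exact: measurable_funM. Qed.

Let mzeta' e : measurable_fun setT (zeta' e).
Proof. by apply: measurable_fsum => f _; exact: measurable_funM. Qed.

Let mzeta'_without e : e \in D ->
  measurable_fun (setT : set (g_sigma_algebraType (events_without D X e))) (zeta' e).
Proof.
move=> eD; apply: (@measurable_fsum _
  (g_sigma_algebraType (events_without D X e))) => f; rewrite !inE => /andP[fe fD].
apply: measurable_funM => //; apply: measurable_funB => //.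
exact: measurable_events_without.
Qed.

Let L1_bounded (phi : R -> R) (Y : T -> R) : measurable_fun setT phi ->
  (forall x, `|phi x| <= C) -> measurable_fun setT Y -> L1 (fun w => phi (Y w)).
Proof.
move=> mphi phiC mY; apply: (@integrable_dominated _ _ _ _ _ (fun=> C)) => //.
  exact: measurableT_comp.
exact: integrable_const.
Qed.

Let L1B (Y Z : T -> R) : L1 Y -> L1 Z -> L1 (fun w => Y w - Z w).
Proof. by move=> iY iZ; exact: (integrableB measurableT iY iZ). Qed.

Let L1_norm_xi e : e \in D -> L1 (fun w => `|xi e w|).
Proof. by move=> eD; exact: integrable_norm (L1_xi mX xi4 eD). Qed.

Let Ex_norm_xi e : e \in D -> \int[P]_w `|xi e w| <= s.
Proof.
move=> eD; rewrite -(ler_pM2l s0).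
have le w : 2 * s * `|xi e w| <= xi e w ^+ 2 + s ^+ 2.
  rewrite -(real_normK (num_real (xi e w))).
  by have := sqr_ge0 (`|xi e w| - s); nra.
have i1 : L1 (fun w => xi e w ^+ 2 + s ^+ 2).
  by apply: integrable_add; [exact: (L1_xi2 mX xi4 eD)|exact: integrable_const].
have := Rintegral_le (integrable_scale (2 * s) (L1_norm_xi eD)) i1 le.
rewrite RintegralZl//; last exact: L1_norm_xi.
rewrite RintegralD//; last 2 first.
- exact: (L1_xi2 mX xi4 eD).
- exact: integrable_const.
by rewrite Rintegral_const xi_var//; set E := \int[P]_w _; nra.
Qed.

Let L1_xi_g e : e \in D -> L1 (fun w => c * xi e w * g (zeta w)).
Proof.
move=> eD; apply: (@integrable_dominated _ _ _ _ _ (fun w => c * C * `|xi e w|)).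
- apply: measurable_funM; first exact: measurable_funM.
  exact: measurableT_comp.
- move=> w; rewrite !normrM (ger0_norm c0) [leRHS]mulrAC ler_wpM2l ?mulr_ge0//.
- by apply: integrable_scale; exact: L1_norm_xi.
Qed.

(** Expand [g] at the sum [zeta'] without [e]: independence kills the constant term and turns the
    linear one into [c ^ 2 * s ^ 2 * E dg (zeta')]. The third moment bounds the remainder, and
    [E |xi e| <= s] the return from [zeta'] to [zeta]. *)
Lemma stein_summand e : e \in D ->
  `|\int[P]_w (c * xi e w * g (zeta w)) - c ^+ 2 * s ^+ 2 * \int[P]_w dg (zeta w)|
    <= c ^+ 2 * s ^+ 2 * (C * c * (M3 + s)).
Proof.
move=> eD.
have [i1 E1] := Ex_xi_mul mX X_indep xi4 xi_mean eD
  (measurableT_comp mg (mzeta'_without eD)) (L1_bounded mg gC (mzeta' e)).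
have [i2 E2] := Ex_xi2_mul mX X_indep xi4 xi_var eD
  (measurableT_comp mdg (mzeta'_without eD)) (L1_bounded mdg dgC (mzeta' e)).
have idg := L1_bounded mdg dgC mzeta.
have idg' := L1_bounded mdg dgC (mzeta' e).
pose r1 w := c * xi e w * g (zeta w) -
  (c * (xi e w * g (zeta' e w)) + c ^+ 2 * (xi e w ^+ 2 * dg (zeta' e w))).
have i12 := integrable_add (integrable_scale c i1) (integrable_scale (c ^+ 2) i2).
have ir1 : L1 r1.
  have := integrable_add (L1_xi_g eD) (integrable_scale (-1) i12).
  by under eq_fun do rewrite mulN1r.
have r1E : \int[P]_w (c * xi e w * g (zeta w)) = \int[P]_w r1 w +
    c ^+ 2 * (s ^+ 2 * \int[P]_w dg (zeta' e w)).
  rewrite RintegralB//; last exact: L1_xi_g.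
  rewrite RintegralD//; [|exact: (integrable_scale c i1)|exact: (integrable_scale (c ^+ 2) i2)].
  by rewrite !RintegralZl// E1 E2 mulr0 add0r subrK.
have r1le : `|\int[P]_w r1 w| <= C * c ^+ 3 * (M3 * s ^+ 2).
  apply: (@le_trans _ _ (\int[P]_w `|r1 w|)); first exact: le_normr_Rintegral.
  apply: (@le_trans _ _ (\int[P]_w (C * c ^+ 3 * `|xi e w| ^+ 3))).
    apply: Rintegral_le; first exact: integrable_norm.
      by apply: integrable_scale; exact: (L1_xi3 mX xi4 eD).
    move=> w; rewrite /r1.
    have := lipschitz_derive_expansion dgP lip (zeta' e w) (zeta w).
    have -> : zeta w - zeta' e w = c * xi e w.
      by rewrite (zetaE w eD) addrAC subrr add0r.
    move=> h.
    rewrite (_ : _ - _ = c * xi e w * (g (zeta w) - g (zeta' e w) -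
      dg (zeta' e w) * (c * xi e w))); last by ring.
    rewrite normrM normrM (ger0_norm c0).
    apply: (le_trans (ler_wpM2l _ h)); first by rewrite mulr_ge0.
    rewrite -(real_normK (num_real (c * _))) normrM (ger0_norm c0).
    by rewrite le_eqVlt; apply/orP; left; apply/eqP; ring.
  rewrite RintegralZl//; last exact: (L1_xi3 mX xi4 eD).
  by rewrite ler_wpM2l ?xi_m3// mulr_ge0// exprn_ge0.
have r2le : `|\int[P]_w dg (zeta' e w) - \int[P]_w dg (zeta w)| <= C * c * s.
  rewrite -RintegralB//.
  apply: (@le_trans _ _ (\int[P]_w `|dg (zeta' e w) - dg (zeta w)|)).
    by apply: le_normr_Rintegral => //; exact: L1B.
  apply: (@le_trans _ _ (\int[P]_w (C * c * `|xi e w|))).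
    apply: Rintegral_le.
    - by apply: integrable_norm => //; exact: L1B.
    - by apply: integrable_scale; exact: L1_norm_xi.
    - move=> w; apply: (le_trans (lip _ _)).
      by rewrite (zetaE w eD) opprD addrA subrr add0r normrN normrM (ger0_norm c0) mulrA.
  by rewrite RintegralZl ?L1_norm_xi// ler_wpM2l ?Ex_norm_xi// mulr_ge0.
rewrite r1E.
set x := \int[P]_w r1 w in r1le *; set y := \int[P]_w dg (zeta' e w) in r2le *.
set z := \int[P]_w dg (zeta w) in r2le *.
rewrite (_ : _ - _ = x + c ^+ 2 * s ^+ 2 * (y - z)); last by ring.
apply: (le_trans (ler_normD _ _)).
have q0 : 0 <= c ^+ 2 * s ^+ 2 by rewrite mulr_ge0 ?sqr_ge0.
rewrite normrM (ger0_norm q0).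
have -> : c ^+ 2 * s ^+ 2 * (C * c * (M3 + s)) =
  C * c ^+ 3 * (M3 * s ^+ 2) + c ^+ 2 * s ^+ 2 * (C * c * s) by ring.
by apply: lerD => //; rewrite ler_wpM2l.
Qed.

(** The first error measures how far the variance of [zeta], which is [#|D| * c ^ 2 * s ^ 2], is
    from 2. *)
Lemma stein_bound (f : R -> R) (m : R) : (forall x, 2 * dg x - x * g x = f x - m) ->
  L1 (fun w => f (zeta w)) ->
  `|\int[P]_w f (zeta w) - m| <= `|2 - #|D|%:R * (c ^+ 2 * s ^+ 2)| * C +
    #|D|%:R * (c ^+ 2 * s ^+ 2) * (C * c * (M3 + s)).
Proof.
move=> eqf L1f.
have idg := L1_bounded mdg dgC mzeta.
have izg : L1 (fun w => \sum_(e in D) c * xi e w * g (zeta w)).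
  by apply: integrable_fsum => e; exact: L1_xi_g.
have E : \int[P]_w f (zeta w) - m =
    2 * \int[P]_w dg (zeta w) - \sum_(e in D) \int[P]_w (c * xi e w * g (zeta w)).
  have -> : \int[P]_w f (zeta w) - m = \int[P]_w (f (zeta w) - m).
    by rewrite RintegralB ?Rintegral_const//; exact: integrable_const.
  have -> : \int[P]_w (f (zeta w) - m) = \int[P]_w (2 * dg (zeta w) -
      \sum_(e in D) c * xi e w * g (zeta w)).
    by apply: eq_Rintegral => w _; rewrite -eqf -mulr_suml.
  rewrite RintegralB//; last exact: (integrable_scale 2 idg).
  rewrite RintegralZl// Rintegral_fsum//; exact: L1_xi_g.
rewrite E; set y := \int[P]_w _; set q := c ^+ 2 * s ^+ 2.
have -> : 2 * y - \sum_(e in D) \int[P]_w (c * xi e w * g (zeta w)) =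
    (2 - #|D|%:R * q) * y -
    \sum_(e in D) (\int[P]_w (c * xi e w * g (zeta w)) - q * y).
  rewrite big_split/= sumrN sumr_const -(mulr_natl (q * y)); ring.
apply: (le_trans (ler_normB _ _)); apply: lerD.
  rewrite normrM ler_wpM2l// /y; apply: (@le_trans _ _ (\int[P]_w `|dg (zeta w)|)).
    exact: le_normr_Rintegral.
  rewrite -[leRHS](Rintegral_const P); apply: Rintegral_le => //.
  - exact: integrable_norm.
  - exact: integrable_const.
apply: (le_trans (ler_norm_sum _ _ _)).
have -> : #|D|%:R * q * (C * c * (M3 + s)) = \sum_(e in D) q * (C * c * (M3 + s)).
  by rewrite sumr_const -[RHS]mulr_natl -[LHS]mulrA.
by apply: ler_sum => e eD; exact: stein_summand.
Qed.

End stein_method.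

(** * Weak convergence from smooth test functions *)

Section weighted_sandwich.
Context d (T : measurableType d) (R : realType) (m : {measure set T -> \bar R}).
Variables (u phi : T -> R) (E : set T) (eta : R).
Hypothesis mE : measurable E.
Hypothesis u0 : forall x, 0 <= u x.
Hypothesis iu : m.-integrable setT (EFin \o u).
Hypothesis iphi : m.-integrable setT (EFin \o (fun x => phi x * u x)).
Hypothesis u1 : \int[m]_x u x = 1.
Hypothesis eta0 : 0 <= eta.
Hypothesis phi01 : forall x, 0 <= phi x <= 1.

Let iuE : m.-integrable setT (EFin \o (u \_ E)).
Proof. by rewrite -restrict_EFin; apply/integrable_restrict => //; rewrite setTI; exact: integrableS iu. Qed.

Let ieta : m.-integrable setT (EFin \o (fun x => eta * u x)).
Proof. exact: (integrableZl measurableT eta iu). Qed.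

(** The weight lets the same pair of bounds serve Lebesgue measure with [gdens] and [P n] with
    weight 1. *)
Lemma weighted_lower : (forall x, E x -> 1 - eta <= phi x) ->
  \int[m]_(x in E) u x - eta <= \int[m]_x (phi x * u x).
Proof.
move=> phiE; rewrite Rintegral_mkcond -[X in _ - X]mulr1 -u1 -RintegralZl// -RintegralB//.
apply: le_Rintegral => //; first exact: (integrableB measurableT iuE ieta).
move=> x _; rewrite patchE; case: ifPn => [/set_mem/phiE h|_].
  by rewrite -[X in X - _]mul1r -mulrBl ler_wpM2r.
have /andP[h _] := phi01 x.
by rewrite sub0r (@le_trans _ _ 0)// ?oppr_le0 mulr_ge0.
Qed.

Lemma weighted_upper : (forall x, ~ E x -> phi x <= eta) ->
  \int[m]_x (phi x * u x) <= \int[m]_(x in E) u x + eta.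
Proof.
move=> phiE; rewrite [X in _ <= X + _]Rintegral_mkcond -[X in _ + X]mulr1 -u1 -RintegralZl// -RintegralD//.
apply: le_Rintegral => //; first exact: (integrableD measurableT iuE ieta).
move=> x _; rewrite patchE; case: ifPn => [_|/negP h].
  have /andP[_ h] := phi01 x.
  by rewrite (@le_trans _ _ (u x))// ?ler_piMl// lerDl mulr_ge0.
rewrite add0r ler_wpM2r//; apply: phiE => Ex; apply: h; exact: mem_set.
Qed.

End weighted_sandwich.

(** A logistic function of slope [k = 1 / (del * eta)]. It is explicit and smooth, reaching 0 and 1
    only up to [eta]: at distance [del] the exponential is at most [expR (- 1 / eta) <= eta]. *)
Lemma smooth_step (R : realType) (s del eta : R) : 0 < del -> 0 < eta ->
  exists f df : R -> R, exists L : R,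
    [/\ (forall x, 0 <= f x <= 1), (forall x : R, is_derive x (1 : R) f (df x)),
        (forall x, `|df x| <= L), (forall x, x <= s - del -> 1 - eta <= f x) &
        (forall x, s + del <= x -> f x <= eta)].
Proof.
move=> del0 eta0; pose k := (del * eta)^-1.
have k0 : 0 < k by rewrite invr_gt0 mulr_gt0.
have kE : expR (- (k * del)) <= eta.
  rewrite expRN -[leRHS]invrK lef_pV2 ?posrE ?expR_gt0 ?invr_gt0//.
  apply: le_trans (expR_ge1Dx _); rewrite (_ : k * del = eta^-1) ?lerDr//.
  by rewrite /k; field; rewrite !gt_eqF.
pose e x := expR (k * (x - s)).
have e0 x : 0 < e x by exact: expR_gt0.
have e1 x : 0 < 1 + e x by rewrite addr_gt0.
have de (x : R) : is_derive x (1 : R) e (e x * (k * (1 - 0))).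
  have dB := is_deriveB_fun (is_derive_id x (1 : R)) (is_derive_cst s x (1 : R)).
  exact: (is_derive_comp_fun (is_derive_expR _) (is_deriveZ_fun k dB)).
have de1 (x : R) : is_derive x (1 : R) (fun x => 1 + e x) (0 + e x * (k * (1 - 0))).
  exact: (is_deriveD_fun (is_derive_cst (1 : R) x (1 : R)) (de x)).
pose f x := (1 + e x)^-1; exists f, (fun x => - (1 + e x) ^- 2 *: (0 + e x * (k * (1 - 0)))), k.
split => [x|x|x|x xs|x xs].
- by rewrite /f invr_ge0 (ltW (e1 x))/= invf_le1// lerDl ltW.
- have n0 : 1 + e x != 0 by rewrite gt_eqF.
  have dv : derivable (fun x => 1 + e x) x 1 by exact: (@ex_derive _ _ _ _ _ _ _ (de1 x)).
  apply: DeriveDef; first exact: derivableV.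
  rewrite deriveV//.
  by rewrite (@derive_val _ _ _ _ _ _ _ (de1 x)).
- rewrite add0r subr0 mulr1 scalerAl /= normrM normrM (gtr0_norm k0) normrN.
  rewrite ler_piMl ?(ltW k0)// (gtr0_norm (e0 x)) gtr0_norm ?invr_gt0 ?exprn_gt0//.
  rewrite mulrC ler_pdivrMr ?exprn_gt0// mul1r expr2.
  by have := e0 x; nra.
- apply: (@le_trans _ _ (1 - e x)); last first.
    rewrite /f -[leRHS]mul1r ler_pdivlMr//; have := e0 x; nra.
  rewrite lerD2l lerN2; apply: le_trans kE; rewrite ler_expR -mulrN ler_pM2l//.
  by rewrite lerBlDr addrC.
- rewrite /f; apply: le_trans kE; rewrite expRN lef_pV2 ?posrE ?expR_gt0//.
  apply: (@le_trans _ _ (e x)); last by rewrite lerDr.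
  by rewrite ler_expR ler_pM2l// lerBrDl.
Qed.

Section convergence_to_normal.
Context {R : realType} (d : nat -> measure_display).
Context (T : forall n, measurableType (d n)) (P : forall n, probability (T n) R).
Variables (zeta Y : forall n, T n -> R).
Arguments zeta : clear implicits.
Arguments Y : clear implicits.
Hypothesis mzeta : forall n, measurable_fun setT (zeta n).
Hypothesis mY : forall n, measurable_fun setT (Y n).
Local Notation leb := (@lebesgue_measure R).

Let N (t : R) := \int[leb]_(x in `]-oo, t]) gdens x.

Hypothesis zeta_cvg : forall (f df : R -> R) (L : R),
  (forall x, 0 <= f x <= 1) -> (forall x : R, is_derive x (1 : R) f (df x)) ->
  (forall x, `|df x| <= L) ->
  \int[P n]_w f (zeta n w) @[n --> \oo] --> gmean f.
Hypothesis close : forall del : R, 0 < del ->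
  fine (P n [set w | del < `|Y n w - zeta n w|]) @[n --> \oo] --> (0 : R).

Let mle (X : forall n, T n -> R) (mX : forall n, measurable_fun setT (X n)) n b :
  measurable [set w | X n w <= b].
Proof.
rewrite (_ : [set w | _] = setT `&` X n @^-1` `]-oo, b]); first exact: mX.
by rewrite setTI; apply/seteqP; split => w /=; rewrite in_itv.
Qed.

Let mfar n del : measurable [set w | del < `|Y n w - zeta n w|].
Proof.
rewrite (_ : [set w | _] =
    setT `&` (fun w => `|Y n w - zeta n w|) @^-1` `]del, +oo[).
  by apply: (measurableT_comp (@normr_measurable R setT)) => //; exact: measurable_funB.
by rewrite setTI; apply/seteqP; split => w /=; rewrite in_itv/= andbT.
Qed.

Let pr_le n (A B C : set (T n)) : measurable A -> measurable B -> measurable C ->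
  A `<=` B `|` C -> fine (P n A) <= fine (P n B) + fine (P n C).
Proof.
move=> mA mB mC ABC; rewrite -fineD ?fin_num_measure//.
rewrite fine_le ?fin_num_measure//; last first.
  apply: (@le_trans _ _ (P n (B `|` C))); last exact: measureU2.
  by apply: le_measure => //; rewrite inE//; exact: measurableU.
by rewrite fin_numD !fin_num_measure.
Qed.

Let fint (f df : R -> R) : (forall x, 0 <= f x <= 1) ->
    (forall x : R, is_derive x (1 : R) f (df x)) ->
  forall n, (P n).-integrable setT (EFin \o (fun w => f (zeta n w) * 1)).
Proof.
move=> f01 fd n.
have mf : measurable_fun setT f.
  apply: continuous_measurable_fun => x.
  apply: differentiable_continuous; apply/derivable1_diffP.
  by apply: ex_derive; exact: fd.
apply: (@integrable_dominated _ _ _ _ _ (fun=> 1)).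
- by apply: measurable_funM => //; exact: measurableT_comp.
- by move=> w; have /andP[h1 h2] := f01 (zeta n w); rewrite mulr1 ger0_norm.
- exact: integrable_const.
Qed.

Let prE n (A : set (T n)) : measurable A -> \int[P n]_(w in A) 1 = fine (P n A).
Proof. by move=> mA; rewrite Rintegral_cst// mul1r. Qed.

Let upper (t e : R) : 0 < e -> {for t, continuous N} ->
  \forall n \near \oo, fine (P n [set w | Y n w <= t]) <= N t + e.
Proof.
(* Five errors are added: continuity of [N], the step against the Gaussian, convergence of its mean,
   the step against [zeta], and [Y] against [zeta]. *)
move=> e0 Nt; pose eta := e / 5.
have eta0 : 0 < eta by rewrite divr_gt0.
have /cvgrPdist_le/(_ _ eta0)/nbhs_ballP[del /= del0 H] := Nt.
(* One [h] moves from [Y] to [zeta] and two more span the transition of the step, so [N] is compared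
   at [t + 3 * h], inside the ball of radius [del]. *)
pose h := del / 4; have h0 : 0 < h by rewrite divr_gt0.
have N1 : N (t + 3 * h) <= N t + eta.
  have hb : ball t del (t + 3 * h).
    rewrite /ball/= opprD addrA subrr sub0r normrN gtr0_norm ?mulr_gt0//.
    by rewrite /h; lra.
  by have := H _ hb; rewrite /= ler_norml => /andP[+ _]; lra.
have [f [df [L [f01 fd dfL fl fr]]]] := smooth_step (t + 2 * h) h0 eta0.
have ifg := integrable_f_gdens (fun x => (andP (f01 x)).1)
  (fun x => (andP (f01 x)).2) fd.
have gm : gmean f <= N (t + 3 * h) + eta.
  apply: weighted_upper => //.
  - by move=> x; exact/ltW/gdens_gt0.
  - exact: integrable_gdens.
  - by rewrite /Rintegral integral_normal_pdf.
  - exact: ltW.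
  - move=> x /=; rewrite in_itv/= => /negP; rewrite -ltNge => xt.
    by apply: fr; lra.
have /cvgrPdist_le/(_ _ eta0) zc := zeta_cvg f01 fd dfL.
have /cvgrPdist_le/(_ _ eta0) cl := close h0.
near=> n.
have zn : `|gmean f - \int[P n]_w f (zeta n w)| <= eta by near: n.
have cn : `|0 - fine (P n [set w | h < `|Y n w - zeta n w|])| <= eta by near: n.
have low : fine (P n [set w | zeta n w <= t + h]) - eta <= \int[P n]_w f (zeta n w).
  rewrite -prE; last exact: mle.
  have -> : \int[P n]_w f (zeta n w) = \int[P n]_w (f (zeta n w) * 1).
    by apply: eq_Rintegral => w _; rewrite mulr1.
  apply: weighted_lower => //.
  - exact: mle.
  - exact: integrable_const.
  - exact: fint f01 fd n.
  - exact: Rintegral_const.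
  - exact: ltW.
  - by move=> w /= zw; apply: fl; lra.
have inc : fine (P n [set w | Y n w <= t]) <=
    fine (P n [set w | zeta n w <= t + h]) +
    fine (P n [set w | h < `|Y n w - zeta n w|]).
  apply: pr_le; [exact: mle|exact: mle|exact: mfar|].
  move=> w /= Yt; have [yz|yz] := ltP h `|Y n w - zeta n w|; first by right.
  by left; move: yz; rewrite ler_norml => /andP[yz _]; lra.
move: zn cn; rewrite sub0r normrN !ler_norml => /andP[z1 z2] /andP[c1 c2].
move: inc low gm N1 z1 c2.
set a := fine _; set b := fine _; set c := fine _; set E := \int[P n]_w _.
by rewrite /eta; lra.
Unshelve. all: by end_near. Qed.

Let lower (t e : R) : 0 < e -> {for t, continuous N} ->
  \forall n \near \oo, N t - e <= fine (P n [set w | Y n w <= t]).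
Proof.
move=> e0 Nt; pose eta := e / 5.
have eta0 : 0 < eta by rewrite divr_gt0.
have /cvgrPdist_le/(_ _ eta0)/nbhs_ballP[del /= del0 H] := Nt.
pose h := del / 4; have h0 : 0 < h by rewrite divr_gt0.
have N1 : N t - eta <= N (t - 3 * h).
  have hb : ball t del (t - 3 * h).
    rewrite /ball/= opprB addrCA subrr addr0 gtr0_norm ?mulr_gt0//.
    by rewrite /h; lra.
  by have := H _ hb; rewrite /= ler_norml => /andP[_]; lra.
have [f [df [L [f01 fd dfL fl fr]]]] := smooth_step (t - 2 * h) h0 eta0.
have ifg := integrable_f_gdens (fun x => (andP (f01 x)).1)
  (fun x => (andP (f01 x)).2) fd.
have gm : N (t - 3 * h) - eta <= gmean f.
  apply: weighted_lower => //.
  - by move=> x; exact/ltW/gdens_gt0.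
  - exact: integrable_gdens.
  - by rewrite /Rintegral integral_normal_pdf.
  - exact: ltW.
  - by move=> x /=; rewrite in_itv/= => xt; apply: fl; lra.
have /cvgrPdist_le/(_ _ eta0) zc := zeta_cvg f01 fd dfL.
have /cvgrPdist_le/(_ _ eta0) cl := close h0.
near=> n.
have zn : `|gmean f - \int[P n]_w f (zeta n w)| <= eta by near: n.
have cn : `|0 - fine (P n [set w | h < `|Y n w - zeta n w|])| <= eta by near: n.
have up : \int[P n]_w f (zeta n w) <= fine (P n [set w | zeta n w <= t - h]) + eta.
  rewrite -prE; last exact: mle.
  have -> : \int[P n]_w f (zeta n w) = \int[P n]_w (f (zeta n w) * 1).
    by apply: eq_Rintegral => w _; rewrite mulr1.
  apply: weighted_upper => //.
  - exact: mle.
  - exact: integrable_const.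
  - exact: fint f01 fd n.
  - exact: Rintegral_const.
  - exact: ltW.
  - by move=> w /= /negP; rewrite -ltNge => zw; apply: fr; lra.
have inc : fine (P n [set w | zeta n w <= t - h]) <=
    fine (P n [set w | Y n w <= t]) +
    fine (P n [set w | h < `|Y n w - zeta n w|]).
  apply: pr_le; [exact: mle|exact: mle|exact: mfar|].
  move=> w /= zt; have [yz|yz] := ltP h `|Y n w - zeta n w|; first by right.
  by left; move: yz; rewrite ler_norml => /andP[_ yz]; lra.
move: zn cn; rewrite sub0r normrN !ler_norml => /andP[z1 z2] /andP[c1 c2].
move: inc up gm N1 z2 c2.
set a := fine _; set b := fine _; set c := fine _; set E := \int[P n]_w _.
by rewrite /eta; lra.
Unshelve. all: by end_near. Qed.

Lemma cvg_normal_of_smooth (t : R) : {for t, continuous N} ->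
  fine (P n [set w | Y n w <= t]) @[n --> \oo] --> N t.
Proof.
move=> Nt; apply/cvgrPdist_le => /= e e0; near=> n.
rewrite ler_norml; apply/andP; split.
  rewrite lerNl opprB lerBlDr addrC; near: n; exact: upper.
rewrite lerBlDr -lerBlDl; near: n; exact: lower.
Unshelve. all: by end_near. Qed.

End convergence_to_normal.

(** * The random matrices *)

Section image_law.
Context d d' (T : measurableType d) (T' : measurableType d') (R : realType).
Context (P : probability T R) (F : probability T' R) (X : T -> T').
Hypothesis mX : measurable_fun setT X.
Hypothesis X_law : forall B : set T', measurable B -> P [set w | B (X w)] = F B.

Lemma law_ge0_integral (phi : T' -> R) : measurable_fun setT phi ->
  (forall x, 0 <= phi x) ->
  (\int[P]_w (phi (X w))%:E = \int[F]_x (phi x)%:E)%E.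
Proof.
move=> mphi phi0.
rewrite -(@eq_measure_integral _ _ _ setT F (pushforward P X)); last first.
  by move=> B mB _; exact: X_law.
rewrite ge0_integral_pushforward//; first exact/measurable_EFinP.
by move=> x _; rewrite lee_fin.
Qed.

Lemma law_Rintegral (phi : T' -> R) : measurable_fun setT phi ->
  P.-integrable setT (EFin \o (fun w => phi (X w))) ->
  \int[P]_w phi (X w) = \int[F]_x phi x.
Proof.
move=> mphi iphi; congr fine.
rewrite -(@eq_measure_integral _ _ _ setT F (pushforward P X)); last first.
  by move=> B mB _; exact: X_law.
rewrite integral_pushforward//; exact/measurable_EFinP.
Qed.

Lemma law_ge0_integrable (phi : T' -> R) (c : R) : measurable_fun setT phi ->
    (forall x, 0 <= phi x) -> (\int[F]_x (phi x)%:E <= c%:E)%E ->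
  P.-integrable setT (EFin \o (fun w => phi (X w))).
Proof.
move=> mphi phi0 le; apply/integrableP; split.
  by apply/measurable_EFinP; exact: measurableT_comp.
under eq_integral do rewrite /= ger0_norm//.
by rewrite law_ge0_integral// (le_lt_trans le)// ltry.
Qed.

End image_law.

Section centered_law.
Context d (T : measurableType d) (R : realType) (P : probability T R).
Variables (X : T -> R) (F : probability (measurableTypeR R) R) (mu s : R).
Hypothesis mX : measurable_fun setT X.
Hypothesis X_law : forall B : set R, measurable B -> P [set w | B (X w)] = F B.
Hypothesis F_mean : ('E_F[idfun] = mu%:E)%E.
Hypothesis F_var : ('V_F[idfun] = (s ^+ 2)%:E)%E.

Let mcentered : measurable_fun setT (fun x : R => x - mu).
Proof. exact: measurable_funB. Qed.

Let F_sqr : (\int[F]_x ((x - mu) ^+ 2)%:E = (s ^+ 2)%:E)%E.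
Proof.
rewrite -F_var /variance unlock F_mean /= unlock.
by apply: eq_integral => x _; rewrite /= expr2.
Qed.

Let F_iX : F.-integrable setT (EFin \o (fun x : R => x - mu)).
Proof.
apply: (@integrable_dominated _ (measurableTypeR R) R F (fun x => x - mu)
  (fun x => 1 + (x - mu) ^+ 2)) => //.
  move=> x; rewrite -(real_normK (num_real (x - mu))).
  by have := sqr_ge0 (`|x - mu| - 1); nra.
apply: integrable_add; first exact: integrable_const.
apply/integrableP; split; first by apply/measurable_EFinP; exact: measurable_funX.
under eq_integral do rewrite /= ger0_norm ?sqr_ge0//.
by rewrite F_sqr ltry.
Qed.

(** Integrability is read off from the finite variance through [|x - mu| <= 1 + (x - mu) ^ 2]. *)
Lemma centered_moments :
  [/\ P.-integrable setT (EFin \o (fun w => X w - mu)),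
      \int[P]_w (X w - mu) = 0,
      P.-integrable setT (EFin \o (fun w => (X w - mu) ^+ 2)) &
      \int[P]_w ((X w - mu) ^+ 2) = s ^+ 2].
Proof.
have msq : measurable_fun setT (fun x : R => (x - mu) ^+ 2) by exact: measurable_funX.
have i2 : P.-integrable setT (EFin \o (fun w => (X w - mu) ^+ 2)).
  apply: (@law_ge0_integrable _ _ T (measurableTypeR R) R P F X mX X_law
    (fun x => (x - mu) ^+ 2) (s ^+ 2)) => //.
    by move=> x; exact: sqr_ge0.
  by rewrite F_sqr.
have i1 : P.-integrable setT (EFin \o (fun w => X w - mu)).
  apply: (@integrable_dominated _ _ _ _ _ (fun w => 1 + (X w - mu) ^+ 2)) => //.
  - exact: measurable_funB.
  - move=> w; rewrite -(real_normK (num_real (X w - mu))).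
    by have := sqr_ge0 (`|X w - mu| - 1); nra.
  - by apply: integrable_add => //; exact: integrable_const.
split => //.
- have FX : F.-integrable setT (EFin \o (fun x : R => x)).
    have := integrable_add F_iX (integrable_const F mu).
    by under eq_fun do rewrite subrK.
  rewrite (@law_Rintegral _ _ T (measurableTypeR R) R P F X mX X_law (fun x => x - mu))//.
  rewrite RintegralB//; last exact: integrable_const.
  rewrite Rintegral_const /Rintegral (_ : (\int[F]_x x%:E)%E = mu%:E) ?subrr//.
  by rewrite -F_mean unlock.
- rewrite /Rintegral (@law_ge0_integral _ _ T (measurableTypeR R) R P F X mX X_law
    (fun x => (x - mu) ^+ 2))//.
    by rewrite F_sqr.
  by move=> x; exact: sqr_ge0.
Qed.

End centered_law.

(** Transports the moment bound, stated for one entry, to every entry with the same law. *)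
Lemma law_ge0_Rintegral d d' e (T : measurableType d) (T' : measurableType d')
    (U : measurableType e) (R : realType) (P : probability T R)
    (P' : probability T' R) (F : probability U R) (X : T -> U) (X' : T' -> U)
    (c : R) (phi : U -> R) :
    measurable_fun setT X -> measurable_fun setT X' ->
    (forall B : set U, measurable B -> P [set w | B (X w)] = F B) ->
    (forall B : set U, measurable B -> P' [set w | B (X' w)] = F B) ->
    measurable_fun setT phi -> (forall x, 0 <= phi x) ->
    ('E_P[fun w => phi (X w)] <= c%:E)%E ->
  P'.-integrable setT (EFin \o (fun w => phi (X' w))) /\
  \int[P']_w phi (X' w) <= c.
Proof.
move=> mX mX' lX lX' mphi phi0; rewrite unlock (law_ge0_integral mX lX)// => le.
have i := law_ge0_integrable mX' lX' mphi phi0 le.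
split => //; rewrite -lee_fin /Rintegral fineK; last exact: integrable_fin_num.
by rewrite (law_ge0_integral mX' lX').
Qed.

Lemma markov_ge0 d (T : measurableType d) (R : realType) (P : probability T R)
    (Z : T -> R) (K : R) (E : set T) :
    (forall w, 0 <= Z w) -> P.-integrable setT (EFin \o Z) -> 0 < K ->
    measurable E -> (forall w, E w -> K <= Z w) ->
  fine (P E) <= (\int[P]_w Z w) / K.
Proof.
move=> Z0 iZ K0 mE KZ; rewrite ler_pdivlMr// mulrC.
have -> : K * fine (P E) = \int[P]_(w in E) K by rewrite Rintegral_cst.
rewrite Rintegral_mkcond; apply: Rintegral_le => //.
- rewrite -restrict_EFin; apply/integrable_restrict => //; rewrite setTI.
  by apply: integrableS (integrable_const P K).
- by move=> w; rewrite patchE; case: ifPn => // /set_mem; exact: KZ.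
Qed.

Lemma excess_stat_ge0 (R : realType) n (v : R) (M : 'I_n -> 'I_n -> R) :
  0 <= v -> 0 <= excess_stat v M.
Proof.
move=> v0; rewrite /excess_stat; apply: addr_ge0; apply: divr_ge0.
- rewrite !addr_ge0 ?sqr_ge0 ?sumr_ge0// => i _; rewrite ?sqr_ge0//.
  by apply: sumr_ge0 => j _; rewrite sqr_ge0.
- by apply: mulr_ge0; rewrite exprn_ge0.
- by apply: addr_ge0; rewrite sqr_ge0.
- by apply: mulr_ge0; rewrite ?exprn_ge0.
Qed.

Lemma card_edges n : (#|[set ij : 'I_n * 'I_n | (ij.1 < ij.2)%N]%SET| * 2 = n * n.-1)%N.
Proof.
have -> : #|[set ij : 'I_n * 'I_n | (ij.1 < ij.2)%N]%SET| = 'C(n, 2).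
  rewrite -sum1_card (eq_bigl (fun ij : 'I_n * 'I_n => (ij.1 < ij.2)%N)); last first.
    by move=> ij; rewrite inE.
  rewrite -(pair_big_dep xpredT (fun i j : 'I_n => (i < j)%N) (fun _ _ => 1%N))/=.
  rewrite (exchange_big_dep xpredT)//= -bin2_sum big_mkord; apply: eq_bigr => j _.
  rewrite -(big_ord_widen n (fun=> 1%N)); last exact: ltnW.
  by rewrite sum1_card card_ord.
by rewrite mulnC -(mul_bin_diag n 1) bin1.
Qed.

Section random_matrix.
Context d (T : measurableType d) (R : realType) (P : probability T R) (n : nat).
Context (F : probability (measurableTypeR R) R).
Variables (A : T -> 'M[R]_n) (mu s c : R).
Hypothesis mA : forall i j, measurable_fun setT (fun w => A w i j).
Hypothesis A_sym : forall w, (A w)^T = A w.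
Let D := [set ij : 'I_n * 'I_n | (ij.1 < ij.2)%N]%SET.
Let X (e : 'I_n * 'I_n) w := A w e.1 e.2.
Hypothesis A_indep : mutually_independent P D X.
Hypothesis A_law : forall i j : 'I_n, (i < j)%N ->
  forall B : set R, measurable B -> P [set w | B (A w i j)] = F B.
Hypothesis F_mean : ('E_F[idfun] = mu%:E)%E.
Hypothesis F_var : ('V_F[idfun] = (s ^+ 2)%:E)%E.
Hypothesis A_moments : forall i j : 'I_n, i = 0%N :> nat -> j = 1%N :> nat ->
  forall k, (3 <= k)%N -> ('E_P[fun w => (`|A w i j - mu| ^+ k)%R] <=
    (k`!%:R / 2 * c ^+ (k - 2) * s ^+ 2)%:E)%E.
Hypothesis s0 : 0 < s.
Hypothesis n2 : (1 < n)%N.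

Local Notation L1 X := (P.-integrable setT (EFin \o X)).
Let v := s ^+ 2.

Let abs_moment k e : (3 <= k)%N -> e \in D ->
  L1 (fun w => `|X e w - mu| ^+ k) /\
  \int[P]_w (`|X e w - mu| ^+ k) <= k`!%:R / 2 * c ^+ (k - 2) * s ^+ 2.
Proof.
move=> k3; rewrite inE => e12.
pose i0 := Ordinal (ltnW n2); pose j0 := Ordinal n2.
apply: (@law_ge0_Rintegral _ _ _ T T (measurableTypeR R) R P P F
  (fun w => A w i0 j0) (X e) _ (fun x : R => `|x - mu| ^+ k)).
- exact: mA.
- exact: mA.
- exact: A_law.
- exact: A_law.
- apply: measurable_funX.
  apply: (measurableT_comp (@normr_measurable R setT)).
  exact: measurable_funB.
- by move=> x; rewrite exprn_ge0.
- exact: A_moments.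
Qed.

Let centered e (eD : e \in D) : [/\ L1 (fun w => X e w - mu),
  \int[P]_w (X e w - mu) = 0, L1 (fun w => (X e w - mu) ^+ 2) &
  \int[P]_w ((X e w - mu) ^+ 2) = v].
Proof.
apply: (centered_moments (mA e.1 e.2) _ F_mean F_var).
by apply: A_law; move: eD; rewrite inE.
Qed.

Let xi4E e : (fun w => (X e w - mu) ^+ 4) = (fun w => `|X e w - mu| ^+ 4).
Proof.
by apply/funext => w; rewrite -normrX ger0_norm// exprn_even_ge0.
Qed.

Let xi4 e : e \in D -> L1 (fun w => (X e w - mu) ^+ 4).
Proof. by move=> eD; rewrite xi4E; have [] := abs_moment (k := 4) isT eD. Qed.

Let xi_m4 e : e \in D -> \int[P]_w ((X e w - mu) ^+ 4) <= 12 * c ^+ 2 * v.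
Proof.
move=> eD; rewrite xi4E; have [_] := abs_moment (k := 4) isT eD.
by rewrite (_ : 4`!%:R / 2 = 12 :> R)// (_ : 4`! = 24)%N//; field.
Qed.

Let xi_m3 e : e \in D -> \int[P]_w (`|X e w - mu| ^+ 3) <= 3 * c * s ^+ 2.
Proof.
move=> eD; have [_] := abs_moment (k := 3) isT eD.
by rewrite (_ : 3`!%:R / 2 = 3 :> R) ?expr1// (_ : 3`! = 6)%N//; field.
Qed.

(** The event is arbitrary because the bound is applied to the failure of the approximation, which
    is only contained in a superlevel set of the statistic. *)
Lemma excess_stat_markov (K : R) (E : set T) : 1 <= n%:R * s ^+ 2 -> 0 < K ->
    measurable E ->
    (forall w, E w -> K <= excess_stat (s ^+ 2) (centered_mx A mu w)) ->
  fine (P E) <= (72 * c ^+ 2 + 11) / K.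
Proof.
move=> nv K0 mE KE.
have kap0 : 0 <= 12 * c ^+ 2 by rewrite mulr_ge0 ?sqr_ge0.
have [iZ le] := excess_stat_expectation mA A_sym A_indep (sqr_ge0 s) kap0 xi4
  (fun e eD => let: And4 _ h _ _ := centered eD in h)
  (fun e eD => let: And4 _ _ _ h := centered eD in h) xi_m4 nv.
apply: (le_trans (markov_ge0 _ iZ K0 mE KE)).
  by move=> w; rewrite excess_stat_ge0 ?sqr_ge0.
rewrite ler_pM2r ?invr_gt0//; apply: (le_trans le).
by rewrite mulrA (_ : 6 * 12 = 72 :> R)// -natrM.
Qed.

Lemma edgesum_stein (g dg f : R -> R) (C m : R) : 0 <= C -> 0 <= c ->
    (forall x : R, is_derive x (1 : R) g (dg x)) ->
    (forall x, 2 * dg x - x * g x = f x - m) ->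
    (forall x, `|g x| <= C) -> (forall x, `|dg x| <= C) ->
    (forall x y, `|dg x - dg y| <= C * `|x - y|) ->
    measurable_fun setT f -> (forall x, 0 <= f x <= 1) ->
  `|\int[P]_w f (2 * edgesum (centered_mx A mu w) / (n%:R * s)) - m| <=
    2 / n%:R * C + 4 * C * (3 * c / (n%:R * s) + n%:R^-1).
Proof.
move=> C0 c0 dgP eqf gC dgC lip mf f01.
have n0 : 0 < n%:R :> R by rewrite ltr0n ltnW.
pose b := 2 / (n%:R * s).
have b0 : 0 <= b by rewrite divr_ge0 ?mulr_ge0 ?ltW.
have zE w : 2 * edgesum (centered_mx A mu w) / (n%:R * s) =
    \sum_(e in D) b * (X e w - mu).
  rewrite -mulr_sumr mulrAC; congr (_ * _); rewrite /edgesum.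
  rewrite [RHS](eq_bigl (fun e : 'I_n * 'I_n => (e.1 < e.2)%N)); last by move=> e; rewrite inE.
  by apply: eq_bigr => e e12; rewrite /centered_mx -val_eqE/= ltn_eqF.
under eq_Rintegral do rewrite zE.
have L1f : L1 (fun w => f (\sum_(e in D) b * (X e w - mu))).
  apply: (@integrable_dominated _ _ _ _ _ (fun=> 1)).
  - apply: measurableT_comp => //; apply: measurable_fsum => e _.
    by apply: measurable_funM => //; apply: measurable_funB => //; exact: mA.
  - by move=> w; set x := \sum_(e in D) _; have /andP[h1 h2] := f01 x; rewrite ger0_norm.
  - exact: integrable_const.
have := stein_bound (fun e => mA e.1 e.2) A_indep s0 xi4
  (fun e eD => let: And4 _ h _ _ := centered eD in h)
  (fun e eD => let: And4 _ _ _ h := centered eD in h) xi_m3 C0 dgP gC dgC lip b0 eqf L1f.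
move=> /le_trans; apply.
(* The variance of the normalised sum over [n * (n - 1) / 2] edges; the missing diagonal costs
   [2 / n]. *)
have -> : #|D|%:R * (b ^+ 2 * s ^+ 2) = 2 - 2 / n%:R :> R.
  have h : #|D|%:R * 2 = n%:R * (n%:R - 1) :> R.
    have -> : n%:R - 1 = n.-1%:R :> R by rewrite -subn1 natrB// ltnW.
    by rewrite -!natrM card_edges.
  rewrite /b (_ : _ * _ = #|D|%:R * 2 * (2 / n%:R ^+ 2)); last first.
    by field; rewrite gt_eqF// gt_eqF.
  by rewrite h; field; rewrite gt_eqF.
have q1 : 0 <= 2 / n%:R :> R by rewrite divr_ge0// ltW.
rewrite subKr (ger0_norm q1) lerD2l.
have -> : 4 * C * (3 * c / (n%:R * s) + n%:R^-1) = 2 * (C * b * (3 * c + s)).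
  by rewrite /b; field; rewrite !gt_eqF.
have q0 : 0 <= C * b * (3 * c + s).
  apply: mulr_ge0; first exact: mulr_ge0.
  by rewrite addr_ge0 ?mulr_ge0// ltW.
by rewrite ler_wpM2r// lerBlDr lerDl.
Qed.

End random_matrix.

(** * Growth rates *)

Lemma cvg_inv_nat (R : realType) : n%:R^-1 @[n --> \oo] --> (0 : R).
Proof.
apply/cvgrPdist_le => /= e e0; near=> n.
have h : e^-1 <= n%:R by near: n; exact: nbhs_infty_ger.
have n0 : 0 < n%:R :> R by apply: lt_le_trans h; rewrite invr_gt0.
rewrite sub0r normrN gtr0_norm ?invr_gt0//.
by rewrite -[leRHS]invrK lef_pV2 ?posrE ?invr_gt0.
Unshelve. all: by end_near. Qed.

Section growth_rates.
Context {R : realType} (mu sigma : nat -> R).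
Hypothesis mu_bigO : mu =O_\oo (fun=> 1 : R).
Hypothesis mu_omega : little_omega mu
  (fun n => ln n%:R `^ (2 / 3) / n%:R `^ (1 / 3)).
Hypothesis sigma_lb : exists2 c0 : R, 0 < c0 &
  forall n, (0 < n)%N -> n%:R `^ (- (1 / 2) + c0) <= sigma n.
Hypothesis sigma_mu_bigO : (fun n => sigma n ^+ 2 / mu n) =O_\oo (fun=> 1 : R).

Let sn n : R := Num.sqrt n%:R.
Let t n := sigma n / (sn n * mu n).

Lemma sigma_gt0 n : (0 < n)%N -> 0 < sigma n.
Proof.
move=> n0; have [c0 _ lb] := sigma_lb; apply: lt_le_trans (lb n n0).
by apply: powR_gt0; rewrite ltr0n.
Qed.

(** The cube of the rate in [mu_omega] is [ln n ^ 2 / n], so [n * mu n ^ 3 >= L ^ 3 * ln n ^ 2 >= L]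
    once [n >= expR 1]. *)
Lemma mean_cube_large (L : R) : 1 <= L ->
  \forall n \near \oo, 0 < mu n /\ L <= n%:R * mu n ^+ 3.
Proof.
move=> L1; have /cvgryPge/(_ L) om := mu_omega.
have n1 : \forall n \near \oo, expR 1 <= n%:R :> R by exact: nbhs_infty_ger.
near=> n.
have ne : expR 1 <= n%:R :> R by near: n.
have n0 : 0 < n%:R :> R by apply: lt_le_trans ne; exact: expR_gt0.
have ln1 : 1 <= ln n%:R :> R by rewrite -[leLHS]expRK ler_ln ?posrE ?expR_gt0.
have cube (a x : R) : 0 <= a -> (a `^ x) ^+ 3 = a `^ (x * 3).
  by move=> a0; rewrite -powR_mulrn ?powR_ge0// -powRrM.
have gL : L <= mu n / (ln n%:R `^ (2 / 3) / n%:R `^ (1 / 3)) by near: n.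
pose g : R := ln n%:R `^ (2 / 3) / n%:R `^ (1 / 3).
have g0 : 0 < g by rewrite divr_gt0 ?powR_gt0// (lt_le_trans _ ln1).
have g3 : 1 <= n%:R * g ^+ 3.
  rewrite /g expr_div_n !cube ?(le_trans _ ln1) ?(ltW n0)// !divfK//.
  rewrite powRr1 ?(ltW n0)// mulrCA divff ?gt_eqF// mulr1 powR_mulrn ?(le_trans _ ln1)//.
  exact: exprn_ege1.
have Lg : L * g <= mu n.
  by rewrite -ler_pdivlMr.
have L0 : 0 <= L by apply: le_trans L1.
split; first by apply: lt_le_trans Lg; rewrite mulr_gt0// (lt_le_trans _ L1).
have h : (L * g) ^+ 3 <= mu n ^+ 3.
  have Lg0 : 0 <= L * g by apply: mulr_ge0 => //; exact: ltW.
  by apply: lerXn2r => //; rewrite nnegrE// (le_trans Lg0).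
apply: le_trans (ler_wpM2l (ltW n0) h).
rewrite exprMn mulrCA; apply: (@le_trans _ _ (L ^+ 3)).
  by rewrite exprS ler_peMr// exprn_ege1.
by rewrite ler_peMr// exprn_ge0.
Unshelve. all: by end_near. Qed.

Lemma mean_bounded : exists2 C : R, 1 <= C &
  \forall n \near \oo, [/\ 0 < mu n, mu n <= C & sigma n ^+ 2 <= C * mu n].
Proof.
have /eqO_exP[C1 C10 H1] := mu_bigO; have /eqO_exP[C2 C20 H2] := sigma_mu_bigO.
exists (1 + C1 + C2); first by rewrite -addrA lerDl addr_ge0// ltW.
have H3 := mean_cube_large (lexx 1).
near=> n.
have [mu0 _] : 0 < mu n /\ 1 <= n%:R * mu n ^+ 3 by near: n.
have h1 : `|mu n| <= C1 * `|1 : R| by near: n.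
have h2 : `|sigma n ^+ 2 / mu n| <= C2 * `|1 : R| by near: n.
move: h1 h2; rewrite normr1 !mulr1 => /(le_trans (ler_norm _)) h1.
move=> /(le_trans (ler_norm _)); rewrite ler_pdivrMr// => h2.
split => //; first by rewrite (le_trans h1)// addrAC lerDr addr_ge0// ltW.
apply: (le_trans h2); rewrite ler_pM2r// lerDr addr_ge0// ltW//.
Unshelve. all: by end_near. Qed.

(** [n * mu ^ 3] is [mu] times the square of this quantity, and [mu] is bounded. *)
Lemma sqrt_mean_large (K : R) : \forall n \near \oo, K <= sn n * mu n.
Proof.
have [C C1 HC] := mean_bounded.
pose K' := 1 + `|K|.
have K'1 : 1 <= K' by rewrite lerDl.
have C0 : 0 < C by apply: lt_le_trans C1.
have L1 : 1 <= C * K' ^+ 2.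
  by rewrite -[leLHS]mulr1 ler_pM// exprn_ege1.
have HL := mean_cube_large L1.
near=> n.
have [mu0 muC _] : [/\ 0 < mu n, mu n <= C & sigma n ^+ 2 <= C * mu n] by near: n.
have [_ h] : 0 < mu n /\ C * K' ^+ 2 <= n%:R * mu n ^+ 3 by near: n.
apply: (@le_trans _ _ K'); first by rewrite (le_trans (ler_norm K))// lerDr.
have q0 : 0 <= sn n * mu n by rewrite mulr_ge0 ?sqrtr_ge0// ltW.
rewrite -(@ler_pXn2r _ 2)//; last by rewrite nnegrE (le_trans _ K'1).
rewrite exprMn sqr_sqrtr// -(ler_pM2l C0); apply: (le_trans h).
rewrite (_ : n%:R * mu n ^+ 3 = mu n * (n%:R * mu n ^+ 2)); last by ring.
by rewrite ler_wpM2r// mulr_ge0 ?sqr_ge0.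
Unshelve. all: by end_near. Qed.

Lemma variance_large (K : R) : \forall n \near \oo, K <= n%:R * sigma n ^+ 2.
Proof.
have [c0 c00 lb] := sigma_lb.
near=> n.
have Kn : 1 + `|K| `^ (2 * c0)^-1 <= n%:R by near: n; exact: nbhs_infty_ger.
have n1 : 1 <= n%:R :> R by apply: le_trans Kn; rewrite lerDl powR_ge0.
have n0 : 0 < n%:R :> R by apply: lt_le_trans n1.
have cc : 0 < 2 * c0 by rewrite mulr_gt0.
apply: (@le_trans _ _ (n%:R `^ (2 * c0))).
  apply: (le_trans (ler_norm K)).
  have -> : `|K| = (`|K| `^ (2 * c0)^-1) `^ (2 * c0).
    by rewrite -powRrM mulVf ?gt_eqF// powRr1.
  apply: ge0_ler_powR; rewrite ?nnegrE ?powR_ge0 ?(ltW cc) ?(ltW n0)//.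
  apply: ltW.
  by apply: lt_le_trans Kn; rewrite ltrDr.
have h := lb n _; rewrite -(ltr0n R) in h; have {}h := h n0.
have -> : n%:R `^ (2 * c0) = n%:R * (n%:R `^ (- (1 / 2) + c0)) ^+ 2.
  rewrite -powR_mulrn ?powR_ge0// -powRrM -[X in _ = X * _](powRr1 (ltW n0)).
  rewrite -powRD; last by rewrite (gt_eqF n0) implybT.
  by congr (_ `^ _); field.
rewrite ler_pM2l// lerXn2r ?nnegrE ?powR_ge0// (le_trans _ h)// powR_ge0.
Unshelve. all: by end_near. Qed.

Lemma sn_ge1 n : (0 < n)%N -> 1 <= sn n.
Proof. by move=> n0; rewrite -sqrtr1 /sn ler_sqrt// ler1n. Qed.

Lemma relative_fluctuation n : 0 < mu n -> 0 < n%:R :> R ->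
  sn n * t n ^+ 2 = sigma n ^+ 2 / mu n * (sn n * mu n)^-1.
Proof.
move=> mu0 n0; rewrite /t.
have s0 : 0 < sn n by rewrite sqrtr_gt0.
by field; rewrite !gt_eqF.
Qed.

(** A bounded factor [sigma ^ 2 / mu] times the vanishing [1 / (sqrt n * mu)]. *)
Lemma cvg_fluctuation_sqr : sn n * t n ^+ 2 @[n --> \oo] --> (0 : R).
Proof.
have [C C1 HC] := mean_bounded.
apply/cvgrPdist_le => /= e e0.
have HL := sqrt_mean_large (C / e).
near=> n.
have [mu0 muC sC] : [/\ 0 < mu n, mu n <= C & sigma n ^+ 2 <= C * mu n] by near: n.
have n0 : 0 < n%:R :> R by rewrite ltr0n; near: n; exact: nbhs_infty_gt.
have h : C / e <= sn n * mu n by near: n.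
have C0 : 0 < C by apply: lt_le_trans C1.
have q0 : 0 < sn n * mu n by apply: lt_le_trans h; rewrite divr_gt0.
rewrite sub0r normrN ger0_norm; last by rewrite mulr_ge0 ?sqrtr_ge0 ?sqr_ge0.
rewrite relative_fluctuation// ler_pdivrMr//.
apply: (@le_trans _ _ C); first by rewrite ler_pdivrMr.
by rewrite mulrC -ler_pdivrMr.
Unshelve. all: by end_near. Qed.

Lemma cvg_fluctuation : t n @[n --> \oo] --> (0 : R).
Proof.
apply/cvgrPdist_le => /= e e0.
have e20 : 0 < e ^+ 2 by rewrite exprn_gt0.
have /cvgrPdist_le/(_ _ e20) H := cvg_fluctuation_sqr.
near=> n.
have n0 : (0 < n)%N by near: n; exact: nbhs_infty_gt.
have : `|0 - sn n * t n ^+ 2| <= e ^+ 2 by near: n.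
have h0 : 0 <= sn n * t n ^+ 2 by rewrite mulr_ge0 ?sqrtr_ge0 ?sqr_ge0.
rewrite !sub0r !normrN (ger0_norm h0) => h.
rewrite -(@ler_pXn2r _ 2) ?nnegrE ?(ltW e0)// real_normK ?num_real//.
by apply: le_trans h; rewrite ler_peMl ?sqr_ge0// sn_ge1.
Unshelve. all: by end_near. Qed.

(** Equivalent to [mu <= sqrt n * sigma], where the left side is bounded and the right side tends to
    infinity by the lower bound on [sigma]. *)
Lemma inv_le_fluctuation : \forall n \near \oo, n%:R^-1 <= t n.
Proof.
have [C C1 HC] := mean_bounded.
have HL := variance_large (C ^+ 2).
near=> n.
have [mu0 muC sC] : [/\ 0 < mu n, mu n <= C & sigma n ^+ 2 <= C * mu n] by near: n.
have n0 : (0 < n)%N by near: n; exact: nbhs_infty_gt.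
have h : C ^+ 2 <= n%:R * sigma n ^+ 2 by near: n.
have C0 : 0 <= C by apply: le_trans C1.
have sn0 : 0 < sn n by rewrite sqrtr_gt0 ltr0n.
have muS : mu n <= sn n * sigma n.
  apply: (le_trans muC).
  rewrite -(@ler_pXn2r _ 2)// ?nnegrE// ?mulr_ge0 ?(ltW sn0) ?(ltW (sigma_gt0 n0))//.
  by rewrite exprMn sqr_sqrtr.
have nE : n%:R = sn n * sn n by rewrite -expr2 /sn sqr_sqrtr// ler0n.
rewrite /t ler_pdivlMr ?mulr_gt0// nE invfM -mulrA mulKf ?gt_eqF//.
by rewrite mulrC ler_pdivrMr// mulrC.
Unshelve. all: by end_near. Qed.

Lemma cvg_inv_size_mean : (n%:R * mu n)^-1 @[n --> \oo] --> (0 : R).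
Proof.
apply/cvgrPdist_le => /= e e0.
have HL := sqrt_mean_large e^-1.
near=> n.
have n0 : (0 < n)%N by near: n; exact: nbhs_infty_gt.
have h : e^-1 <= sn n * mu n by near: n.
have q0 : 0 < sn n * mu n by apply: lt_le_trans h; rewrite invr_gt0.
have nE : n%:R = sn n * sn n by rewrite -expr2 /sn sqr_sqrtr// ler0n.
have h2 : e^-1 <= n%:R * mu n.
  rewrite nE -mulrA; apply: (le_trans h); rewrite ler_peMl ?(ltW q0)//.
  exact: sn_ge1.
rewrite sub0r normrN ger0_norm; last by rewrite invr_ge0 (le_trans _ h2)// invr_ge0 ltW.
rewrite -[leRHS]invrK lef_pV2 ?posrE ?invr_gt0//.
by apply: lt_le_trans h2; rewrite invr_gt0.
Unshelve. all: by end_near. Qed.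

Lemma cvg_inv_size_deviation : (n%:R * sigma n)^-1 @[n --> \oo] --> (0 : R).
Proof.
apply/cvgrPdist_le => /= e e0.
have HL := variance_large (e^-1 ^+ 2).
near=> n.
have n0 : (0 < n)%N by near: n; exact: nbhs_infty_gt.
have h : e^-1 ^+ 2 <= n%:R * sigma n ^+ 2 by near: n.
have s0 := sigma_gt0 n0.
have h2 : e^-1 <= n%:R * sigma n.
  rewrite -(@ler_pXn2r _ 2)// ?nnegrE ?invr_ge0 ?mulr_ge0 ?(ltW e0) ?(ltW s0)//.
  apply: (le_trans h); rewrite exprMn ler_wpM2r ?sqr_ge0//.
  by rewrite expr2 ler_peMl// ler1n.
rewrite sub0r normrN ger0_norm; last by rewrite invr_ge0 mulr_ge0// ltW.
rewrite -[leRHS]invrK lef_pV2 ?posrE ?invr_gt0//.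
by apply: lt_le_trans h2; rewrite invr_gt0.
Unshelve. all: by end_near. Qed.

End growth_rates.

Unset Implicit Arguments.
Theorem corollary2p14 (R : realType)
    (d : nat -> measure_display) (T : forall n, measurableType (d n))
    (P : forall n, probability (T n) R)
    (F : nat -> probability (measurableTypeR R) R)
    (mu sigma : nat -> R)
    (A : forall n, T n -> 'M[R]_n)
    (* F_n is supported on [0, oo), with mean mu_n and variance sigma_n^2 *)
    (F_supp : forall n, (0 < n)%N -> F n `[0, +oo[%classic = 1%E)
    (F_mean : forall n, (0 < n)%N -> ('E_(F n)[idfun] = (mu n)%:E)%E)
    (F_var : forall n, (0 < n)%N -> ('V_(F n)[idfun] = (sigma n ^+ 2)%:E)%E)
    (sigma_ge0 : forall n, (0 < n)%N -> 0 <= sigma n)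
    (* A_n is a symmetric random matrix *)
    (A_meas : forall n (i j : 'I_n), measurable_fun setT (fun w => A n w i j))
    (A_sym : forall n (w : T n), (A n w)^T = A n w)
    (* (i) *)
    (A_indep : forall n, mutually_independent (P n)
       [set ij : 'I_n * 'I_n | (ij.1 < ij.2)%N]%SET
       (fun ij w => A n w ij.1 ij.2))
    (A_law : forall n (i j : 'I_n), (i < j)%N ->
       forall B : set R, measurable B ->
         P n [set w | B (A n w i j)] = F n B)
    (A_diag : forall n (w : T n) (i : 'I_n), A n w i i = 0)
    (* (ii) *)
    (mu_bigO : mu =O_\oo (fun=> 1 : R))
    (mu_omega : little_omega mu
       (fun n => ln n%:R `^ (2 / 3) / n%:R `^ (1 / 3)))
    (sigma_lb : exists2 c0 : R, 0 < c0 &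
       forall n, (0 < n)%N -> n%:R `^ (- (1 / 2) + c0) <= sigma n)
    (sigma_mu_bigO : (fun n => sigma n ^+ 2 / mu n) =O_\oo (fun=> 1 : R))
    (* (iii); the indices i and j are the first two, so A n w i j is a_12 *)
    (A_moments : exists c : R, forall n (i j : 'I_n),
       i = 0%N :> nat -> j = 1%N :> nat -> forall k, (3 <= k)%N ->
       ('E_(P n)[fun w => (`|A n w i j - mu n| ^+ k)%R] <=
         (k`!%:R / 2 * c ^+ (k - 2) * sigma n ^+ 2)%:E)%E)
    (r : R) (r_ge2 : 2 <= r)
    (* Z is a Normal(0, 2) random variable; the second argument of
       [normal_prob] is the standard deviation *)
    (d' : measure_display) (T' : measurableType d') (Q : probability T' R)
    (Z : {RV Q >-> R})
    (Z_normal : forall B : set R, measurable B ->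
       distribution Q Z B = normal_prob 0 (Num.sqrt 2) B) :
  let p := r / (r - 1) in
  cvg_in_distribution P
    (fun n w => (sigma n)^-1 *
      (max_quad_form r (n%:R `^ (- (1 - 2 / r)) *: A n w) -
       alpha mu sigma p r n)) Z.
Proof.
move=> p.
have r0 : 0 < r by apply: lt_le_trans r_ge2.
have r1 : r - 1 != 0.
  by rewrite gt_eqF// subr_gt0; apply: lt_le_trans r_ge2; rewrite ltr1n.
pose Y n w := (sigma n)^-1 *
  (max_quad_form r (n%:R `^ (- (1 - 2 / r)) *: A n w) - alpha mu sigma p r n).
change (cvg_in_distribution P Y Z).
have mY n : measurable_fun setT (Y n).
  apply: measurable_funM => //; apply: measurable_funB => //.
  apply: measurable_max_quad_form => // i j.
  by under eq_fun do rewrite mxE; exact: measurable_funM.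
split => // t ct.
pose zeta n w := 2 * edgesum (centered_mx (A n) (mu n) w) / (n%:R * sigma n).
have mzeta n : measurable_fun setT (zeta n).
  apply: measurable_funM => //; apply: measurable_funM => //.
  apply: measurable_fsum => e _; rewrite /centered_mx; case: (e.1 == e.2).
    exact: measurable_cst.
  by apply: measurable_funB => //; exact: A_meas.
have s0 n (n0 : (0 < n)%N) : 0 < sigma n := sigma_gt0 sigma_lb n0.
have [c A_mom] := A_moments.
(* The sign of [c] follows from the third-moment bound at [n = 2], where the left side is
   nonnegative and [sigma 2] is positive. *)
have c0 : 0 <= c.
  have := A_mom 2%N ord0 ord_max erefl erefl 3%N isT.
  rewrite expr1 => /(le_trans (expectation_ge0 _ _)) h.
  have {h} : 0 <= 3`!%:R / 2 * c * sigma 2 ^+ 2.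
    by rewrite -lee_fin; apply: h => w; rewrite exprn_ge0.
  by rewrite pmulr_lge0 ?exprn_gt0 ?s0// pmulr_rge0// divr_gt0// ltr0n.
pose N (t : R) := \int[@lebesgue_measure R]_(x in `]-oo, t]) gdens x.
have cdfE : cdf Z = EFin \o N.
  apply/funext => u; rewrite /cdf Z_normal//.
  change (normal_prob 0 (Num.sqrt 2) `]-oo, u] =
    (fine (normal_prob 0 (Num.sqrt 2) `]-oo, u]))%:E).
  by rewrite fineK// fin_num_measure.
have Nt : {for t, continuous N}.
  by move: ct; rewrite /prop_for /continuous_at cdfE; exact: fine_cvg.
have mYt n : measurable [set w | Y n w <= t].
  rewrite (_ : [set w | _] = setT `&` Y n @^-1` `]-oo, t]); first exact: mY.
  by rewrite setTI; apply/seteqP; split => w /=; rewrite in_itv.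
rewrite cdfE; apply: cvg_EFin.
  by apply: nearW => n; exact: fin_num_measure.
apply: (cvg_normal_of_smooth mzeta mY _ _ Nt).
- move=> f df L f01 fd dfL.
  have [g [dg [C C0 [dgP eqf gC dgC lip]]]] := stein_equation_solvable
    (fun x => (andP (f01 x)).1) (fun x => (andP (f01 x)).2) fd dfL.
  have mf : measurable_fun setT f.
    apply: continuous_measurable_fun => x.
    apply: differentiable_continuous; apply/derivable1_diffP.
    by apply: ex_derive; exact: fd.
  pose err n : R := 2 / n%:R * C + 4 * C * (3 * c / (n%:R * sigma n) + n%:R^-1).
  have err0 : err n @[n --> \oo] --> (0 : R).
    have i0 : n%:R^-1 @[n --> \oo] --> (0 : R) by exact: cvg_inv_nat.
    have i1 := cvg_inv_size_deviation sigma_lb.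
    rewrite -[X in _ --> X](_ : 2 * 0 * C + 4 * C * (3 * c * 0 + 0) = 0 :> R); last by ring.
    apply: cvgD; first by apply: cvgM (cvg_cst _); apply: cvgM i0; exact: cvg_cst.
    apply: cvgM; first exact: cvg_cst.
    by apply: cvgD => //; apply: cvgM i1; exact: cvg_cst.
  apply/cvgrPdist_le => /= e e0.
  have /cvgrPdist_le/(_ _ e0) H := err0.
  near=> n.
  have n2 : (1 < n)%N by near: n; exact: nbhs_infty_gt.
  have : `|0 - err n| <= e by near: n.
  rewrite sub0r normrN distrC => /(le_trans (ler_norm _)); apply: le_trans.
  exact: (edgesum_stein (A_meas n) (A_indep n) (A_law n) (F_mean n (ltnW n2))
    (F_var n (ltnW n2)) (A_mom n) (s0 n (ltnW n2)) n2 C0 c0 dgP eqf gC dgC lip mf f01).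
- move=> del del0; apply/cvgrPdist_le => /= e e0.
  pose b := 72 * c ^+ 2 + 11.
  have b0 : 0 < b by rewrite ltr_wpDl// mulr_ge0 ?sqr_ge0.
  (* Chosen so that Markov's bound [b / K] is at most [e], while [K >= 1] as the expansion
     requires. *)
  pose K := 1 + b / e.
  have K1 : 1 <= K by rewrite lerDl divr_ge0 ?ltW.
  have K0 : 0 < K by apply: lt_le_trans K1.
  have bK : b / K <= e.
    by rewrite ler_pdivrMr// mulrDr mulr1 mulrCA divff ?gt_eqF// mulr1 lerDr ltW.
  have [C C0 expansion] := max_quad_form_expansion r_ge2 K1.
  pose sn n : R := Num.sqrt n%:R.
  pose tn n := sigma n / (sn n * mu n).
  have l1 : tn n @[n --> \oo] --> (0 : R) := cvg_fluctuation mu_bigO mu_omega sigma_mu_bigO.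
  have l2 : sn n * tn n ^+ 2 @[n --> \oo] --> (0 : R) :=
    cvg_fluctuation_sqr mu_bigO mu_omega sigma_mu_bigO.
  have l3 := cvg_inv_size_mean mu_bigO mu_omega sigma_mu_bigO.
  have c1 : C * tn n @[n --> \oo] --> (0 : R).
    by rewrite -(mulr0 C); apply: cvgM l1; exact: cvg_cst.
  have c2 : C * (sn n * tn n ^+ 2) ^+ 2 @[n --> \oo] --> (0 : R).
    rewrite -[X in _ --> X](_ : C * (0 * 0) = 0 :> R); last by rewrite !mulr0.
    by apply: cvgM; [exact: cvg_cst|exact: (cvgM l2 l2)].
  have c3 : C * (sn n * tn n ^+ 2) + K / (n%:R * mu n) + 6 * K * tn n
      @[n --> \oo] --> (0 : R).
    rewrite -[X in _ --> X](_ : C * 0 + K * 0 + 6 * K * 0 = 0 :> R); last by rewrite !mulr0 !addr0.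
    by apply: cvgD; [apply: cvgD|]; apply: cvgM; try exact: cvg_cst.
  have /cvgrPdist_le/(_ _ ltr01) H1 := c1.
  have /cvgrPdist_le/(_ _ ltr01) H2 := c2.
  have /cvgrPdist_le/(_ _ del0) H3 := c3.
  have [Cm Cm1 Hm] := mean_bounded mu_bigO mu_omega sigma_mu_bigO.
  have Hv := variance_large sigma_lb 1.
  have Ht := inv_le_fluctuation mu_bigO mu_omega sigma_lb sigma_mu_bigO.
  near=> n.
  have n2 : (1 < n)%N by near: n; exact: nbhs_infty_gt.
  have h1 : `|0 - C * tn n| <= 1 by near: n.
  have h2 : `|0 - C * (sn n * tn n ^+ 2) ^+ 2| <= 1 by near: n.
  have h3 : `|0 - (C * (sn n * tn n ^+ 2) + K / (n%:R * mu n) + 6 * K * tn n)| <= del.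
    by near: n.
  have [mu0 _ _] : [/\ 0 < mu n, mu n <= Cm & sigma n ^+ 2 <= Cm * mu n] by near: n.
  have nv : 1 <= n%:R * sigma n ^+ 2 by near: n.
  have nt : n%:R^-1 <= tn n by near: n.
  move: h1 h2 h3; rewrite !sub0r !normrN => h1 h2 h3.
  have n0 : (0 < n)%N by exact: ltnW.
  have sn0 : 0 < sn n by rewrite sqrtr_gt0 ltr0n.
  have snN : sn n ^+ 2 = n%:R by rewrite /sn sqr_sqrtr// ler0n.
  have sgE : sn n * mu n * tn n = sigma n.
    by rewrite /tn mulrC divfK// gt_eqF// mulr_gt0.
  rewrite ger0_norm ?fine_ge0//; apply: le_trans bK.
  apply: (excess_stat_markov (A_meas n) (A_sym n) (A_indep n) (A_law n)
    (F_mean n n0) (F_var n n0) (A_mom n) n2 nv K0).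
    rewrite (_ : [set w | _] =
        setT `&` (fun w => `|Y n w - zeta n w|) @^-1` `]del, +oo[).
      by apply: (measurableT_comp (@normr_measurable R setT)) => //; exact: measurable_funB.
    by rewrite setTI; apply/seteqP; split => w /=; rewrite in_itv/= andbT.
  (* By contraposition: where the statistic is below [K], the deterministic expansion brings [Y]
     within [del] of [zeta]. *)
  move=> w /=; apply: contraTT; rewrite -ltNge -leNgt => /ltW small.
  apply: le_trans h3; apply: le_trans (ler_norm _).
  have := expansion n (A n w) (mu n) (sn n) (tn n) n0 mu0 sn0 snN (A_sym n w)
    (A_diag n w) nt (le_trans (ler_norm _) h1).
  rewrite (_ : C * (n%:R * tn n ^+ 4) = C * (sn n * tn n ^+ 2) ^+ 2); last first.
    by rewrite -snN; ring.
  move=> /(_ (le_trans (ler_norm _) h2)); rewrite /= sgE => /(_ small).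
  rewrite (_ : (n%:R - 1) * mu n + sigma n ^+ 2 / ((r - 1) * mu n) = alpha mu sigma p r n)//.
  (* Since [p - 1 = 1 / (r - 1)], the coefficient in [alpha] is [2 / (r - 1)], and its 2 cancels the
     one in [2 * mu]. *)
  rewrite /alpha /p; congr (_ + _).
  by field; rewrite r1 gt_eqF.
Unshelve. all: by end_near. Qed.
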